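(* Assume $\overline{\Pi}_X^+\in\mathcal L^{(\alpha)}$ and fix $T>0$, $x\in[0,\infty)$ and $K\in(-\infty,\infty)$. Then for every $H\in\mathcal H_T$, $$\lim_{u\to\infty}\frac{E\big[H\big(X_{[0,\tau(u-x))},\,X\circ\theta_{\tau(u-x)}-c^u\big);\,X_{\tau(u-x)-}<K,\ A(u,x,T)\big]}{\overline{\Pi}_X^+(u)}=\int_{D\otimes D}H(w,w')\,\mu_K^T(dw)\otimes\nu_x^T(dw'),$$ where $A(u,x,T)=\{\tau(u-x)<T,\ \tau(u)-\tau(u-x)<T\}$.
   Context: Let $\alpha>0$ and let $X$ be a real-valued Lévy process with Lévy measure $\Pi_X$; $\Pi_X^+$ is its restriction to $(0,\infty)$ and $\overline{\Pi}_X^+(u)=\Pi_X((u,\infty))$. A distribution $F$ on $[0,\infty)$ is in $\mathcal L^{(\alpha)}$ if $\overline F(u)>0$ for all $u>0$ and $\overline F(u+y)/\overline F(u)\to e^{-\alpha y}$ as $u\to\infty$ for all real $y$; $\overline{\Pi}_X^+\in\mathcal L^{(\alpha)}$ means that for some $x_0>0$ with $\overline\Pi_X^+$ positive on $[x_0,\infty)$ the renormalized tail $\overline{\Pi}_X^+(u)/\overline{\Pi}_X^+(x_0)$, $u\ge x_0$, is the tail of a distribution in $\mathcal L^{(\alpha)}$. Path space: $E=\mathbb R\cup\{\Delta\}$ with $\Delta$ an isolated cemetery point; $D$ is the Skorohod space of right-continuous $E$-valued paths with left limits on $[0,\infty)$, with the σ-algebra $\mathcal F$ generated by the coordinates; $X$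 is realized as the coordinate process on $D$, $P_z$ is its law started at $z$, $P=P_0$, and $\theta_t$ is the shift $(\theta_t w)_s=w_{t+s}$. For $w\in D$: $\tau_z(w)=\inf\{t>0:w_t>z\}$, $\tau_\Delta(w)=\inf\{t>0:w_t=\Delta\}$, $w_{\tau_\Delta-}$ is the left limit of $w$ at $\tau_\Delta(w)$, $\overline w_t=\sup_{s\le t}w_s$. $\tau(u)=\tau_u(X)$. The killed path $w_{[0,r)}$ equals $w_t$ for $t<r$ and $\Delta$ for $t\ge r$; $c^x$ is the constant path equal to $x$; $(w-w')_t=w_t-w'_t$ if $t<\tau_\Delta(w)\wedge\tau_\Delta(w')$ and $\Delta$ otherwise. Measures on $\mathcal F\otimes\mathcal B([0,\infty))\otimes\mathcal B(\mathbb R)$: for $K\in(-\infty,\infty]$, $x\in[0,\infty]$, $\mu_K(dw,dt,d\phi)=I(\phi<K)e^{\alpha\phi}P(X_{[0,t)}\in dw,\,X_{t-}\in d\phi)\,dt$ and $\nu_x(dw',dr,dz)=I(z>-x)\alpha e^{-\alpha z}\,dz\,P_z(X\in dw',\tau(0)\in dr)$. $\mu_K^T$ and $\nu_x^T$ are the restrictions of $\mu_K,\nu_x$ to $D\times[0,T)\times\mathbb R$, and $\mu_K^T(dw)$, $\nu_x^T(dw')$ denote their marginals on $D$. The class $\mathcal H$: measurable $H:D\otimes D\to\mathbb R$ such that (i) $H(w,w')\exp\big(\tilde\gamma\, w_{\tau_\Delta-}I(w_{\tau_\Delta-}\le0)\big)$ is bounded for some $\tilde\gamma\in[0,\alpha)$,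 and (ii) for every $w\in D$, $z\mapsto G(w,z):=E_z[H(w,X);\tau(0)<\infty]$ is continuous a.e. on $(-\infty,\infty)$. $\mathcal H_T$ is the class of $H$ with $H(w,w')I(\tau_0(w')<T)\in\mathcal H$. *)

(* Defs.v *)
From HB Require Import structures.
From mathcomp Require Import all_boot all_order all_algebra.
From mathcomp Require Import all_classical all_reals all_analysis.
Set Implicit Arguments.
Unset Strict Implicit.
Unset Printing Implicit Defensive.
Import Order.TTheory GRing.Theory Num.Theory.
Import numFieldNormedType.Exports.
Local Open Scope classical_set_scope.
Local Open Scope ring_scope.

Section PathSpace.
Variable R : realType.

(* E = R u {Delta}, encoded as option R (None = Delta, isolated point). *)

Definition right_cont (w : R -> option R) (t : R) : Prop :=
  match w t with
  | Some a => forall e, 0 < e -> exists d, 0 < d /\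
       forall s, t <= s < t + d -> exists b, w s = Some b /\ `|b - a| < e
  | None => exists d, 0 < d /\ forall s, t <= s < t + d -> w s = None
  end.

Definition left_conv (w : R -> option R) (t l : R) : Prop :=
  forall e, 0 < e -> exists d, 0 < d /\
    forall s, t - d < s < t -> exists b, w s = Some b /\ `|b - l| < e.

Definition left_dead (w : R -> option R) (t : R) : Prop :=
  exists d, 0 < d /\ forall s, t - d < s < t -> w s = None.

(* cadlag E-valued paths on [0, oo); by convention w t = Delta for t < 0 *)
Definition cadlag (w : R -> option R) : Prop :=
  [/\ (forall t, t < 0 -> w t = None),
      (forall t, 0 <= t -> right_cont w t) &
      (forall t, 0 < t -> (exists l, left_conv w t l) \/ left_dead w t)].

Record Dpath := DPath { dval :> R -> option R ; dcadlag : cadlag dval }.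

Lemma cadlag_dead : cadlag (fun _ => None).
Proof.
split => //.
- by move=> t _; rewrite /right_cont; exists 1.
- by move=> t _; right; exists 1.
Qed.

Definition dead_path : Dpath := DPath cadlag_dead.

HB.instance Definition _ := gen_eqMixin Dpath.
HB.instance Definition _ := gen_choiceMixin Dpath.
HB.instance Definition _ := isPointed.Build Dpath dead_path.

Definition coord_sets : set (set Dpath) :=
  [set A | exists t : R, A = [set w : Dpath | dval w t = None] \/
     exists B : set R, measurable B /\
       A = [set w : Dpath | exists a, dval w t = Some a /\ B a]].

End PathSpace.

Notation D R := (g_sigma_algebraType (@coord_sets R)).

Section Functionals.
Variable R : realType.
Local Open Scope ereal_scope.

Definition leftlim (w : R -> option R) (t : R) : option R :=
  if pselect (exists l, left_conv w t l) is left _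
  then Some (xget 0%R [set l | left_conv w t l]) else None.

(* left limit at an extended time (None = Delta / undefined when infinite) *)
Definition leftlim_at (w : R -> option R) (r : \bar R) : option R :=
  if r is r0%:E then leftlim w r0 else None.

Definition tau (z : R) (w : R -> option R) : \bar R :=
  ereal_inf [set t%:E | t in [set t : R | (0 < t)%R /\
                                 exists a, w t = Some a /\ (z < a)%R]].

Definition tauD (w : R -> option R) : \bar R :=
  ereal_inf [set t%:E | t in [set t : R | (0 < t)%R /\ w t = None]].

Definition kill (w : R -> option R) (r : \bar R) : R -> option R :=
  fun t => if t%:E < r then w t else None.

Definition shift_sub (w : R -> option R) (r : \bar R) (u : R) : R -> option R :=
  fun s => if r is r0%:E then
             (if (s < 0)%R then None else omap (fun a => a - u)%R (w (r0 + s)%R))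
           else None.

(* a raw path seen as an element of D (all uses below are on cadlag paths) *)
Definition toD (f : R -> option R) : D R :=
  match pselect (cadlag f) with
  | left h => (DPath h : D R)
  | right _ => (dead_path R : D R)
  end.

Definition ind (b : bool) : R := if b then 1%R else 0%R.

(* X is a real-valued Levy process started at z under P z
   (coordinate process on D) *)
Definition levy_family (P : R -> probability (D R) R) : Prop :=
  [/\
      (forall z t, (0 <= t)%R -> P z [set w : D R | dval w t = None] = 0),
      P 0%R [set w : D R | dval w 0%R = Some 0%R] = 1,
      (forall (n : nat) (t : nat -> R) (B : nat -> set R),
         (0 <= t 0%N)%R -> (forall i, (t i <= t i.+1)%R) ->
         (forall i, measurable (B i)) ->
         P 0%R [set w : D R | forall i, (i < n)%N ->
             exists a b, dval w (t i.+1) = Some a /\ dval w (t i) = Some b /\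
                         B i (a - b)%R]
         = \big[*%E/1]_(i < n)
             P 0%R [set w : D R | exists a, dval w (t i.+1 - t i)%R = Some a /\ B i a]) &
      (forall z (n : nat) (t : nat -> R) (B : nat -> set R),
         (forall i, (0 <= t i)%R) -> (forall i, measurable (B i)) ->
         P z [set w : D R | forall i, (i < n)%N ->
                exists a, dval w (t i) = Some a /\ B i a]
         = P 0%R [set w : D R | forall i, (i < n)%N ->
                exists a, dval w (t i) = Some a /\ B i (a + z)%R])].

(* \overline{Pi}_X^+(u) = E[#{s in (0,1] : Delta X_s > u}], the tail of the
   Levy measure on (u, oo) (Levy measure = intensity of the jump measure) *)
Definition Pibar (P : R -> probability (D R) R) (u : R) : \bar R :=
  \int[P 0%R]_w
    (\esum_(s in [set s : R | (0 < s <= 1)%R /\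
        exists a b, dval w s = Some a /\ leftlim w s = Some b /\ (u < a - b)%R])
      1%E).

Definition Pibar_in_L (alpha : R) (P : R -> probability (D R) R) : Prop :=
  exists x0 : R, (0 < x0)%R /\
    (forall u, (x0 <= u)%R -> 0 < Pibar P u < +oo) /\
    (forall y : R, (fine (Pibar P (u + y)) / fine (Pibar P u))%R
                     @[u --> +oo%R] --> expR (- alpha * y)%R).

(* exp(gamma * w_{tau_Delta -} I(w_{tau_Delta -} <= 0)); taken to be 1 when
   w_{tau_Delta -} is undefined *)
Definition expfac (g : R) (w : R -> option R) : R :=
  match leftlim_at w (tauD w) with
  | Some v => if (v <= 0)%R then expR (g * v)%R else 1%R
  | None => 1%R
  end.

Definition in_H (P : R -> probability (D R) R) (alpha : R)
    (H : D R -> D R -> R) : Prop :=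
  [/\ measurable_fun setT (fun p : D R * D R => H p.1 p.2),
      (exists g M : R, (0 <= g < alpha)%R /\
         forall w w', (`|H w w' * expfac g w| <= M)%R) &
      (forall w : D R,
         let G := fun z : R =>
           fine (\int[P z]_w' (H w w' * ind (tau 0%R w' < +oo)%E)%:E) in
         (@lebesgue_measure R).-negligible
           [set z : R | ~ (G y @[y --> z] --> G z)])].

Definition in_HT (P : R -> probability (D R) R) (alpha T : R)
    (H : D R -> D R -> R) : Prop :=
  in_H P alpha (fun w w' => H w w' * ind (tau 0%R w' < T%:E)%E)%R.

Definition lhs_num (P : R -> probability (D R) R) (H : D R -> D R -> R)
    (T x K u : R) : \bar R :=
  \int[P 0%R]_w
    (let t1 := tau (u - x) w in
     H (toD (kill w t1)) (toD (shift_sub w t1 u))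
     * ind (if leftlim_at w t1 is Some phi then (phi < K)%R else false)
     * ind (t1 < T%:E)%E * ind (tau u w - t1 < T%:E)%E)%R%:E.

(* inner integral against mu_K^T(dw):
   int_0^T E[ H(X_{[0,t)}, w') I(X_{t-} < K) e^{alpha X_{t-}} ] dt *)
Definition mu_int (P : R -> probability (D R) R) (H : D R -> D R -> R)
    (alpha T K : R) (w' : D R) : \bar R :=
  \int[@lebesgue_measure R]_(t in `[0%R, T[%classic)
    \int[P 0%R]_w
      (H (toD (kill w t%:E)) w' *
       (if leftlim w t is Some phi then ind (phi < K)%R * expR (alpha * phi)
        else 0))%R%:E.

(* int_{D x D} H d(mu_K^T (x) nu_x^T), written as an iterated integral:
   int_{(-x,oo)} alpha e^{-alpha z} E_z[ (int H(w, X) mu_K^T(dw)); tau(0) < T ] dz *)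
Definition rhs (P : R -> probability (D R) R) (H : D R -> D R -> R)
    (alpha T x K : R) : \bar R :=
  \int[@lebesgue_measure R]_(z in `](- x)%R, +oo[%classic)
    ((alpha * expR (- alpha * z))%R%:E *
     \int[P z]_w' ((ind (tau 0%R w' < T%:E)%E)%:E * mu_int P H alpha T K w')).

End Functionals.

(* Main.v *)
Require Import Defs.
From HB Require Import structures.
From mathcomp Require Import all_boot all_order all_algebra finmap.
From mathcomp Require Import all_classical all_reals all_analysis.
From mathcomp Require Import measurable_realfun ring lra.
Set Implicit Arguments.
Unset Strict Implicit.
Unset Printing Implicit Defensive.
Import Order.TTheory GRing.Theory Num.Theory.
Import numFieldNormedType.Exports.
Local Open Scope classical_set_scope.
Local Open Scope ring_scope.

(* The post-[tau(u - x)] path is, by the strong Markov property, a fresh copy of the process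
   started from the overshoot, so the numerator is the mean of a kernel evaluated at the
   killed path and at the jump that crosses the level. By the compensation formula this mean
   is an integral against dt P(dw) Pi(dy): the level is crossed by a jump larger than
   u - x - X_(t-) of a path that stayed below the level. After division by the tail of Pi,
   the shifted restriction of Pi to jumps over the level converges weakly to
   alpha exp(alpha phi) exp(- alpha z) dz on (-x, oo), because the tail is in L^(alpha); the
   kernel is continuous almost everywhere, and Potter's bound f(u + y) <= C exp(- g y) f(u)
   dominates the growth exp(- g phi) that H is allowed for phi <= 0. Paths that touch the
   level without crossing it are bounded by the atoms of Pi, which are negligible with respect
   to the tail. *)

(** The hypothesis [levy_family] only fixes finite-dimensional laws, so everything about jumps is
    built from increments. The finite bound [K] makes large jumps sufficient: with a left limit
    below [K] and [K + x0 <= u - x], a jump that reaches the level exceeds [x0]. Such jumps are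
    finitely many in bounded time, and the Levy measure restricted to them is finite. The
    compensation formula is then an identity between two finite measures on pairs of a killed path
    and a jump size, checked on a pi-system where it reduces to the Markov property at a fixed time
    and to the linearity in time of the mean number of jumps. As kernels are only almost everywhere
    continuous in the overshoot, weak convergence is turned by quantile functions into almost
    everywhere convergence on a bounded interval. Integrands such as that of [lhs_num] are rewritten
    path by path on the full set [Om], an operation that the integral allows for arbitrary
    functions. *)

Section measure_generalities.
Local Open Scope ereal_scope.
Import HBNNSimple.

Section ex_measure.
Context d (T : measurableType d) (R : realType) (f : set T -> \bar R).
Hypotheses (f0 : f set0 = 0) (f_ge0 : forall A, 0 <= f A)
  (f_sadd : semi_sigma_additive f).

Let mk := f.
HB.instance Definition _ := isMeasure.Build _ _ _ mk f0 f_ge0 f_sadd.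

(** A set function built inside a proof has no canonical measure structure; the existential packs it
    as one for local use. *)
Lemma ex_measure : exists m : {measure set T -> \bar R}, forall A, m A = f A.
Proof. by exists mk. Qed.

End ex_measure.

(** Holds simple function by simple function: the integral of a nonnegative [f] is the supremum over
    simple functions below it, whose integrals are finite sums of measures. *)
Lemma ge0_integral_le_measure d (T : measurableType d) (R : realType)
    (m1 m2 : {measure set T -> \bar R}) (f : T -> \bar R) :
  (forall A, measurable A -> m1 A <= m2 A) -> (forall x, 0 <= f x) ->
  \int[m1]_x f x <= \int[m2]_x f x.
Proof.
move=> m12 f0; rewrite !ge0_integralTE//.
apply: ge_ereal_sup => _ [h hf <-]; apply: (@le_trans _ _ (sintegral m2 h)).
  rewrite !sintegralE; apply: lee_fsum; first exact: fimfunP.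
  move=> r [x _ <-]; rewrite lee_wpmul2l ?lee_fin ?fun_ge0//.
  exact: m12.
by apply: ereal_sup_ubound; exists h.
Qed.

(** A simple function below [f] may be cut to [A] without changing its integral, and then lies below
    [g]. This treats arbitrary integrands, such as those defined through [toD] and [leftlim]. *)
Lemma ge0_integral_full_set d (T : measurableType d) (R : realType)
    (m : {measure set T -> \bar R}) (A : set T) (f g : T -> \bar R) :
  measurable A -> m (~` A) = 0 -> (forall x, 0 <= f x) -> (forall x, 0 <= g x) ->
  {in A, f =1 g} -> \int[m]_x f x <= \int[m]_x g x.
Proof.
move=> mA A0 f0 g0 fg; rewrite !ge0_integralTE//.
apply: ge_ereal_sup => _ [h hf <-].
apply: (@le_trans _ _ (sintegral m (proj_nnsfun h mA))); last first.
  apply: ereal_sup_ubound; exists (proj_nnsfun h mA) => // x /=.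
  rewrite mindicE; case: (boolP (x \in A)) => xA.
    by rewrite mulr1 -fg.
  by rewrite mulr0.
rewrite -!integralT_nnsfun le_eqVlt; apply/orP; left; apply/eqP.
apply: ge0_ae_eq_integral => //=.
- exact/measurable_EFinP.
- exact/measurable_EFinP/(measurable_funPT (proj_nnsfun h mA)).
- by move=> x _; rewrite lee_fin.
- by move=> x _; rewrite lee_fin mulr_ge0.
exists (~` A); split => //; first exact: measurableC.
move=> x /= xA Ax; apply: xA => _.
by rewrite mindicE mem_set// mulr1.
Qed.

Lemma integral_full_set d (T : measurableType d) (R : realType)
    (m : {measure set T -> \bar R}) (A : set T) (f g : T -> \bar R) :
  measurable A -> m (~` A) = 0 -> {in A, f =1 g} ->
  \int[m]_x f x = \int[m]_x g x.
Proof.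
move=> mA A0 fg; rewrite integralE [in RHS]integralE; congr (_ - _);
  apply/eqP; rewrite eq_le; apply/andP; split;
  apply: (ge0_integral_full_set mA A0) => // x xA;
  by rewrite ?funeposE ?funenegE fg.
Qed.

Lemma integral_mrestr d (T : measurableType d) (R : realType)
    (m : {measure set T -> \bar R}) (D : set T) (mD : measurable D)
    (f : T -> \bar R) :
  \int[mrestr m mD]_x f x = \int[m]_(x in D) f x.
Proof.
rewrite (@integral_full_set _ _ _ _ D f (f \_ D)) //.
- rewrite -integral_mkcond; apply: eq_measure_integral => A mA AD /=.
  by rewrite /mrestr setIidl.
- by rewrite /= /mrestr setICl measure0.
- by move=> x xD; rewrite patchE xD.
Qed.

Definition image_measure d d' (T1 : measurableType d) (T2 : measurableType d')
    (R : realType) (m : {measure set T1 -> \bar R}) (f : T1 -> T2)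
    (mf : measurable_fun setT f) : {measure set T2 -> \bar R}.
Proof. by refine (pushforward m f : {measure set T2 -> \bar R}). Defined.

Lemma image_measureE d d' (T1 : measurableType d) (T2 : measurableType d')
    (R : realType) (m : {measure set T1 -> \bar R}) (f : T1 -> T2)
    (mf : measurable_fun setT f) (A : set T2) :
  image_measure m mf A = m (f @^-1` A).
Proof. by []. Qed.

Lemma ge0_integral_image_measure d d' (T1 : measurableType d)
    (T2 : measurableType d') (R : realType) (m : {measure set T1 -> \bar R})
    (f : T1 -> T2) (mf : measurable_fun setT f) (g : T2 -> \bar R) :
  measurable_fun setT g -> (forall y, 0 <= g y) ->
  \int[image_measure m mf]_y g y = \int[m]_x g (f x).
Proof.
move=> mg g0; have := @ge0_integral_pushforward _ _ _ _ R f mf m setT g.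
by rewrite preimage_setT; apply.
Qed.

Lemma integral_image_measure d d' (T1 : measurableType d)
    (T2 : measurableType d') (R : realType) (m : {measure set T1 -> \bar R})
    (f : T1 -> T2) (mf : measurable_fun setT f) (g : T2 -> \bar R) :
  measurable_fun setT g ->
  \int[image_measure m mf]_y g y = \int[m]_x g (f x).
Proof.
move=> mg; rewrite integralE [RHS]integralE; congr (_ - _).
- by rewrite ge0_integral_image_measure//; [apply: eq_integral => x _; rewrite !funeposE|exact: measurable_funepos].
- by rewrite ge0_integral_image_measure//; [apply: eq_integral => x _; rewrite !funenegE|exact: measurable_funeneg].
Qed.

Lemma measure_unique_pi d (T : measurableType d) (R : realType) (G : set (set T))
    (m1 m2 : {measure set T -> \bar R}) :
  measurable = <<s G >> -> setI_closed G -> G setT -> m1 setT < +oo ->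
  (forall A, G A -> m1 A = m2 A) -> forall A, measurable A -> m1 A = m2 A.
Proof.
move=> mG GI GT fin m12 A mA.
apply: (@measure_unique _ _ _ G (fun=> setT)) => //.
by rewrite bigcup_const.
Qed.

(** A rectangle is the intersection of two cylinders, and the bases whose cylinders are generated
    form a sigma-algebra; [setT] in each generating class makes the cylinder over a generator a
    rectangle of the class. *)
Lemma measurable_prod_generated d1 d2 (T1 : measurableType d1)
    (T2 : measurableType d2) (G1 : set (set T1)) (G2 : set (set T2)) :
  measurable = <<s G1 >> -> measurable = <<s G2 >> -> G1 setT -> G2 setT ->
  @measurable _ (T1 * T2)%type = <<s [set A `*` B | A in G1 & B in G2] >>.
Proof.
move=> mG1 mG2 G1T G2T; set GG := (X in <<s X >>).
apply/seteqP; split; last first.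
  apply: smallest_sub; first exact: sigma_algebra_measurable.
  move=> _ [A GA [B GB <-]]; apply: measurableX; rewrite ?mG1 ?mG2;
    exact: sub_sigma_algebra.
rewrite measurable_prod_measurableType.
apply: smallest_sub; first exact: smallest_sigma_algebra.
have [s0 sC sU] := smallest_sigma_algebra setT GG.
have sT : <<s GG >> setT by have := sC _ s0; rewrite setD0.
pose L1 := [set A : set T1 | <<s GG >> (A `*` setT)].
have HL1 : <<s G1 >> `<=` L1.
  apply: smallest_sub.
    split; rewrite /L1 /=; first by rewrite set0X.
      move=> A LA; rewrite (_ : _ `*` _ = setT `\` (A `*` setT)); first exact: sC.
      by apply/seteqP; split => -[x y]; rewrite /setX /setD /=; tauto.
    move=> F LF; rewrite (_ : _ `*` _ = \bigcup_k (F k `*` setT)); first exact: sU.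
    apply/seteqP; split => [[x y]/= [[k _ ?] _]|[x y] [k _ [? _]]]; first by exists k.
    by split => //; exists k.
  by move=> A GA; apply: sub_sigma_algebra; exists A => //; exists setT.
pose L2 := [set B : set T2 | <<s GG >> (setT `*` B)].
have HL2 : <<s G2 >> `<=` L2.
  apply: smallest_sub.
    split; rewrite /L2 /=; first by rewrite setX0.
      move=> A LA; rewrite (_ : _ `*` _ = setT `\` (setT `*` A)); first exact: sC.
      by apply/seteqP; split => -[x y]; rewrite /setX /setD /=; tauto.
    move=> F LF; rewrite (_ : _ `*` _ = \bigcup_k (setT `*` F k)); first exact: sU.
    apply/seteqP; split => [[x y]/= [_ [k _ ?]]|[x y] [k _ [_ ?]]]; first by exists k.
    by split => //; exists k.
  by move=> A GA; apply: sub_sigma_algebra; exists setT => //; exists A.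
move=> _ [A mA [B mB <-]].
rewrite (_ : A `*` B = (A `*` setT) `&` (setT `*` B)); last first.
  by apply/seteqP; split => -[x y]; rewrite /setX /setI /=; tauto.
apply: (@measurableI _ (g_sigma_algebraType GG)).
- by apply: HL1; rewrite -mG1.
- by apply: HL2; rewrite -mG2.
Qed.

(* The pi-lambda theorem, applied first to [f] and then to [g]. *)
Lemma independence_generated d d1 d2 (T : measurableType d)
    (S1 : measurableType d1) (S2 : measurableType d2) (R : realType)
    (P : {measure set T -> \bar R}) (f : T -> S1) (g : T -> S2)
    (q : {measure set S2 -> \bar R}) (G1 : set (set S1)) (G2 : set (set S2)) :
  P setT < +oo -> q setT < +oo ->
  measurable_fun setT f -> measurable_fun setT g ->
  measurable = <<s G1 >> -> measurable = <<s G2 >> ->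
  setI_closed G1 -> setI_closed G2 -> G1 setT -> G2 setT ->
  (forall A B, G1 A -> G2 B ->
     P (f @^-1` A `&` g @^-1` B) = P (f @^-1` A) * q B) ->
  forall A B, measurable A -> measurable B ->
     P (f @^-1` A `&` g @^-1` B) = P (f @^-1` A) * q B.
Proof.
move=> Pfin qfin mf mg mG1 mG2 G1I G2I G1T G2T fg.
have mpf A : measurable A -> measurable (f @^-1` A).
  by move=> mA; rewrite -[X in measurable X]setTI; exact: mf.
have mpg A : measurable A -> measurable (g @^-1` A).
  by move=> mA; rewrite -[X in measurable X]setTI; exact: mg.
have Pf A : measurable A -> P A \is a fin_num.
  move=> mA; rewrite ge0_fin_numE//; apply: le_lt_trans Pfin.
  by apply: le_measure; rewrite ?inE//.
have qf A : measurable A -> q A \is a fin_num.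
  move=> mA; rewrite ge0_fin_numE//; apply: le_lt_trans qfin.
  by apply: le_measure; rewrite ?inE//.
have step1 A B : measurable A -> G2 B ->
    P (f @^-1` A `&` g @^-1` B) = P (f @^-1` A) * q B.
  move=> mA GB.
  have mB : measurable B by rewrite mG2; exact: sub_sigma_algebra.
  pose c : {nonneg R} := NngNum (fine_ge0 (measure_ge0 q B)).
  pose m1 : {measure set S1 -> \bar R} := image_measure (mrestr P (mpg _ mB)) mf.
  pose m2 : {measure set S1 -> \bar R} := mscale c (image_measure P mf).
  have : m1 A = m2 A.
    apply: (measure_unique_pi mG1) => //.
      rewrite /m1 /= /pushforward /mrestr preimage_setT setTI.
      by rewrite -ge0_fin_numE//; exact: (Pf _ (mpg _ mB)).
    move=> A' GA'; rewrite /m1 /m2 /= /pushforward /mrestr /mscale /=.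
    by rewrite fg// muleC fineK// qf.
  rewrite /m1 /m2 /= /pushforward /mrestr /mscale /= => ->.
  by rewrite muleC fineK// qf.
move=> A B mA mB.
pose c : {nonneg R} := NngNum (fine_ge0 (measure_ge0 P (f @^-1` A))).
pose m1 : {measure set S2 -> \bar R} := image_measure (mrestr P (mpf _ mA)) mg.
pose m2 : {measure set S2 -> \bar R} := mscale c q.
have : m1 B = m2 B.
  apply: (measure_unique_pi mG2) => //.
    rewrite /m1 /= /pushforward /mrestr preimage_setT setTI.
    by rewrite -ge0_fin_numE//; exact: (Pf _ (mpf _ mA)).
  move=> B' GB'; rewrite /m1 /m2 /= /pushforward /mrestr /mscale /=.
  by rewrite setIC step1// fineK//; exact: (Pf _ (mpf _ mA)).
rewrite /m1 /m2 /= /pushforward /mrestr /mscale /= setIC => ->.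
by rewrite fineK//; exact: (Pf _ (mpf _ mA)).
Qed.

Lemma measurable_fun_integral_snd d1 d2 (T1 : measurableType d1)
    (T2 : measurableType d2) (R : realType)
    (m2 : {sigma_finite_measure set T2 -> \bar R}) (f : T1 * T2 -> \bar R) :
  measurable_fun setT f -> measurable_fun setT (fun x => \int[m2]_y f (x, y)).
Proof.
move=> mf; under eq_fun do rewrite integralE.
apply: emeasurable_funB.
- have := @measurable_fun_fubini_tonelli_F _ _ T1 T2 R m2 _
    (measurable_funepos mf) (fun=> funepos_ge0 _ _).
  apply: eq_measurable_fun => x _; apply: eq_integral => y _.
  by rewrite !funeposE.
- have := @measurable_fun_fubini_tonelli_F _ _ T1 T2 R m2 _
    (measurable_funeneg mf) (fun=> funeneg_ge0 _ _).
  apply: eq_measurable_fun => x _; apply: eq_integral => y _.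
  by rewrite !funenegE.
Qed.

End measure_generalities.

(** * Paths: left limits, killing, shifting and stopping *)

Section paths.
Variable R : realType.
Implicit Types (p : R -> option R) (t s a b r u l : R).

Definition pval p t : R := odflt 0 (p t).

(** The first multiple of [1 / (n + 1)] strictly after [t]; [grid_below] is the last one strictly
    before. Reading a path there involves countably many coordinates only. *)
Definition grid_above (n : nat) t : R := (Num.floor (t * n.+1%:R) + 1)%:~R / n.+1%:R.
Definition grid_below (n : nat) t : R := (Num.ceil (t * n.+1%:R) - 1)%:~R / n.+1%:R.

(** A left limit taken along a countable grid: always defined and jointly measurable in time and
    path, it is the true left limit as soon as that exists ([left_conv_llim]). *)
Definition llim p t : R :=
  fine (limn_esup (fun n => (pval p (grid_below n t))%:E)).

Definition jump p t : R := pval p t - llim p t.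

(** Events about the stopped path play the role of the sigma-algebra of the past of [a]. *)
Definition stop p a : R -> option R :=
  fun t => if t < 0 then None else p (Num.min t a).

Definition alive p := forall t, 0 <= t -> p t <> None.

Lemma grid_above_gt n t : t < grid_above n t.
Proof. by rewrite /grid_above ltr_pdivlMr// real_floorD1_gt ?num_real. Qed.

Lemma grid_above_le n t : grid_above n t <= t + n.+1%:R^-1.
Proof.
rewrite /grid_above ler_pdivrMr// mulrDl mulVf// intrD lerD2r.
by rewrite real_floor_le ?num_real.
Qed.

Lemma grid_below_lt n t : grid_below n t < t.
Proof. by rewrite /grid_below ltr_pdivrMr// real_ceilB1_lt ?num_real. Qed.

Lemma grid_below_ge n t : t - n.+1%:R^-1 <= grid_below n t.
Proof.
rewrite /grid_below ler_pdivlMr// mulrBl mulVf// intrB lerD2r.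
by rewrite real_ceil_ge ?num_real.
Qed.

Lemma cvg_grid_above t : grid_above n t @[n --> \oo] --> t.
Proof.
apply: (@squeeze_cvgr _ _ _ _ (cst t) (fun n => t + n.+1%:R^-1)).
- by apply: nearW => n; rewrite /= ltW ?grid_above_gt//= grid_above_le.
- exact: cvg_cst.
- rewrite -[X in _ --> X]addr0; apply: cvgD; [exact: cvg_cst|exact: cvg_harmonic].
Qed.

Lemma cvg_grid_below t : grid_below n t @[n --> \oo] --> t.
Proof.
apply: (@squeeze_cvgr _ _ _ _ (fun n => t - n.+1%:R^-1) (cst t)).
- by apply: nearW => n; rewrite /= grid_below_ge/= ltW// grid_below_lt.
- rewrite -[X in _ --> X]subr0; apply: cvgB; [exact: cvg_cst|exact: cvg_harmonic].
- exact: cvg_cst.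
Qed.

Lemma right_cvg p t (s : nat -> R) : cadlag p -> 0 <= t ->
  (forall n, t <= s n) -> s n @[n --> \oo] --> t ->
  pval p (s n) @[n --> \oo] --> pval p t.
Proof.
move=> [_ rc _] t0 ts st; move: (rc _ t0); rewrite /right_cont.
have near_s d : 0 < d -> \forall n \near \oo, t <= s n < t + d.
  move=> d0; move/cvgrPdist_lt : st => /(_ _ d0); apply: filterS => n.
  by rewrite ts/= distrC ltr_norml => /andP[_]; rewrite ltrBlDl.
case E : (p t) => [a|].
  move=> h; apply/cvgrPdist_lt => e /h[d [d0 hd]].
  apply: filterS (near_s _ d0) => n /hd[b [pb ab]].
  by rewrite /pval pb E/= distrC.
move=> [d [d0 hd]]; apply/cvgrPdist_lt => e e0.
by apply: filterS (near_s _ d0) => n /hd; rewrite /pval E => -> /=; rewrite subrr normr0.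
Qed.

Lemma left_cvg p t l (s : nat -> R) : left_conv p t l ->
  (forall n, s n < t) -> s n @[n --> \oo] --> t ->
  pval p (s n) @[n --> \oo] --> l.
Proof.
move=> lc ts st; apply/cvgrPdist_lt => e /lc[d [d0 hd]].
move/cvgrPdist_lt : st => /(_ _ d0); apply: filterS => n tsd.
have [|b [pb ab]] := hd (s n).
  by rewrite ts andbT ltrBlDl -ltrBlDr; move: tsd; rewrite ltr_norml => /andP[].
by rewrite /pval pb /= distrC.
Qed.

Lemma left_conv_llim p t l : left_conv p t l -> llim p t = l.
Proof.
move=> lc; rewrite /llim; have : (pval p (grid_below n t))%:E @[n --> \oo] --> l%:E.
  apply: cvg_EFin; first exact: nearW.
  by apply: (left_cvg lc) => [n|]; [exact: grid_below_lt|exact: cvg_grid_below].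
by move=> /cvg_limn_einf_sup[_ ->].
Qed.

Lemma left_conv_leftlim p t l : left_conv p t l -> leftlim p t = Some l.
Proof.
move=> lc; rewrite /leftlim; case: pselect => [h|]; last by case; exists l.
congr Some; case: xgetP => [y _ /= yc|/(_ l)//].
by rewrite -(left_conv_llim yc) (left_conv_llim lc).
Qed.

Lemma alive_left_conv p t : cadlag p -> alive p -> 0 < t ->
  left_conv p t (llim p t).
Proof.
move=> [_ _ lc] ap t0; have [[l pl]|[d [d0 hd]]] := lc _ t0.
  by rewrite (left_conv_llim pl).
(* The sampling time must be positive, for [alive] to apply, and within [d] of [t]. *)
pose s := Num.max (t - d / 2) (t / 2).
have s0 : 0 < s by rewrite lt_max; apply/orP; right; rewrite divr_gt0.
have : p s = None.
  by apply: hd; rewrite /s lt_max gt_max; apply/andP; split;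
    [apply/orP; left; lra|apply/andP; split; lra].
by move/(ap _ (ltW s0)).
Qed.

Lemma leftlim0 p : cadlag p -> leftlim p 0 = None.
Proof.
move=> [neg _ _]; rewrite /leftlim; case: pselect => // -[l /(_ 1 ltr01)].
move=> [d [d0 /(_ (- (d / 2)))]] [|b []]; first by apply/andP; split; lra.
by rewrite neg//; lra.
Qed.

Lemma cadlag_kill p r : cadlag p -> cadlag (kill p r%:E).
Proof.
move=> [neg rc lc]; split.
- by move=> t t0; rewrite /kill neg//; case: ifP.
- move=> t t0; rewrite /right_cont /kill lte_fin; case: ltP => tr; last first.
    by exists 1; split => // s /andP[ts _]; rewrite lte_fin ltNge (le_trans tr ts).
  have := rc _ t0; rewrite /right_cont; case E : (p t) => [a|].
    move=> h e /h[d [d0 hd]]; exists (Num.min d (r - t)); split.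
      by rewrite lt_min d0 subr_gt0.
    move=> s /andP[ts]; rewrite -ltrBlDl lt_min => /andP[sd sr].
    have -> : (s%:E < r%:E)%E by rewrite lte_fin; lra.
    by apply: hd; rewrite ts -ltrBlDl.
  move=> [d [d0 hd]]; exists d; split => // s /hd ->; by case: ifP.
- move=> t t0; have [tr|rt] := leP t r; last first.
    right; exists (t - r); split; first by rewrite subr_gt0.
    move=> s /andP[ts st]; rewrite /kill lte_fin ltNge.
    by rewrite (_ : r <= s); [|lra].
  have [[l pl]|[d [d0 hd]]] := lc _ t0; [left; exists l|right].
    move=> e /pl[d [d0 hd]]; exists d; split => // s st.
    have [b [sb bl]] := hd _ st; exists b; split => //.
    by rewrite /kill lte_fin (lt_le_trans _ tr)//; case/andP: st.
  by exists d; split => // s /hd; rewrite /kill => ->; case: ifP.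
Qed.

Lemma cadlag_shift_sub p r u : cadlag p -> 0 <= r -> cadlag (shift_sub p r%:E u).
Proof.
move=> [neg rc lc] r0; split.
- by move=> t t0; rewrite /shift_sub t0.
- move=> t t0; have rt : 0 <= r + t by rewrite addr_ge0.
  have := rc _ rt; rewrite /right_cont /shift_sub ltNge t0 /=.
  case E : (p (r + t)) => [a|] /=.
    move=> h e /h[d [d0 hd]]; exists d; split => // s /andP[ts sd].
    rewrite ltNge (le_trans t0 ts) /=.
    have [|b [-> ab]] := hd (r + s); first by apply/andP; split; lra.
    by exists (b - u); split => //; rewrite (_ : b - u - _ = b - a)//; lra.
  move=> [d [d0 hd]]; exists d; split => // s /andP[ts sd].
  by rewrite ltNge (le_trans t0 ts) /= hd//; apply/andP; split; lra.
- move=> t t0; have rt : 0 < r + t by lra.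
  have [[l pl]|[d [d0 hd]]] := lc _ rt; [left; exists (l - u)|right].
    move=> e /pl[d [d0 hd]]; exists (Num.min d t); split; first by rewrite lt_min d0.
    move=> s /andP[ts st]; have [sd s0] : t - d < s /\ 0 < s.
      move: ts; rewrite ltrBlDl -ltrBlDr lt_min => /andP[? ?]; split; lra.
    have [|b [E bl]] := hd (r + s); first by apply/andP; split; lra.
    exists (b - u); rewrite /shift_sub ltNge (ltW s0)/= E/=; split => //.
    by rewrite (_ : b - u - _ = b - l)//; lra.
  exists (Num.min d t); split; first by rewrite lt_min d0.
  move=> s /andP[ts st]; have [sd s0] : t - d < s /\ 0 < s.
    move: ts; rewrite ltrBlDl -ltrBlDr lt_min => /andP[? ?]; split; lra.
  by rewrite /shift_sub ltNge (ltW s0)/= hd//; apply/andP; split; lra.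
Qed.

Lemma cadlag_stop p a : cadlag p -> 0 <= a -> cadlag (stop p a).
Proof.
move=> [neg rc lc] a0; split.
- by move=> t t0; rewrite /stop t0.
- move=> t t0; rewrite /right_cont /stop ltNge t0/=.
  have [ta|at_] := ltP t a.
    have := rc _ t0; rewrite /right_cont; case E : (p t) => [x|].
      move=> h e /h[d [d0 hd]]; exists (Num.min d (a - t)); split.
        by rewrite lt_min d0 subr_gt0.
      move=> s /andP[ts]; rewrite -ltrBlDl lt_min => /andP[sd sr].
      rewrite ltNge (le_trans t0 ts)/= min_l; last lra.
      by apply: hd; rewrite ts -ltrBlDl.
    move=> [d [d0 hd]]; exists (Num.min d (a - t)); split.
      by rewrite lt_min d0 subr_gt0.
    move=> s /andP[ts]; rewrite -ltrBlDl lt_min => /andP[sd sr].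
    rewrite ltNge (le_trans t0 ts)/= min_l; last lra.
    by apply: hd; rewrite ts -ltrBlDl.
  have const s : t <= s -> (if s < 0 then None else p (Num.min s a)) = p a.
    by move=> ts; rewrite ltNge (le_trans t0 ts)/= min_r// (le_trans at_ ts).
  case E : (p a) => [x|].
    move=> e e0; exists 1; split => // s /andP[ts _]; exists x.
    by rewrite const// E subrr normr0.
  by exists 1; split => // s /andP[ts _]; rewrite const// E.
- move=> t t0; have [ta|at_] := leP t a.
    have pos s d : t - Num.min d t < s < t -> t - d < s < t /\ stop p a s = p s.
      rewrite ltrBlDl -ltrBlDr lt_min => /andP[/andP[? ?] st].
      have s0 : 0 <= s by lra.
      rewrite /stop (ltNge s 0) s0/=.
      by rewrite min_l; [split => //; apply/andP; split; lra|lra].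
    have [[l pl]|[d [d0 hd]]] := lc _ t0; [left; exists l|right].
      move=> e /pl[d [d0 hd]]; exists (Num.min d t); split; first by rewrite lt_min d0.
      by move=> s /pos[/hd h ->].
    exists (Num.min d t); split; first by rewrite lt_min d0.
    by move=> s /pos[/hd h ->].
  have const s : a < s -> stop p a s = p a.
    by move=> ts; rewrite /stop ltNge (ltW (le_lt_trans a0 ts))/= min_r// ltW.
  have ta : 0 < t - a by rewrite subr_gt0.
  case E : (p a) => [x|]; [left; exists x => e e0|right];
    exists (t - a); split => // s /andP[ts _].
    by exists x; rewrite const ?E ?subrr ?normr0//; lra.
  by rewrite const ?E//; lra.
Qed.

Lemma toDE p : cadlag p -> dval (toD p) = p.
Proof. by move=> cp; rewrite /toD; case: pselect. Qed.

End paths.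

(** * Oscillation of cadlag paths on compact intervals *)

Section oscillation.
Variable R : realType.
Implicit Types (p : R -> option R) (t s a b c r u l y e : R).

Lemma alive_pval p t : alive p -> 0 <= t -> p t = Some (pval p t).
Proof. by move=> ap t0; rewrite /pval; case: (p t) (ap _ t0). Qed.

Lemma cadlag_gauge p s e : cadlag p -> alive p -> 0 <= s -> 0 < e ->
  exists d, [/\ 0 < d,
    forall y, s <= y < s + d -> `|pval p y - pval p s| < e &
    forall y, 0 <= y -> s - d < y < s -> `|pval p y - llim p s| < e].
Proof.
move=> cp ap s0 e0; have [_ rc _] := cp.
have := rc _ s0; rewrite /right_cont (alive_pval ap s0) => /(_ _ e0)[d1 [d10 h1]].
have h1' d : d <= d1 -> forall y, s <= y < s + d -> `|pval p y - pval p s| < e.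
  move=> dd1 y /andP[sy yd]; have [|b [pb bs]] := h1 y.
    by rewrite sy (lt_le_trans yd)// lerD2l.
  by rewrite {1}/pval pb.
move: s0; rewrite le_eqVlt => /predU1P[s0|s0].
  exists d1; split => //; first exact: h1'.
  by move=> y y0; rewrite -s0 => /andP[_]; rewrite ltNge y0.
have /(_ _ e0)[d2 [d20 h2]] := alive_left_conv cp ap s0.
exists (Num.min d1 d2); split; first by rewrite lt_min d10.
  by apply: h1'; rewrite ge_min lexx.
move=> y y0 /andP[sy ys]; have [|b [pb bs]] := h2 y.
  rewrite ys andbT (le_lt_trans _ sy)// lerB// ge_min lexx orbT//.
by rewrite {1}/pval pb.
Qed.

Lemma llim_close p r s e a : cadlag p -> alive p -> 0 <= r -> r < s ->
  (forall y, r < y < s -> `|pval p y - a| <= e) -> `|llim p s - a| <= e.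
Proof.
move=> cp ap r0 rs h; have s0 := le_lt_trans r0 rs.
apply/ler_addgt0Pr => d d0.
have /(_ _ d0)[d' [d'0 hd]] := alive_left_conv cp ap s0.
pose y := Num.max ((r + s) / 2) (s - d' / 2).
have ry : r < y by rewrite lt_max; apply/orP; left; lra.
have ys : y < s by rewrite gt_max; apply/andP; split; lra.
have dy : s - d' < y by rewrite lt_max; apply/orP; right; lra.
have [|b [pb bl]] := hd y; first by rewrite dy ys.
have := h y; rewrite ry ys {1}/pval pb/= => /(_ isT) ba.
rewrite (_ : llim p s - a = (b - a) - (b - llim p s)); last lra.
by rewrite (le_trans (ler_normB _ _))// lerD// ltW.
Qed.

(** By compactness of [[0, c]], a short interval lies in the gauge of a single point [s], and the
    path is nearly constant on each side of [s]. Only [s] can carry a large jump, and the increment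
    over an interval that contains it is nearly that jump. *)
Lemma cadlag_oscillation p c e : cadlag p -> alive p -> 0 < e ->
  exists2 rho, 0 < rho & forall r q, 0 <= r <= c -> r < q -> q < r + rho ->
  exists s, [/\ forall s', r < s' <= q -> s' != s -> `|jump p s'| <= e,
    r < s <= q -> `|pval p q - pval p r - jump p s| <= e &
    ~~ (r < s <= q) -> `|pval p q - pval p r| <= e].
Proof.
move=> cp ap e0.
pose good rho r := 0 <= r -> forall q, r < q -> q < r + rho ->
  exists s, [/\ forall s', r < s' <= q -> s' != s -> `|jump p s'| <= e,
    r < s <= q -> `|pval p q - pval p r - jump p s| <= e &
    ~~ (r < s <= q) -> `|pval p q - pval p r| <= e].
have cov : \forall rho \near 0^'+, `[0, c] `<=` good rho.
  have/compact_near_coveringP := @segment_compact R 0 c.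
  apply => x /=; rewrite in_itv/= => /andP[x0 xc].
  have e2 : 0 < e / 2 by lra.
  have [d [d0 hr hl]] := cadlag_gauge cp ap x0 e2.
  (* Half the gauge for [r] and half for [rho]: the whole interval from [r] to [q] stays within [d]
     of [x]. *)
  exists ([set r | `|x - r| < d / 2], [set rho | rho < d / 2]).
    split => /=; last by apply: nbhs_right_lt; lra.
    by apply: (@nbhsx_ballx _ _ x (d / 2)); lra.
  move=> [r rho] [/=]; rewrite ltr_norml => /andP[xr1 xr2] rhod r0 q rq qr.
  have H1 y : x <= y -> y <= q -> `|pval p y - pval p x| < e / 2.
    by move=> xy yq; apply: hr; apply/andP; split; lra.
  have H2 y : r <= y -> y < x -> `|pval p y - llim p x| < e / 2.
    by move=> ry yx; apply: hl; [lra|apply/andP; split; lra].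
  exists x; split.
  - move=> s' /andP[rs sq] /eqP sx; rewrite /jump.
    have s'0 : 0 < s' by lra.
    have [s'x|xs'] : s' < x \/ x < s' by case: (ltgtP s' x) => // ?; [left|right].
      have := H2 s' (ltW rs) s'x.
      have : `|llim p s' - llim p x| <= e / 2.
        apply: (@llim_close _ r) => // y /andP[ry ys]; apply/ltW/H2; lra.
      rewrite ltr_norml !ler_norml => /andP[? ?] /andP[? ?]; apply/andP; split; lra.
    have := H1 s' (ltW xs') sq.
    have : `|llim p s' - pval p x| <= e / 2.
      apply: (@llim_close _ x) => // y /andP[xy ys]; apply/ltW/H1; lra.
    rewrite ltr_norml !ler_norml => /andP[? ?] /andP[? ?]; apply/andP; split; lra.
  - move=> /andP[rx xq]; rewrite /jump.
    have := H1 q xq (lexx _); have := H2 r (lexx _) rx.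
    rewrite !ltr_norml !ler_norml => /andP[? ?] /andP[? ?]; apply/andP; split; lra.
  - rewrite negb_and -!leNgt -ltNge => /orP[xr|qx].
      have := H1 q (le_trans xr (ltW rq)) (lexx _); have := H1 r xr (ltW rq).
      rewrite !ltr_norml !ler_norml => /andP[? ?] /andP[? ?]; apply/andP; split; lra.
    have := H2 q (ltW rq) qx; have := H2 r (lexx _) (lt_trans rq qx).
    rewrite !ltr_norml !ler_norml => /andP[? ?] /andP[? ?]; apply/andP; split; lra.
have [rho [rho0 H]] := filter_ex (filterI (nbhs_right_gt (0 : R)) cov).
exists rho => // r q /andP[r0 rc]; apply: H => //=.
by rewrite in_itv/= r0.
Qed.

(** The same covering argument with the bound in place of the mesh; it later shows that a fixed path
    stays below every high level over a bounded time. *)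
Lemma cadlag_bounded p c : cadlag p -> alive p ->
  exists M, forall t, 0 <= t <= c -> `|pval p t| <= M.
Proof.
move=> cp ap.
have cov : \forall M \near +oo, `[0, c] `<=` [set t | 0 <= t -> `|pval p t| <= M].
  have/compact_near_coveringP := @segment_compact R 0 c.
  apply => x /=; rewrite in_itv/= => /andP[x0 xc].
  have [d [d0 hr hl]] := cadlag_gauge cp ap x0 ltr01.
  exists ([set r | `|x - r| < d], [set M | `|pval p x| + `|llim p x| + 1 < M]).
    split => /=; first exact: (@nbhsx_ballx _ _ x d).
    by apply: nbhs_pinfty_gt; rewrite num_real.
  move=> [r M] [/=]; rewrite ltr_norml => /andP[xr1 xr2] hM r0.
  have [xr|rx] := leP x r.
    have /hr : x <= r < x + d by apply/andP; split; lra.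
    move: hM (normr_ge0 (llim p x)) (ler_normB (pval p x) (pval p x - pval p r)).
    rewrite subKr (distrC (pval p x)); lra.
  have /(hl _ r0) : x - d < r < x by apply/andP; split; lra.
  move: hM (normr_ge0 (pval p x)) (ler_normB (llim p x) (llim p x - pval p r)).
  rewrite subKr (distrC (llim p x)); lra.
have [M H] := filter_ex cov.
by exists M => t /andP[t0 tc]; apply: H => //=; rewrite in_itv/= t0.
Qed.

End oscillation.

(** * Large jumps of a path and their number *)

Section jumps.
Variable R : realType.
Implicit Types (p : R -> option R) (t s a b c r u l y e : R).

Definition jumps p y : set R := [set s | 0 < s /\ y < jump p s].

Definition cell a b (n k : nat) : R := a + (b - a) * (k%:R / n.+1%:R).

Lemma cell0 a b n : cell a b n 0 = a.
Proof. by rewrite /cell mul0r mulr0 addr0. Qed.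

Lemma celln a b n : cell a b n n.+1 = b.
Proof. by rewrite /cell divff// mulr1 addrC subrK. Qed.

Lemma cell_le a b (n k m : nat) :
  a <= b -> (k <= m)%N -> cell a b n k <= cell a b n m.
Proof.
move=> ab kl; rewrite /cell lerD2l ler_wpM2l ?subr_ge0//.
by rewrite ler_pM2r ?invr_gt0// ler_nat.
Qed.

Lemma cellS a b n k : cell a b n k.+1 = cell a b n k + (b - a) / n.+1%:R.
Proof. by rewrite /cell -addrA -[k.+1%:R]natr1 [(_ + 1) / _]mulrDl mul1r mulrDr. Qed.

Lemma mesh_near a b rho : 0 < rho -> \forall n \near \oo, (b - a) / n.+1%:R < rho.
Proof.
move=> rho0.
have : (b - a) * (n.+1%:R)^-1 @[n --> \oo] --> (b - a) * 0.
  by apply: cvgMr; exact: cvg_harmonic.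
rewrite mulr0 => /cvgrPdist_lt/(_ _ rho0); apply: filterS => n.
by rewrite sub0r normrN ltr_norml => /andP[].
Qed.

Lemma in_cell a b n s : a < s <= b ->
  exists2 k, (k <= n)%N & cell a b n k < s <= cell a b n k.+1.
Proof.
move=> /andP[as_ sb].
have [k [sk kmin]] : exists k, s <= cell a b n k.+1 /\
    forall j, s <= cell a b n j.+1 -> (k <= j)%N.
  have ex : exists k, s <= cell a b n k.+1 by exists n; rewrite celln.
  by case: (ex_minnP ex) => k; exists k.
exists k; first by apply: kmin; rewrite celln.
rewrite sk andbT ltNge; apply/negP => sk'.
case: k => [|k] in sk kmin sk' *; first by move: sk'; rewrite cell0; lra.
by have := kmin _ sk'; rewrite ltnn.
Qed.

(** With tolerance [y / 2] in [cadlag_oscillation], a jump above [y] can only sit at the exceptional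
    point of the interval. *)
Lemma jumps_cell p y c : cadlag p -> alive p -> 0 < y ->
  exists2 rho, 0 < rho & forall r q, 0 <= r <= c -> r < q -> q < r + rho ->
  forall s1 s2, jumps p y s1 -> jumps p y s2 -> r < s1 <= q -> r < s2 <= q ->
  s1 = s2.
Proof.
move=> cp ap y0; have y2 : 0 < y / 2 by lra.
have [rho rho0 H] := @cadlag_oscillation R p c (y / 2) cp ap y2.
exists rho => // r q rc rq qr s1 s2 [s10 J1] [s20 J2] s1r s2r.
have [s [h _ _]] := H _ _ rc rq qr.
have eqs s' : r < s' <= q -> y < jump p s' -> s' = s.
  move=> rs' ys'; apply/eqP/negPn/negP => s's; have := h _ rs' s's.
  by rewrite ler_norml => /andP[_]; lra.
by rewrite (eqs s1)// (eqs s2).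
Qed.

Lemma finite_jumps p y b : cadlag p -> alive p -> 0 < y ->
  finite_set (jumps p y `&` `]0, b]).
Proof.
move=> cp ap y0; have [b0|b0] := leP b 0.
  rewrite (_ : _ `&` _ = set0)//; apply/seteqP; split => // s [_] /=.
  by rewrite in_itv/= => /andP[? ?]; lra.
have [rho rho0 H] := @jumps_cell p y b cp ap y0.
have [n hn] := filter_ex (@mesh_near 0 b rho rho0).
pose F k := jumps p y `&` `]cell 0 b n k, cell 0 b n k.+1].
apply: (@sub_finite_set _ _ (\bigcup_(k in `I_n.+1) F k)).
  move=> s [Js]; rewrite /= in_itv/= => /(in_cell n)[k kn sk].
  by exists k => //=; split => //=; rewrite in_itv.
apply: bigcup_finite => [|k /= kn]; first exact: finite_II.
have [->|/set0P[s [Js sk]]] := eqVneq (F k) set0.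
  exact: finite_set0.
apply: (@sub_finite_set _ _ [set s]); last exact: finite_set1.
move=> s' [Js' s'k]; move: sk s'k; rewrite /= !in_itv/= => sk s'k.
apply: (H (cell 0 b n k) (cell 0 b n k.+1)) => //.
- apply/andP; split; first by rewrite -[leLHS](cell0 0 b n) cell_le// ltW.
  by rewrite -[leRHS](celln 0 b n) cell_le//; [exact: ltW|exact: ltnW].
- by rewrite cellS ltrDl divr_gt0//; lra.
- by rewrite cellS ltrD2l.
Qed.

End jumps.

Section jump_counts.
Variable R : realType.
Implicit Types (p : R -> option R) (t s a b c r u l y e : R).

Lemma eq_llim p p' s : (forall t, t < s -> pval p t = pval p' t) ->
  llim p s = llim p' s.
Proof.
move=> pp'; rewrite /llim; congr (fine (limn_esup _)).
by apply/funext => n; rewrite pp'// grid_below_lt.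
Qed.

Lemma pval_stop p c t : cadlag p -> t <= c -> pval (stop p c) t = pval p t.
Proof.
move=> [neg _ _] tc; rewrite /pval /stop min_l//.
by case: ltP => // /neg ->.
Qed.

Lemma llim_stop p c s : cadlag p -> s <= c -> llim (stop p c) s = llim p s.
Proof.
move=> cp sc; apply: eq_llim => t ts; apply: pval_stop => //.
exact: le_trans (ltW ts) sc.
Qed.

Lemma jump_stop p c s : cadlag p -> s <= c -> jump (stop p c) s = jump p s.
Proof. by move=> cp sc; rewrite /jump pval_stop// llim_stop. Qed.

Lemma pval_kill p c t : t < c -> pval (kill p c%:E) t = pval p t.
Proof. by move=> tc; rewrite /pval /kill lte_fin tc. Qed.

Lemma llim_kill p c s : s <= c -> llim (kill p c%:E) s = llim p s.
Proof.
move=> sc; apply: eq_llim => t ts; apply: pval_kill.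
exact: lt_le_trans ts sc.
Qed.

Lemma alive_stop p c : 0 <= c -> alive p -> alive (stop p c).
Proof.
move=> c0 ap t t0; rewrite /stop ltNge t0/=; apply: ap.
by rewrite le_min t0.
Qed.

Lemma alive_shift_sub p r u : 0 <= r -> alive p -> alive (shift_sub p r%:E u).
Proof.
move=> r0 ap t t0; rewrite /shift_sub ltNge t0/= (alive_pval ap)//.
by rewrite addr_ge0.
Qed.

Lemma pval_shift_sub p r u t : alive p -> 0 <= r -> 0 <= t ->
  pval (shift_sub p r%:E u) t = pval p (r + t) - u.
Proof.
move=> ap r0 t0; rewrite {1}/pval /shift_sub ltNge t0/= (alive_pval ap)//.
by rewrite addr_ge0.
Qed.

Lemma llim_shift_sub p r u t : cadlag p -> alive p -> 0 <= r -> 0 < t ->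
  llim (shift_sub p r%:E u) t = llim p (r + t) - u.
Proof.
move=> cp ap r0 t0; apply: left_conv_llim => e e0.
have rt : 0 < r + t by lra.
have /(_ _ e0)[d [d0 hd]] := alive_left_conv cp ap rt.
exists (Num.min d t); split; first by rewrite lt_min d0.
move=> s; rewrite ltrBlDl -ltrBlDr lt_min => /andP[/andP[sd st] ts].
have s0 : 0 <= s by lra.
have [|b [pb bl]] := hd (r + s); first by apply/andP; split; lra.
exists (b - u); rewrite /shift_sub ltNge s0/= pb/=; split => //.
by rewrite (_ : b - u - _ = b - llim p (r + t))//; lra.
Qed.

Lemma jump_shift_sub p r u t : cadlag p -> alive p -> 0 <= r -> 0 < t ->
  jump (shift_sub p r%:E u) t = jump p (r + t).
Proof.
move=> cp ap r0 t0; rewrite /jump pval_shift_sub//; last exact: ltW.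
by rewrite llim_shift_sub//; lra.
Qed.

(* The right-hand side only involves countably many times: the presence of a jump is
   thereby measurable. *)
Lemma jump_detection p y a b : cadlag p -> alive p -> 0 < y -> 0 <= a -> a < b ->
  (exists s, a < s <= b /\ jumps p y s) <->
  (exists m N : nat, forall n, (N <= n)%N -> exists2 j, (j <= n)%N &
     y + m.+1%:R^-1 < pval p (cell a b n j.+1) - pval p (cell a b n j)).
Proof.
move=> cp ap y0 a0 ab.
have cell_a n j : 0 <= cell a b n j.
  by rewrite (le_trans a0)// -[leLHS](cell0 a b n) cell_le// ltW.
have cell_b n j : (j <= n)%N -> cell a b n j <= b.
  by move=> jn; rewrite -[leRHS](celln a b n) cell_le ?ltW// ltnW.
have cellab n j : cell a b n j < cell a b n j.+1.
  by rewrite cellS ltrDl divr_gt0// subr_gt0.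
split=> [[s [sab [s0 sy]]]|[m [N H]]].
  (* Half of the excess over [y]: one margin pays for the oscillation, the other one is left in the
     conclusion. *)
  have : \forall m \near \oo, m.+1%:R^-1 < (jump p s - y) / 2.
    have /cvgrPdist_lt/(_ ((jump p s - y) / 2)) := @cvg_harmonic R.
    have sy2 : 0 < (jump p s - y) / 2 by lra.
    move=> /(_ sy2); apply: filterS => n.
    by rewrite sub0r normrN ltr_norml => /andP[].
  move=> /filter_ex[m /= hm]; exists m.
  have m0 : 0 < m.+1%:R^-1 :> R by rewrite invr_gt0.
  have [rho rho0 osc] := @cadlag_oscillation R p b _ cp ap m0.
  have [N _ hN] := @mesh_near R a b rho rho0.
  exists N => n Nn; have [j jn sj] := in_cell n sab.
  exists j => //.
  have [|||s' [h1 h2 _]] := osc (cell a b n j) (cell a b n j.+1).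
  - by rewrite cell_a cell_b.
  - exact: cellab.
  - by rewrite cellS ltrD2l hN.
  have ss' : s = s'.
    apply/eqP/negPn/negP => ss'; have := h1 _ sj ss'.
    by rewrite ler_norml => /andP[_]; move: hm; move: (m.+1%:R^-1) => v; lra.
  move: sj; rewrite ss' => /h2; rewrite ler_norml -ss' => /andP[+ _].
  by move: hm; move: (m.+1%:R^-1) => v; lra.
(* With half the margin as tolerance, an increment above [y + 1 / (m + 1)] forces the exceptional
   point into the cell and its jump above [y]. *)
have m0 : 0 < m.+1%:R^-1 / 2 :> R by rewrite divr_gt0// invr_gt0.
have [rho rho0 osc] := @cadlag_oscillation R p b _ cp ap m0.
have [n [Nn hn]] : exists n, (N <= n)%N /\ (b - a) / n.+1%:R < rho.
  have [n [? ?]] := filter_ex (filterI (nbhs_infty_ge N) (@mesh_near R a b rho rho0)).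
  by exists n.
have [j jn hj] := H _ Nn.
have [|||s [_ h2 h3]] := osc (cell a b n j) (cell a b n j.+1).
- by rewrite cell_a cell_b.
- exact: cellab.
- by rewrite cellS ltrD2l.
have [sj|sj] := boolP (cell a b n j < s <= cell a b n j.+1); last first.
  have := h3 sj; rewrite ler_norml => /andP[_].
  by move: hj m0; move: (m.+1%:R^-1) => v; lra.
exists s; split.
  case/andP: sj => s1 s2; rewrite (le_trans s2) ?andbT; last first.
    by rewrite -[leRHS](celln a b n) cell_le// ltW.
  by rewrite (le_lt_trans _ s1)// -[leLHS](cell0 a b n) cell_le// ltW.
split; first by case/andP: sj => s1 _; rewrite (le_lt_trans _ s1).
have := h2 sj; rewrite ler_norml => /andP[_].
by move: hj m0; move: (m.+1%:R^-1) => v; lra.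
Qed.

Definition njumps p y a b : \bar R := counting (jumps p y `&` `]a, b]).

Lemma finite_measurable (A : set R) : finite_set A -> measurable A.
Proof.
by move=> fA; apply: countable_measurable => [t|]; [exact: measurable_set1|exact: finite_set_countable].
Qed.

Lemma njumps_ge0 p y a b : (0 <= njumps p y a b)%E.
Proof. by rewrite /njumps /counting; case: ifP. Qed.

Lemma finite_jumps_itv p y a b : cadlag p -> alive p -> 0 < y -> 0 <= a ->
  finite_set (jumps p y `&` `]a, b]).
Proof.
move=> cp ap y0 a0; apply: sub_finite_set (finite_jumps b cp ap y0).
by move=> s [Js /=]; rewrite !in_itv/= => /andP[as_ ->]; rewrite (le_lt_trans a0).
Qed.

Lemma njumpsD p y a b c : cadlag p -> alive p -> 0 < y -> 0 <= a ->
  a <= b -> b <= c -> njumps p y a c = (njumps p y a b + njumps p y b c)%E.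
Proof.
move=> cp ap y0 a0 ab bc; rewrite /njumps -measureU.
- rewrite -setIUr; congr (counting (_ `&` _)); rewrite eqEsubset; split => s /=.
    by rewrite !in_itv/= => /andP[as_ sc]; have [sb|sb] := leP s b;
      [left|right]; rewrite ?as_ ?sb.
  rewrite !in_itv/= => -[/andP[s1 s2]|/andP[s1 s2]].
    by rewrite s1 (le_trans s2).
  by rewrite s2 (le_lt_trans ab).
- by apply: finite_measurable; exact: finite_jumps_itv.
- by apply: finite_measurable; apply: finite_jumps_itv => //; exact: le_trans a0 ab.
- apply/seteqP; split => // s [[_ /=] + [_ /=]]; rewrite !in_itv/=.
  by move=> /andP[_ sb] /andP[bs _]; lra.
Qed.

Definition has_jump p y a b := exists s, a < s <= b /\ jumps p y s.

(** On a fine mesh a cell holds at most one jump, so the count becomes a finite sum of indicators of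
    [has_jump], which is how it is shown measurable. *)
Lemma njumps_cells p y a b : cadlag p -> alive p -> 0 < y -> 0 <= a -> a < b ->
  \forall n \near \oo, njumps p y a b =
    (\sum_(k < n.+1) (`[< has_jump p y (cell a b n k) (cell a b n k.+1) >])%:R%:E)%E.
Proof.
move=> cp ap y0 a0 ab.
have [rho rho0 H] := @jumps_cell R p y b cp ap y0.
have := @mesh_near R a b rho rho0; apply: filterS => n hn.
have cell_a j : 0 <= cell a b n j.
  by rewrite (le_trans a0)// -[leLHS](cell0 a b n) cell_le// ltW.
have cellab j : cell a b n j < cell a b n j.+1.
  by rewrite cellS ltrDl divr_gt0// subr_gt0.
rewrite -[b in LHS](celln a b n).
have : (n.+1 <= n.+1)%N by [].
(* Induction on the number of cells counted, the mesh [n] being kept. *)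
elim: {-2}(n.+1) => [_|k IH kn].
  rewrite cell0 big_ord0 /njumps (_ : _ `&` _ = set0) ?measure0//.
  by apply/seteqP; split => // s [_] /=; rewrite in_itv/= => /andP[? ?]; lra.
rewrite big_ord_recr/= -IH; last exact: ltnW.
rewrite (@njumpsD _ _ _ (cell a b n k)) //.
- congr (_ + _)%E; rewrite /njumps.
  case: asboolP => [[s [sk Js]]|nj]; last first.
    rewrite (_ : _ `&` _ = set0) ?measure0//; apply/seteqP; split => // s [Js] /=.
    by rewrite in_itv/= => sk; apply: nj; exists s.
  rewrite (_ : _ `&` _ = [set s]).
    by rewrite /counting asboolT// fset_set1 cardfs1.
  apply/seteqP; split => [s' [Js'] /=|s' ->]; last by split => //=; rewrite in_itv.
  rewrite in_itv/= => s'k.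
  apply: (H (cell a b n k) (cell a b n k.+1)) => //.
    by rewrite cell_a -[leRHS](celln a b n) cell_le ?ltW// ltnW.
  by rewrite cellS ltrD2l.
- by rewrite -[leLHS](cell0 a b n) cell_le// ltW.
- exact: ltW.
Qed.

Lemma counting_image_inj (T T' : choiceType) (f : T -> T') (A : set T) :
  injective f -> finite_set A -> counting (f @` A) = counting A :> \bar R.
Proof.
move=> fi fA; rewrite /counting !asboolT//; last exact: finite_image.
rewrite fset_set_image// card_imfset//.
Qed.

Lemma njumps_shift_sub p y r u c : cadlag p -> alive p -> 0 < y -> 0 <= r ->
  njumps (shift_sub p r%:E u) y 0 c = njumps p y r (r + c).
Proof.
move=> cp ap y0 r0; rewrite /njumps.
have <- : (fun s => r + s) @` (jumps (shift_sub p r%:E u) y `&` `]0, c]) =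
    jumps p y `&` `]r, r + c].
  apply/seteqP; split => [z [s [[s0 Js] /=]]|s [[s0 Js] /=]]; rewrite !in_itv/=.
    move=> /andP[_ sc] <-; move: Js; rewrite jump_shift_sub// => Js; split => /=.
      by split => //; lra.
    by rewrite ?in_itv/=; apply/andP; split; lra.
  move=> /andP[sr1 sr2]; exists (s - r); last by rewrite addrC subrK.
  split => /=; last by rewrite ?in_itv/=; apply/andP; split; lra.
  split; first lra.
  by rewrite jump_shift_sub//; [rewrite addrC subrK|lra].
rewrite counting_image_inj//.
by apply: finite_jumps => //; [exact: cadlag_shift_sub|exact: alive_shift_sub].
Qed.

End jump_counts.

(** * Measurability on the path space *)

Section measurable_sets_of_functions.
Context d (T : measurableType d) (R : realType).
Implicit Types f g : T -> R.

Lemma measurable_ltr_set f g : measurable_fun setT f -> measurable_fun setT g ->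
  measurable [set x | f x < g x].
Proof.
move=> mf mg; have /(_ measurableT [set true] I) := measurable_fun_ltr mf mg.
by rewrite setTI.
Qed.

Lemma measurable_ler_set f g : measurable_fun setT f -> measurable_fun setT g ->
  measurable [set x | f x <= g x].
Proof.
move=> mf mg; have /(_ measurableT [set true] I) := measurable_fun_ler mf mg.
by rewrite setTI.
Qed.

Lemma measurable_eqr_set f g : measurable_fun setT f -> measurable_fun setT g ->
  measurable [set x | f x = g x].
Proof.
move=> mf mg; rewrite (_ : [set _ | _] =
    [set x | f x <= g x] `&` [set x | g x <= f x]).
  by apply: measurableI; exact: measurable_ler_set.
apply/seteqP; split => x /= => [->//|[fg gf]]; apply/eqP.
by rewrite eq_le fg gf.
Qed.

Lemma measurable_preimage_set d' (T' : measurableType d') (f : T -> T') A :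
  measurable_fun setT f -> measurable A -> measurable (f @^-1` A).
Proof. by move=> mf mA; rewrite -[X in measurable X]setTI; exact: mf. Qed.

End measurable_sets_of_functions.

Section path_space.
Variable R : realType.
Implicit Types (w : D R) (t s a b c r u z : R).

(** Rays suffice: boxes of this kind are stable under intersection and also detect death, as
    [measurable_hboxes] shows. Times and bounds are sequences, so that boxes can be concatenated. *)
Definition hbox (n : nat) (t c : nat -> R) : set (D R) :=
  [set w | forall i, (i < n)%N -> exists a, dval w (t i) = Some a /\ c i < a].

Definition hboxes : set (set (D R)) :=
  [set A | exists n (t c : nat -> R), (forall i, 0 <= t i) /\ A = hbox n t c].

Lemma hboxesT : hboxes setT.
Proof.
exists 0%N, (fun=> 0), (fun=> 0); split => //.
by apply/seteqP; split => // w _ i.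
Qed.

Lemma setI_closed_hboxes : setI_closed hboxes.
Proof.
move=> _ _ [n [t [c [t0 ->]]]] [m [t' [c' [t'0 ->]]]].
pose glue (f g : nat -> R) i := if (i < n)%N then f i else g (i - n)%N.
exists (n + m)%N, (glue t t'), (glue c c'); split.
  by move=> i; rewrite /glue; case: ifP.
apply/seteqP; split => [w [h1 h2] i inm|w h].
  rewrite /glue; case: ltnP => ni; first exact: h1.
  by apply: h2; rewrite ltn_subLR.
split => i ni.
  by have := h i; rewrite /glue ni => /(_ (ltn_addr _ ni)).
by have := h (n + i)%N; rewrite /glue (ltnNge (n + i)%N n) leq_addr/= addKn ltn_add2l; exact.
Qed.

Lemma measurable_coord t (B : set R) : measurable B ->
  measurable [set w : D R | exists a, dval w t = Some a /\ B a].
Proof. by move=> mB; apply: sub_sigma_algebra; exists t; right; exists B. Qed.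

Lemma measurable_dead t : measurable [set w : D R | dval w t = None].
Proof. by apply: sub_sigma_algebra; exists t; left. Qed.

Lemma measurable_hbox n (t c : nat -> R) : measurable (hbox n t c).
Proof.
rewrite (_ : hbox n t c = \bigcap_(i < n)
    [set w : D R | exists a, dval w (t i) = Some a /\ c i < a]); last first.
  by apply/seteqP; split.
rewrite bigcap_mkord; apply: bigsetI_measurable => i _.
have := @measurable_coord (t i) `]c i, +oo[ (measurable_itv _).
by under eq_set do under eq_exists do rewrite /= in_itv/= andbT.
Qed.

(** Death at [t] is the failure of [- k < w t] for every natural [k]; Borel conditions at [t] follow
    from rays through the generators of the Borel sets. *)
Lemma measurable_hboxes : @measurable _ (D R) = <<s hboxes >>.
Proof.
apply/seteqP; split; last first.
  apply: smallest_sub; first exact: sigma_algebra_measurable.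
  by move=> _ [n [t [c [_ ->]]]]; exact: measurable_hbox.
have [s0 sC sU] := smallest_sigma_algebra setT hboxes.
have ray t c : <<s hboxes >> [set w : D R | exists a, dval w t = Some a /\ c < a].
  have [t0|t0] := leP 0 t.
    apply: sub_sigma_algebra; exists 1%N, (fun=> t), (fun=> c); split => //.
    by apply/seteqP; split => [w /= ? [|]//|w /(_ 0%N isT)].
  rewrite (_ : [set _ | _] = set0)//; apply/seteqP; split => // w [a []].
  by have [neg _ _] := dcadlag w; rewrite neg.
have dead t : <<s hboxes >> [set w : D R | dval w t = None].
  rewrite (_ : [set _ | _] = setT `\` \bigcup_k
      [set w : D R | exists a, dval w t = Some a /\ - k%:R < a]).
    by apply: sC; exact: sU.
  apply/seteqP; split => [w /= wt|w /= [_ h]].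
    by split => // -[k _ [a []]]; rewrite wt.
  case E : (dval w t) => [a|//]; exfalso; apply: h.
  exists (Num.bound `|a|) => //; exists a; split => //.
  have := archi_boundP (normr_ge0 a); rewrite ltr_norml.
  by case/andP.
apply: smallest_sub; first exact: smallest_sigma_algebra.
move=> _ [t [->|[B [mB ->]]]]; first exact: dead.
pose C : set (set R) := [set B | <<s hboxes >>
  [set w : D R | exists a, dval w t = Some a /\ B a]].
suff : <<s @RGenOInfty.G R >> `<=` C.
  have : (@RGenOInfty.G R).-sigma.-measurable B.
    by rewrite -RGenOInfty.measurableE.
  by move=> GB; apply.
apply: smallest_sub; last first.
  move=> _ [c ->]; rewrite /C/=.
  under eq_set do under eq_exists do rewrite /= in_itv/= andbT.
  exact: ray.
split; rewrite /C/=.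
- by rewrite (_ : [set _ | _] = set0)//; apply/seteqP; split => // w [a []].
- move=> A CA.
  rewrite (_ : [set _ | _] = setT `\` ([set w : D R | dval w t = None] `|`
      [set w : D R | exists a, dval w t = Some a /\ A a])).
    apply: sC; apply: (@measurableU _ (g_sigma_algebraType hboxes)) => //.
    exact: dead.
  apply/seteqP; split => [w /= [a [wa [_ Aa]]]|w /= [_ h]].
    split => // -[|[b []]]; first by rewrite wa.
    by rewrite wa => -[<-].
  case E : (dval w t) => [a|]; last by exfalso; apply: h; left.
  exists a; split => //; split => // Aa; apply: h; right.
  by exists a.
- move=> F CF.
  rewrite (_ : [set _ | _] = \bigcup_k
      [set w : D R | exists a, dval w t = Some a /\ F k a]); first exact: sU.
  apply/seteqP; split => [w [a [wa [k _ ?]]]|w [k _ [a [wa ?]]]].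
    by exists k => //; exists a.
  by exists a; split => //; exists k.
Qed.

Lemma measurable_fun_path d (T : measurableType d) (F : T -> D R) :
  (forall t c, 0 <= t ->
    measurable [set x | exists a, dval (F x) t = Some a /\ c < a]) ->
  measurable_fun setT F.
Proof.
move=> h; apply: (measurability _ measurable_hboxes).
move=> _ [_ [n [t [c [t0 ->]]]] <-]; rewrite setTI.
rewrite (_ : _ @^-1` _ = \bigcap_(i < n)
    [set x | exists a, dval (F x) (t i) = Some a /\ c i < a]); last first.
  by apply/seteqP; split.
by rewrite bigcap_mkord; apply: bigsetI_measurable => i _; exact: h.
Qed.

Lemma path_measure_unique (m1 m2 : {measure set (D R) -> \bar R}) :
  (m1 setT < +oo)%E ->
  (forall n (t c : nat -> R), (forall i, 0 <= t i) -> m1 (hbox n t c) = m2 (hbox n t c)) ->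
  forall A, measurable A -> m1 A = m2 A.
Proof.
move=> fin h; apply: (measure_unique_pi measurable_hboxes) => //.
- exact: setI_closed_hboxes.
- exact: hboxesT.
- by move=> _ [n [t [c [t0 ->]]]]; exact: h.
Qed.

(* [odflt z (w t)] for a default value [z]; two values of [z] detect death. *)
Definition pvald z (p : R -> option R) t : R := odflt z (p t).

Lemma measurable_pvald_coord z t : measurable_fun setT (fun w : D R => pvald z w t).
Proof.
move=> _ B mB; rewrite setTI.
have [Bz|Bz] := pselect (B z).
  rewrite (_ : _ @^-1` _ = [set w : D R | dval w t = None] `|`
      [set w : D R | exists a, dval w t = Some a /\ B a]).
    by apply: measurableU; [exact: measurable_dead|exact: measurable_coord].
  apply/seteqP; split => w; rewrite /preimage/= /pvald.
    by case: (dval w t) => [a|]; [right; exists a|left].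
  by case: (dval w t) => [a [//|[b [[<-]//]]]|].
rewrite (_ : _ @^-1` _ = [set w : D R | exists a, dval w t = Some a /\ B a]).
  exact: measurable_coord.
apply/seteqP; split => w; rewrite /preimage/= /pvald.
  by case: (dval w t) => [a|//]; exists a.
by case: (dval w t) => [a [b [[<-]//]]|[a []]].
Qed.

(** The index [g t] has countably many values, and on each of its fibres a single coordinate is
    read. *)
Lemma measurable_pvald_grid z (m : int) (g : R -> int) (h : int -> R) :
  (forall k, measurable (g @^-1` [set k])) ->
  measurable_fun setT (fun x : R * D R => pvald z x.2 (h (g x.1))).
Proof.
move=> mg _ B mB; rewrite setTI.
rewrite (_ : _ @^-1` _ = \bigcup_(k in [set: int])
    ((g @^-1` [set k]) `*` [set w : D R | B (pvald z w (h k))])).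
  apply: countable_bigcupT_measurable => // k; apply: measurableX; first exact: mg.
  by have := @measurable_pvald_coord z (h k) measurableT B mB; rewrite setTI.
apply/seteqP; split => [[t w]/= Bw|[t w] [k _ [/= <-]]//].
by exists (g t) => //; split.
Qed.

Lemma measurable_floor_fiber (n : nat) (k : int) :
  measurable ((fun t : R => Num.floor (t * n.+1%:R)) @^-1` [set k]).
Proof.
rewrite (_ : _ @^-1` _ = [set t | k%:~R <= t * n.+1%:R] `&`
    [set t | t * n.+1%:R < (k + 1)%:~R]).
  apply: measurableI; [apply: measurable_ler_set|apply: measurable_ltr_set] => //;
    exact: measurable_funM.
apply/seteqP; split => t; rewrite /preimage/=.
  by move/eqP; rewrite real_floor_eq ?num_real// => /andP[].
by move=> [h1 h2]; apply/eqP; rewrite real_floor_eq ?num_real// h1.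
Qed.

Lemma measurable_ceil_fiber (n : nat) (k : int) :
  measurable ((fun t : R => Num.ceil (t * n.+1%:R)) @^-1` [set k]).
Proof.
rewrite (_ : _ @^-1` _ = [set t | (k - 1)%:~R < t * n.+1%:R] `&`
    [set t | t * n.+1%:R <= k%:~R]).
  apply: measurableI; [apply: measurable_ltr_set|apply: measurable_ler_set] => //;
    exact: measurable_funM.
apply/seteqP; split => t; rewrite /preimage/=.
  by move/eqP; rewrite real_ceil_eq ?num_real// => /andP[].
by move=> [h1 h2]; apply/eqP; rewrite real_ceil_eq ?num_real// h1.
Qed.

Lemma pvald_right_cvg z (p : R -> option R) t (s : nat -> R) : cadlag p ->
  (forall n, t <= s n) -> s n @[n --> \oo] --> t ->
  pvald z p (s n) @[n --> \oo] --> pvald z p t.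
Proof.
move=> [neg rc _] ts st.
have near_s d : 0 < d -> \forall n \near \oo, t <= s n < t + d.
  move=> d0; move/cvgrPdist_lt : st => /(_ _ d0); apply: filterS => n.
  by rewrite ts/= distrC ltr_norml => /andP[_]; rewrite ltrBlDl.
have [t0|t0] := leP 0 t; last first.
  apply/cvgrPdist_lt => e e0; have t'0 : 0 < - t by rewrite oppr_gt0.
  apply: filterS (near_s _ t'0) => n /andP[_]; rewrite subrr => sn.
  by rewrite /pvald !neg// subrr normr0.
move: (rc _ t0); rewrite /right_cont.
case E : (p t) => [a|].
  move=> h; apply/cvgrPdist_lt => e /h[d [d0 hd]].
  apply: filterS (near_s _ d0) => n /hd[b [pb ab]].
  by rewrite /pvald pb E/= distrC.
move=> [d [d0 hd]]; apply/cvgrPdist_lt => e e0.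
by apply: filterS (near_s _ d0) => n /hd; rewrite /pvald E => -> /=; rewrite subrr normr0.
Qed.

(** Right-continuity makes the evaluation at a varying time a limit of evaluations on grids. *)
Lemma measurable_pvald z : measurable_fun setT (fun x : R * D R => pvald z x.2 x.1).
Proof.
apply: (@measurable_fun_cvg _ _ _ _
  (fun n (x : R * D R) => pvald z x.2 (grid_above n x.1))).
  move=> n; apply: (@measurable_pvald_grid z 0 (fun t => Num.floor (t * n.+1%:R))
    (fun k => (k + 1)%:~R / n.+1%:R)).
  by move=> k; exact: measurable_floor_fiber.
move=> [t w] _ /=; apply: pvald_right_cvg.
- exact: dcadlag.
- by move=> n; rewrite ltW// grid_above_gt.
- exact: cvg_grid_above.
Qed.

Lemma measurable_pval : measurable_fun setT (fun x : R * D R => pval x.2 x.1).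
Proof. exact: (measurable_pvald 0). Qed.

Lemma measurable_alive_set : measurable [set x : R * D R | dval x.2 x.1 <> None].
Proof.
rewrite (_ : [set _ | _] = [set x : R * D R | pvald 1 x.2 x.1 = pvald 0 x.2 x.1]).
  by apply: measurable_eqr_set; exact: measurable_pvald.
apply/seteqP; split => -[t w] /=; rewrite /pvald; case: (dval w t) => //=.
by move/eqP; rewrite oner_eq0.
Qed.

Lemma measurable_llim : measurable_fun setT (fun x : R * D R => llim x.2 x.1).
Proof.
apply: measurableT_comp => //; apply: measurable_fun_limn_esup => n.
apply/measurable_EFinP; apply: (@measurable_pvald_grid 0 0
  (fun t => Num.ceil (t * n.+1%:R)) (fun k => (k - 1)%:~R / n.+1%:R)).
by move=> k; exact: measurable_ceil_fiber.
Qed.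

Definition killD t w : D R := toD (kill w t%:E).
(** Truncating [r] at 0 keeps the shifted path cadlag, so the map is total and jointly
    measurable. *)
Definition shiftD r u w : D R := toD (shift_sub w (Num.max r 0)%:E u).
Definition stopD a w : D R := toD (stop w (Num.max a 0)).

Lemma killDE t w : dval (killD t w) = kill w t%:E.
Proof. by rewrite toDE//; apply: cadlag_kill; exact: dcadlag. Qed.

Lemma shiftD_val r u w : dval (shiftD r u w) = shift_sub w (Num.max r 0)%:E u.
Proof.
rewrite /shiftD toDE//; apply: cadlag_shift_sub; first exact: dcadlag.
by rewrite le_max lexx orbT.
Qed.

Lemma shiftDE r u w : 0 <= r -> dval (shiftD r u w) = shift_sub w r%:E u.
Proof.
by move=> r0; rewrite shiftD_val max_l.
Qed.

Lemma stopDE a w : 0 <= a -> dval (stopD a w) = stop w a.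
Proof.
move=> a0; rewrite /stopD toDE ?max_l//; apply: cadlag_stop => //.
exact: dcadlag.
Qed.

Lemma measurable_killD : measurable_fun setT (fun x : R * D R => killD x.1 x.2).
Proof.
apply: measurable_fun_path => t c t0.
rewrite (_ : [set _ | _] = `]t, +oo[ `*`
    [set w : D R | exists a, dval w t = Some a /\ a \in `]c, +oo[]).
  apply: measurableX; first exact: measurable_itv.
  by apply: (@measurable_coord t); exact: measurable_itv.
apply/seteqP; split => -[r w] /=; rewrite killDE /kill lte_fin !in_itv/= andbT.
  case: ltP => tr; last by move=> [a []].
  by move=> [a [wa ca]]; split => //; exists a; rewrite in_itv/= andbT.
by move=> [-> [a [wa]]]; rewrite in_itv/= andbT => ca; exists a.
Qed.

Lemma measurable_shiftD :
  measurable_fun setT (fun x : (R * R) * D R => shiftD x.1.1 x.1.2 x.2).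
Proof.
have mt t : measurable_fun setT (fun x : (R * R) * D R => (Num.max x.1.1 0 + t, x.2)).
  apply: measurable_fun_pair => //; apply: measurable_funD => //.
  by apply: measurable_maxr => //; exact: measurableT_comp.
apply: measurable_fun_path => t c t0.
rewrite (_ : [set _ | _] =
  ((fun x : (R * R) * D R => (Num.max x.1.1 0 + t, x.2)) @^-1`
      [set x : R * D R | dval x.2 x.1 <> None]) `&`
  [set x : (R * R) * D R | c < pval x.2 (Num.max x.1.1 0 + t) - x.1.2]).
  apply: measurableI.
    by apply: measurable_preimage_set => //; exact: measurable_alive_set.
  apply: measurable_ltr_set => //; apply: measurable_funB.
    exact: (measurableT_comp measurable_pval (mt t)).
  exact: measurableT_comp.
apply/seteqP; split => -[[r u] w] /=;
  rewrite /pval /preimage/= shiftD_val /shift_sub (ltNge t 0) t0/=;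
  case: (dval w _) => [a|] //=.
- by move=> [b [[<-] cb]].
- by move=> [b []].
- by move=> [_ ca]; exists (a - u).
- by case.
Qed.

Lemma measurable_stopD a : measurable_fun setT (stopD a).
Proof.
apply: measurable_fun_path => t c t0.
have a0 : 0 <= Num.max a 0 by rewrite le_max lexx orbT.
have -> : [set w | exists x, dval (stopD a w) t = Some x /\ c < x] =
    [set w : D R | exists x, dval w (Num.min t (Num.max a 0)) = Some x /\ x \in `]c, +oo[].
  apply/seteqP; split => w /=; rewrite /stopD toDE ?/stop ?(ltNge t 0) ?t0/=;
    try (by apply: cadlag_stop => //; exact: dcadlag).
    by move=> [x [wx cx]]; exists x; rewrite in_itv/= cx.
  by move=> [x [wx cx]]; exists x; move: cx; rewrite in_itv/= andbT.
by apply: measurable_coord; exact: measurable_itv.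
Qed.

Lemma right_cont_rat w t a z e : 0 <= t -> dval w t = Some a -> z < a -> 0 < e ->
  exists q : rat, [/\ t < ratr q, ratr q < t + e &
    exists b, dval w (ratr q) = Some b /\ z < b].
Proof.
move=> t0 wt za e0; have [_ rc _] := dcadlag w.
have := rc _ t0; rewrite /right_cont wt => /(_ (a - z)).
rewrite subr_gt0 => /(_ za)[d [d0 hd]].
have : t < t + Num.min d e by rewrite ltrDl lt_min d0.
move=> /rat_in_itvoo[q]; rewrite in_itv/= => /andP[tq]; rewrite -ltrBlDl lt_min.
move=> /andP[qd qe]; exists q; split => //; first by rewrite -ltrBlDl.
have [|b [wb ab]] := hd (ratr q); first by rewrite (ltW tq)/= -ltrBlDl.
by exists b; split => //; move: ab; rewrite ltr_norml => /andP[]; lra.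
Qed.

Lemma dead_rat w t e : 0 <= t -> dval w t = None -> 0 < e ->
  exists q : rat, [/\ t < ratr q, ratr q < t + e & dval w (ratr q) = None].
Proof.
move=> t0 wt e0; have [_ rc _] := dcadlag w.
have := rc _ t0; rewrite /right_cont wt => -[d [d0 hd]].
have : t < t + Num.min d e by rewrite ltrDl lt_min d0.
move=> /rat_in_itvoo[q]; rewrite in_itv/= => /andP[tq]; rewrite -ltrBlDl lt_min.
move=> /andP[qd qe]; exists q; split => //; first by rewrite -ltrBlDl.
by apply: hd; rewrite (ltW tq)/= -ltrBlDl.
Qed.

(** By right-continuity a path that enters an open set, or dies, before [c] is found there at a
    rational time before [c]; the events [f < c] are then countable unions. *)
Lemma measurable_fun_hitting (f : D R -> \bar R) (S : R -> set (D R)) :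
  (forall t, measurable (S t)) ->
  (forall w c, (f w < c%:E)%E <-> exists2 q : rat, (0 : R) < ratr q < c & S (ratr q) w) ->
  (forall w, 0 <= f w)%E -> measurable_fun setT f.
Proof.
move=> mS fS f0; apply: (measurability _ (ErealGenCInfty.measurableE R)).
move=> _ [_ [c ->] <-]; rewrite setTI.
rewrite (_ : f @^-1` _ = ~` [set w | (f w < c%:E)%E]); last first.
  apply/seteqP; split => w; rewrite /preimage/= in_itv/= andbT.
    by rewrite leNgt => /negP.
  by move/negP; rewrite -leNgt.
apply: measurableC; rewrite (_ : [set _ | _] =
  \bigcup_(q in [set q : rat | (0 : R) < ratr q < c]) S (ratr q)).
  rewrite bigcup_mkcond; apply: bigcupT_measurable_rat => q.
  by case: ifP => // _.
apply/seteqP; split => [w /= /fS[q qc Sq]|w [q /= qc Sq]]; first by exists q.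
by apply/fS; exists q.
Qed.

Lemma measurable_tau z : measurable_fun setT (fun w : D R => tau z w).
Proof.
apply: (@measurable_fun_hitting _ (fun t => [set w : D R |
  exists a, dval w t = Some a /\ a \in `]z, +oo[])).
- by move=> t; apply: measurable_coord; exact: measurable_itv.
- move=> w c; split.
    move/ereal_inf_lt => [_ [t [t0 [a [wa za]]] <-]]; rewrite lte_fin => tc.
    have ct : 0 < c - t by lra.
    have [q [tq qc [b [wb zb]]]] := right_cont_rat (ltW t0) wa za ct.
    exists q; first by rewrite (lt_trans t0 tq)/=; lra.
    by exists b; rewrite in_itv/= zb.
  move=> [q /andP[q0 qc] [a [wa]]]; rewrite in_itv/= andbT => za.
  apply: (@le_lt_trans _ _ (ratr q)%:E); last by rewrite lte_fin.
  by apply: ereal_inf_lbound; exists (ratr q) => //; split => //; exists a.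
- move=> w.
  by apply: le_ereal_inf_tmp => _ [t [t0 _] <-]; rewrite lee_fin ltW.
Qed.

Lemma measurable_tauD : measurable_fun setT (fun w : D R => tauD w).
Proof.
apply: (@measurable_fun_hitting _ (fun t => [set w : D R | dval w t = None])).
- by move=> t; exact: measurable_dead.
- move=> w c; split.
    move/ereal_inf_lt => [_ [t [t0 wt] <-]]; rewrite lte_fin => tc.
    have ct : 0 < c - t by lra.
    have [q [tq qc wb]] := dead_rat (ltW t0) wt ct.
    by exists q => //; rewrite (lt_trans t0 tq)/=; lra.
  move=> [q /andP[q0 qc] wq].
  apply: (@le_lt_trans _ _ (ratr q)%:E); last by rewrite lte_fin.
  by apply: ereal_inf_lbound; exists (ratr q).
- move=> w.
  by apply: le_ereal_inf_tmp => _ [t [t0 _] <-]; rewrite lee_fin ltW.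
Qed.

(** The full set of paths on which the proof works. [levy_family] gives life at each fixed time;
    rational times and right-continuity extend it to all times at once. *)
Definition Om : set (D R) := [set w : D R | alive w /\ dval w 0 = Some 0].

Lemma alive_ratP w : alive w <-> forall q : rat, 0 <= ratr q :> R -> dval w (ratr q) <> None.
Proof.
split=> [aw q q0|h t t0 wt]; first exact: aw.
have [q [tq _ wq]] := dead_rat t0 wt ltr01.
by apply: (h q) => //; rewrite (le_trans t0)// ltW.
Qed.

Lemma measurable_alive : measurable [set w : D R | alive w].
Proof.
rewrite (_ : [set _ | _] = ~` \bigcup_(q in [set q : rat | 0 <= ratr q :> R])
    [set w : D R | dval w (ratr q) = None]).
  apply: measurableC; rewrite bigcup_mkcond; apply: bigcupT_measurable_rat => q.
  by case: ifP => // _; exact: measurable_dead.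
apply/seteqP; split => [w /= /alive_ratP h [q /= q0]|w /= h]; first exact: h.
by apply/alive_ratP => q q0 wq; apply: h; exists q.
Qed.

Lemma measurable_Om : measurable Om.
Proof.
apply: measurableI; first exact: measurable_alive.
have := @measurable_coord 0 [set 0] (measurable_set1 _).
congr (measurable _); apply/seteqP; split => w /=; first by move=> [a [-> ->]].
by move=> ->; exists 0.
Qed.

End path_space.

(** * Sampling at finitely many times: merged grids and increments *)

Section sorted_times.
Variable R : realType.

(** The independence of increments concerns consecutive times of one grid. The times before [a], the
    time [a] and the times after [a] are therefore sorted together, [M] being the index of [a]. *)
Lemma sorted_times (a : R) (n m : nat) (t r : nat -> R) :
  0 <= a -> (forall i, 0 <= t i) -> (forall i, t i <= a) -> (forall j, 0 <= r j) ->
  exists s : nat -> R, exists M : nat, exists k l : nat -> nat,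
  [/\ s 0%N = 0, forall i, s i <= s i.+1, s M = a,
    forall i, (i < n)%N -> (k i <= M)%N /\ s (k i) = t i &
    forall j, (j < m)%N -> s (M + l j)%N = a + r j].
Proof.
move=> a0 t0 ta r0.
pose L0 := 0 :: a :: [seq t i | i <- iota 0 n] ++ [seq a + r j | j <- iota 0 m].
pose L := sort <=%R L0.
have L0ge0 x : x \in L0 -> 0 <= x.
  rewrite !inE mem_cat => /orP[/eqP->//|/orP[/eqP->//|/orP[]]].
    by move=> /mapP[i _ ->].
  by move=> /mapP[j _ ->]; rewrite addr_ge0.
(* The default is the last time, so the sequence stays nondecreasing beyond the end of the list. *)
pose s k := nth (last 0 L) L k.
have srt : sorted <=%R L by apply: sort_sorted; exact: le_total.
have szL : (0 < size L)%N by rewrite size_sort.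
have sS i : s i <= s i.+1.
  rewrite /s; case: (ltnP i.+1 (size L)) => iL.
    by apply: (sorted_leq_nth le_trans le_refl) => //; rewrite inE// ltnW.
  rewrite (nth_default _ iL); case: (ltnP i (size L)) => iL'; last by rewrite nth_default.
  have -> : i = (size L).-1 by apply/eqP; rewrite eqn_leq -ltnS prednK// iL' -ltnS prednK//.
  by rewrite nth_last; case: (L) szL.
have smono i j : (i <= j)%N -> s i <= s j.
  by move=> ij; apply: (homo_leq le_refl le_trans).
have sidx x : x \in L0 -> s (index x L) = x.
  by move=> xL; rewrite /s nth_index// mem_sort.
have idx_le x y : x \in L0 -> y \in L0 -> x <= y -> (index x L <= index y L)%N.
  move=> xL yL; rewrite le_eqVlt => /predU1P[->//|xy].
  by rewrite leqNgt; apply/negP => /ltnW/smono; rewrite !sidx// leNgt xy.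
have in0 : 0 \in L0 by rewrite inE eqxx.
have ina : a \in L0 by rewrite !inE eqxx orbT.
have intt i : (i < n)%N -> t i \in L0.
  by move=> iN; rewrite !inE mem_cat map_f ?orbT// mem_iota.
have inr j : (j < m)%N -> a + r j \in L0.
  move=> jm; rewrite !inE mem_cat; apply/orP; right; apply/orP; right; apply/orP; right.
  by apply: (map_f (fun j => a + r j)); rewrite mem_iota.
exists s, (index a L), (fun i => index (t i) L), (fun j => (index (a + r j)%R L - index a L)%N).
split => //.
- apply/eqP; rewrite eq_le; apply/andP; split.
    by rewrite -[leRHS](sidx 0)//; exact: smono.
  by rewrite /s L0ge0// -(mem_sort <=%R) mem_nth.
- exact: sidx.
- by move=> i iN; rewrite idx_le ?intt// sidx// intt.
- by move=> j jm; rewrite subnKC ?sidx ?inr// idx_le ?inr// lerDl.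
Qed.

End sorted_times.

Section sequence_space.
Variable R : realType.

Definition sbox (n : nat) (B : nat -> set R) : set (nat -> R) :=
  [set y | forall i, (i < n)%N -> B i (y i)].

Definition sboxes : set (set (nat -> R)) :=
  [set A | exists n B, (forall i, measurable (B i)) /\ A = sbox n B].

Notation SS := (g_sigma_algebraType sboxes).

Lemma sboxesT : sboxes setT.
Proof.
exists 0%N, (fun=> setT); split => //.
by apply/seteqP; split => // y _ i.
Qed.

Lemma setI_closed_sboxes : setI_closed sboxes.
Proof.
move=> A A' [n [B [mB ->]]] [m [B' [mB' ->]]].
pose C i := (if (i < n)%N then B i else setT) `&` (if (i < m)%N then B' i else setT).
exists (maxn n m), C; split.
  by move=> i; apply: measurableI; case: ifP.
apply/seteqP; split => [y [h1 h2] i inm|y h].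
  by split; case: ifP => // ?; [exact: h1|exact: h2].
split => i im; have := h i; rewrite leq_max im ?orbT => /(_ isT); rewrite /C im.
  by case.
by case.
Qed.

Lemma measurable_sbox n (B : nat -> set R) : (forall i, measurable (B i)) ->
  @measurable _ SS (sbox n B).
Proof. by move=> mB; apply: sub_sigma_algebra; exists n, B. Qed.

Lemma measurable_seq_coord i : measurable_fun setT (fun y : SS => y i).
Proof.
move=> _ B mB; rewrite setTI.
rewrite (_ : _ @^-1` _ = sbox i.+1 (fun j => if j == i then B else setT)).
  by apply: measurable_sbox => j; case: ifP.
apply/seteqP; split => y; rewrite /preimage/=.
  by move=> Byi j _; case: ifPn => // /eqP ->.
by move=> /(_ i (ltnSn i)); rewrite eqxx.
Qed.

(** On a path started at 0, a bound on a position is a bound on a partial sum of increments. *)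
Lemma measurable_partial_sums n (k : nat -> nat) (c : nat -> R) :
  @measurable _ SS [set y : nat -> R | forall i, (i < n)%N -> c i < \sum_(j < k i) y j].
Proof.
rewrite (_ : [set _ | _] = \bigcap_(i < n)
    [set y : SS | c i < \sum_(j < k i) y j]); last by apply/seteqP; split.
rewrite bigcap_mkord; apply: bigsetI_measurable => i _.
apply: measurable_ltr_set => //.
have := @measurable_sum _ SS R setT _ (enum 'I_(k i)) (fun j y => y (val j))
  (fun j => measurable_seq_coord (val j)).
by apply: eq_measurable_fun => y _; rewrite big_enum.
Qed.

Definition increments (t : nat -> R) (w : D R) : SS :=
  fun i => pval w (t i.+1) - pval w (t i).

Lemma measurable_increments t : measurable_fun setT (increments t).
Proof.
apply: (@measurability _ _ _ SS _ _ sboxes) => //.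
move=> _ [_ [n [B [mB ->]]] <-]; rewrite setTI.
rewrite (_ : _ @^-1` _ = \bigcap_(i < n)
    [set w : D R | B i (pval w (t i.+1) - pval w (t i))]); last by apply/seteqP; split.
rewrite bigcap_mkord; apply: bigsetI_measurable => i _.
apply: (@measurable_preimage_set _ _ _ R
  (fun w : D R => pval w (t i.+1) - pval w (t i)) (B i)) => //.
by apply: measurable_funB; exact: (measurable_pvald_coord 0).
Qed.

Lemma sum_increments t w k : \sum_(i < k) increments t w i = pval w (t k) - pval w (t 0%N).
Proof.
elim: k => [|k IH]; first by rewrite big_ord0 subrr.
by rewrite big_ord_recr/= IH /increments addrC subrKA.
Qed.

End sequence_space.
Notation SS R := (g_sigma_algebraType (@sboxes R)).

(** * Levy processes and the Markov property at a fixed time *)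

Section levy.
Variables (R : realType) (P : R -> probability (D R) R).
Hypothesis levyP : levy_family P.
Local Open Scope ereal_scope.

Lemma levy_alive z : P z (~` [set w : D R | alive w]) = 0.
Proof.
have [h _ _ _] := levyP.
pose F k : set (D R) := if @choice.unpickle rat k is Some q then
  (if (0 <= ratr (q : rat) :> R)%R then [set w : D R | dval w (ratr q) = None] else set0)
  else set0.
have : (P z).-negligible (\bigcup_k F k).
  apply: negligible_bigcup => k; rewrite /F; case: choice.unpickle => [q|]; last exact: negligible_set0.
  case: ifPn => q0; last exact: negligible_set0.
  by apply/negligibleP; [exact: measurable_dead|exact: h].
have sub : ~` [set w : D R | alive w] `<=` \bigcup_k F k.
  move=> w /= aw; apply: contrapT => H; apply: aw; apply/alive_ratP => q q0 wq; apply: H.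
  exists (choice.pickle q); first exact: I.
  rewrite /F choice.pickleK q0; exact: wq.
move=> /(negligibleS sub)/negligibleP; apply; apply: measurableC; exact: measurable_alive.
Qed.

Lemma levy_Om : P 0 (~` Om (R:=R)) = 0.
Proof.
have [_ h _ _] := levyP.
have m0 : measurable [set w : D R | dval w 0 = Some 0%R].
  have := @measurable_coord R 0 [set 0%R] (measurable_set1 _).
  congr (measurable _); apply/seteqP; split => w /=; first by move=> [a [-> ->]].
  by move=> ->; exists 0%R.
have N0 : P 0 (~` [set w : D R | dval w 0 = Some 0%R]) = 0.
  by rewrite probability_setC// [X in 1 - X]h subee.
apply/negligibleP; first by apply: measurableC; exact: measurable_Om.
apply: (@negligibleS _ _ _ _ (~` [set w : D R | alive w] `|`
    ~` [set w : D R | dval w 0 = Some 0%R])).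
  by rewrite -setCI.
apply: negligibleU; apply/negligibleP.
- by apply: measurableC; exact: measurable_alive.
- exact: levy_alive.
- exact: measurableC.
- exact: N0.
Qed.

Lemma levy_eq_set A B : measurable A -> measurable B ->
  (forall w, Om w -> A w <-> B w) -> P 0 A = P 0 B.
Proof.
move=> mA mB AB; have mO := @measurable_Om R.
have mOC : measurable (~` @Om R) by exact: measurableC.
have h C : measurable C -> P 0 C = P 0 (C `&` @Om R).
  move=> mC; rewrite -[in LHS](setIT C) -(setUv (@Om R)) setIUr measureU.
  - rewrite [X in _ + X](_ : _ = 0) ?adde0//.
    apply: (@subset_measure0 _ _ _ _ _ (~` @Om R)); last exact: levy_Om.
    + exact: measurableI.
    + exact: mOC.
    + exact: subIsetr.
  - exact: measurableI.
  - exact: measurableI.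
  - by rewrite setIACA setICr setI0.
rewrite (h A)// (h B)//; congr (P 0 _); apply/seteqP; split => w [? O]; split => //;
  exact/AB.
Qed.

Lemma levy_ae_eq_integral (f g : D R -> \bar R) : {in @Om R, f =1 g} ->
  \int[P 0]_w f w = \int[P 0]_w g w.
Proof.
by move=> fg; apply: (integral_full_set (@measurable_Om R) levy_Om).
Qed.

Definition addD (z : R) (w : D R) : D R := shiftD 0 (- z)%R w.

Lemma addDE z w t : (0 <= t)%R -> dval (addD z w) t = omap (+%R^~ z) (dval w t).
Proof.
move=> t0; rewrite /addD shiftDE// /shift_sub ltNge t0/= add0r.
by case: (dval w t) => //= a; rewrite opprK.
Qed.

Lemma measurable_addD : measurable_fun setT (fun x : R * D R => addD x.1 x.2).
Proof.
apply: (@measurableT_comp _ _ _ _ _ _ (fun x : (R * R) * D R =>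
  shiftD x.1.1 x.1.2 x.2) setT (fun x : R * D R => ((0, - x.1)%R, x.2))).
  exact: measurable_shiftD.
apply: measurable_fun_pair => //; apply: measurable_fun_pair => //.
exact: measurableT_comp.
Qed.

Lemma measurable_addDz z : measurable_fun setT (addD z).
Proof. exact: (measurable_fun_pair2 z measurable_addD). Qed.

(** Both sides are measures with the same masses on boxes: this is the translation clause of
    [levy_family]. *)
Lemma levy_start z A : measurable A -> P z A = P 0 (addD z @^-1` A).
Proof.
move=> mA; have [_ _ _ h] := levyP.
transitivity (image_measure (P 0) (measurable_addDz z) A); last by [].
apply: path_measure_unique => //.
  by rewrite -ge0_fin_numE//; exact: fin_num_measure.
move=> n t c t0; rewrite /=.
have := h z n t (fun i => `]c i, +oo[%classic) t0 (fun i => measurable_itv _).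
rewrite (_ : [set w : D R | _] = hbox n t c); last first.
  by apply/seteqP; split => w h' i /h'[a [wa ca]]; exists a; split => //;
    move: ca; rewrite /= in_itv/= andbT.
move=> ->; apply: (@congr1 _ _ (P 0)); apply/seteqP; split => w h' i /h'.
  move=> [a [wa]]; rewrite /= in_itv/= andbT => ca; exists (a + z)%R.
  by rewrite addDE// wa.
rewrite addDE//; case: (dval w (t i)) => [a|] /= [b []]// [<-] ca.
by exists a; rewrite in_itv/= andbT.
Qed.

(** The future after [a], recentred so that it starts at 0 as under [P 0]. *)
Definition thetaD (a : R) (w : D R) : D R := shiftD a (pval w a) w.

Lemma measurable_thetaD2 : measurable_fun setT (fun x : R * D R => thetaD x.1 x.2).
Proof.
apply: (@measurableT_comp _ _ _ _ _ _ (fun x : (R * R) * D R =>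
  shiftD x.1.1 x.1.2 x.2) setT (fun x : R * D R => ((x.1, pval x.2 x.1), x.2))).
  exact: measurable_shiftD.
apply: measurable_fun_pair => //; apply: measurable_fun_pair => //.
exact: measurable_pval.
Qed.

Lemma measurable_thetaD a : measurable_fun setT (thetaD a).
Proof. exact: (measurable_fun_pair2 a measurable_thetaD2). Qed.

Lemma levy_increments (t : nat -> R) n (B : nat -> set R) :
  (0 <= t 0%N)%R -> (forall i, t i <= t i.+1)%R -> (forall i, measurable (B i)) ->
  P 0 (increments t @^-1` sbox n B) =
  \prod_(i < n) P 0 [set w : D R | exists a, dval w (t i.+1 - t i)%R = Some a /\ B i a].
Proof.
move=> t0 tS mB; have [_ _ h _] := levyP.
have ti i : (0 <= t i)%R by elim: i => // i /le_trans; apply.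
rewrite -h//; apply: levy_eq_set.
- apply: measurable_preimage_set; [exact: measurable_increments|exact: measurable_sbox].
- rewrite (_ : [set _ | _] = \bigcap_(i < n) [set w : D R | exists a b,
      dval w (t i.+1) = Some a /\ dval w (t i) = Some b /\ B i (a - b)%R]); last first.
    by apply/seteqP; split.
  rewrite bigcap_mkord; apply: bigsetI_measurable => i _.
  rewrite (_ : [set _ | _] = (~` [set w : D R | dval w (t i.+1) = None] `&`
      ~` [set w : D R | dval w (t i) = None]) `&`
      [set w : D R | B i (pval w (t i.+1) - pval w (t i))%R]).
    apply: measurableI.
      by apply: measurableI; apply: measurableC; exact: measurable_dead.
    apply: (@measurable_preimage_set _ _ _ R
      (fun w : D R => pval w (t i.+1) - pval w (t i))%R (B i)) => //.
    by apply: measurable_funB; exact: (measurable_pvald_coord 0).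
  apply/seteqP; split => w; rewrite /pval/=; last first.
    move=> [[]]; case: (dval w (t i.+1)) => // a _; case: (dval w (t i)) => // b _ ?.
    by exists a, b.
  by move=> [a [b [-> [-> ?]]]].
- move=> w [aw _]; split => h' i /h'; rewrite /increments.
    by move=> ?; exists (pval w (t i.+1)), (pval w (t i)); rewrite -!alive_pval.
  by move=> [a [b [wa [wb ?]]]]; rewrite /pval wa wb.
Qed.

End levy.

Section markov.
Variables (R : realType) (P : R -> probability (D R) R).
Hypothesis levyP : levy_family P.
Local Open Scope ereal_scope.

(* Freezing the indices at [M] keeps the increments up to time [s M] in the same
   sequence space. *)
Lemma increments_independent (s : nat -> R) (M : nat) (E F : set (SS R)) :
  s 0%N = 0%R -> (forall i, s i <= s i.+1)%R -> measurable E -> measurable F ->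
  P 0 (increments (fun i => s (minn i M)) @^-1` E `&`
       increments (fun i => s (M + i)%N) @^-1` F) =
  P 0 (increments (fun i => s (minn i M)) @^-1` E) *
  P 0 (increments (fun i => s (M + i)%N - s M)%R @^-1` F).
Proof.
move=> s0 sS mE mF.
have smono i j : (i <= j)%N -> (s i <= s j)%R.
  by move=> ij; apply: (homo_leq le_refl le_trans).
have tS i : (s (minn i M) <= s (minn i.+1 M))%R.
  by apply: smono; rewrite leq_min !geq_min leqnSn leqnn !orbT.
pose q := image_measure (P 0) (measurable_increments (fun i => s (M + i)%N - s M)%R).
rewrite -[X in _ = _ * X]/(q F); move: E F mE mF.
apply: (@independence_generated _ _ _ (D R) (SS R) (SS R) R (P 0)
  (increments (fun i => s (minn i M))) (increments (fun i => s (M + i)%N)) q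
  (@sboxes R) (@sboxes R)) => //.
- by rewrite -ge0_fin_numE//; exact: fin_num_measure.
- rewrite image_measureE preimage_setT -ge0_fin_numE//; exact: fin_num_measure.
- exact: measurable_increments.
- exact: measurable_increments.
- exact: setI_closed_sboxes.
- exact: setI_closed_sboxes.
- exact: sboxesT.
- exact: sboxesT.
move=> _ _ [n1 [B1 [mB1 ->]]] [n2 [B2 [mB2 ->]]].
pose N1 := (n1 + M)%N.
pose C1 i := if (i < n1)%N then B1 i else setT.
pose t i := if (i <= N1)%N then s (minn i M) else s (M + (i - N1))%N.
pose B i := if (i < N1)%N then C1 i else B2 (i - N1)%N.
have tN j : t (N1 + j)%N = s (M + j)%N.
  rewrite /t; case: leqP => [|_]; last by rewrite addKn.
  case: j => [_|j]; last by rewrite -[leqRHS]addn0 leq_add2l.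
  by rewrite !addn0 (minn_idPr _)// leq_addl.
have tlt i : (i <= N1)%N -> t i = s (minn i M) by rewrite /t => ->.
have t0 : (0 <= t 0%N)%R by rewrite tlt// min0n s0.
have t_mono i : (t i <= t i.+1)%R.
  have [iN|iN] := leqP i.+1 N1; first by rewrite !tlt// ltnW.
  have [k ->] : exists k, i = (N1 + k)%N by exists (i - N1)%N; rewrite subnKC.
  by rewrite -addnS !tN addnS.
have mC1 i : measurable (C1 i) by rewrite /C1; case: ifP.
have mB i : measurable (B i) by rewrite /B; case: ifP.
have sboxC1 : sbox n1 B1 = sbox N1 C1.
  apply/seteqP; split => y h i iN; rewrite ?/C1.
    by case: ifP => // ?; exact: h.
  by have := h i; rewrite /C1 iN; apply; rewrite ltn_addr.
rewrite (_ : _ `&` _ = increments t @^-1` sbox (N1 + n2) B); last first.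
  rewrite sboxC1; apply/seteqP; split => [w [h1 h2] i iN|w h].
    rewrite /increments /B; case: ltnP => iN1.
      by rewrite !tlt// ?(ltnW iN1)//; exact: h1.
    have [k kE] : exists k, i = (N1 + k)%N by exists (i - N1)%N; rewrite subnKC.
    rewrite kE -addnS !tN addKn; apply: h2.
    by move: iN; rewrite kE ltn_add2l.
  split => i iN.
    have := h i (ltn_addr _ iN); rewrite /increments /B iN !tlt// ltnW//.
  have := h (N1 + i)%N; rewrite ltn_add2l => /(_ iN).
  by rewrite /increments /B ltnNge leq_addr/= addKn -addnS !tN.
have s'0 : (0 <= s (minn 0 M))%R by rewrite min0n s0.
have s''0 : (0 <= s (M + 0)%N - s M)%R by rewrite addn0 subrr.
have s''S i : (s (M + i)%N - s M <= s (M + i.+1)%N - s M)%R by rewrite lerB// addnS.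
have L1 := levy_increments levyP (t := fun i => s (minn i M)) N1 s'0 tS mC1.
have L2 := levy_increments levyP (t := fun i => (s (M + i)%N - s M)%R) n2 s''0 s''S mB2.
rewrite sboxC1 [X in X * _]L1 [X in _ * X]L2.
apply: (etrans (levy_increments levyP (t := t) (N1 + n2) t0 t_mono mB)).
rewrite big_split_ord/=; congr (_ * _); apply: eq_bigr => i _.
  by rewrite /B (ltn_ord i) !tlt// ltnW.
rewrite /B ltnNge leq_addr/= addKn -addnS !tN; congr (P 0 _).
apply/seteqP; split => w [a [wa ?]]; exists a; split => //; rewrite -wa; congr (dval w _).
  by rewrite opprB addrA subrK.
by rewrite opprB addrA subrK.
Qed.

(** On [Om] positions are partial sums of increments along the merged grid of [sorted_times], so
    that the past box and the future box depend on independent blocks of increments. *)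
Lemma markov_hbox (a : R) n (t c : nat -> R) m (r e : nat -> R) :
  (0 <= a)%R -> (forall i, 0 <= t i <= a)%R -> (forall j, 0 <= r j)%R ->
  P 0 (hbox n t c `&` thetaD a @^-1` hbox m r e) = P 0 (hbox n t c) * P 0 (hbox m r e).
Proof.
move=> a0 ta r0.
have t0 i : (0 <= t i)%R by case/andP: (ta i).
have ta' i : (t i <= a)%R by case/andP: (ta i).
have [s [M [k [l [s0 sS sM sk sl]]]]] := @sorted_times R a n m t r a0 t0 ta' r0.
pose E : set (SS R) := [set y : nat -> R | forall i, (i < n)%N -> (c i < \sum_(j < k i) y j)%R].
pose F : set (SS R) := [set y : nat -> R | forall i, (i < m)%N -> (e i < \sum_(j < l i) y j)%R].
have mE : measurable E by exact: measurable_partial_sums.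
have mF : measurable F by exact: measurable_partial_sums.
have incE w : Om w -> hbox n t c w <-> E (increments (fun i => s (minn i M)) w).
  move=> [aw w0]; split => h i iN; have := h i iN; rewrite sum_increments/=;
    have [kM skt] := sk i iN; rewrite (minn_idPl kM) skt min0n s0 /pval w0/= subr0.
    by move=> [x [-> ]].
  by rewrite -/(pval w (t i)) => ?; exists (pval w (t i)); rewrite -alive_pval.
have incF w : Om w -> (thetaD a @^-1` hbox m r e) w <->
    F (increments (fun i => s (M + i)%N) w).
  move=> [aw w0]; split => h i im; have := h i im; rewrite sum_increments/= addn0 sM sl//;
    rewrite /thetaD shiftDE// /shift_sub (ltNge (r i) 0%R) r0/= (alive_pval aw) ?addr_ge0//=.
    by move=> [x [[<-]]].
  by move=> ?; exists (pval w (a + r i) - pval w a)%R.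
have incF' w : Om w -> hbox m r e w <->
    F (increments (fun i => s (M + i)%N - s M)%R w).
  move=> [aw w0]; split => h i im; have := h i im; rewrite sum_increments/= addn0 subrr;
    rewrite sl// sM addrAC subrr add0r {2}/pval w0/= subr0.
    by move=> [x [wx]]; rewrite /pval wx.
  by move=> ?; exists (pval w (r i)); rewrite -alive_pval.
have mT b : measurable (hbox b t c) by exact: measurable_hbox.
have mpre (u : nat -> R) (G : set (SS R)) : measurable G -> measurable (increments u @^-1` G).
  by move=> mG; apply: measurable_preimage_set => //; exact: measurable_increments.
have mth : measurable (thetaD a @^-1` hbox m r e).
  by apply: measurable_preimage_set; [exact: measurable_thetaD|exact: measurable_hbox].
rewrite (levy_eq_set levyP (B := increments (fun i => s (minn i M)) @^-1` E `&`
       increments (fun i => s (M + i)%N) @^-1` F)); last 3 first.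
- exact: measurableI.
- by apply: measurableI; exact: mpre.
- by move=> w Ow; split => -[h1 h2]; split;
    [exact/(incE w Ow).1|exact/(incF w Ow).1|exact/(incE w Ow).2|exact/(incF w Ow).2].
rewrite increments_independent//; congr (_ * _); apply: (levy_eq_set levyP).
- exact: mpre.
- exact: measurable_hbox.
- by move=> w Ow; rewrite incE.
- exact: mpre.
- exact: measurable_hbox.
- by move=> w Ow; rewrite incF'.
Qed.

(** Membership of the stopped path in a box is membership of the path in the box with times capped
    at [a]; the pi-lambda theorem then extends [markov_hbox]. *)
Lemma markov (a : R) (A B : set (D R)) : (0 <= a)%R -> measurable A -> measurable B ->
  P 0 (stopD a @^-1` A `&` thetaD a @^-1` B) = P 0 (stopD a @^-1` A) * P 0 B.
Proof.
move=> a0; move: A B.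
apply: (@independence_generated _ _ _ (D R) (D R) (D R) R (P 0)
  (stopD a) (thetaD a) (P 0) (@hboxes R) (@hboxes R)) => //.
- by rewrite -ge0_fin_numE//; exact: fin_num_measure.
- by rewrite -ge0_fin_numE//; exact: fin_num_measure.
- exact: measurable_stopD.
- exact: measurable_thetaD.
- exact: measurable_hboxes.
- exact: measurable_hboxes.
- exact: setI_closed_hboxes.
- exact: setI_closed_hboxes.
- exact: hboxesT.
- exact: hboxesT.
move=> _ _ [n [t [c [t0 ->]]]] [m [r [e [r0 ->]]]].
have -> : stopD a @^-1` hbox n t c = hbox n (fun i => Num.min (t i) a) c.
  by apply/seteqP; split => w h i /h; rewrite stopDE// /stop (ltNge (t i) 0%R) t0/=.
apply: markov_hbox => // i; rewrite le_min t0 a0/= ge_min lexx orbT//.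
Qed.

Lemma markov_integral (a : R) (A : set (D R)) (f : D R -> \bar R) : (0 <= a)%R ->
  measurable A -> measurable_fun setT f -> (forall w, 0 <= f w) ->
  \int[P 0]_(w in stopD a @^-1` A) f (thetaD a w) =
  P 0 (stopD a @^-1` A) * \int[P 0]_w f w.
Proof.
move=> a0 mA mf f0.
have mS : measurable (stopD a @^-1` A).
  by apply: measurable_preimage_set => //; exact: measurable_stopD.
pose c : {nonneg R} := NngNum (fine_ge0 (measure_ge0 (P 0) (stopD a @^-1` A))).
have cE : c%:num%:E = P 0 (stopD a @^-1` A) by rewrite /= fineK// fin_num_measure.
rewrite -cE -ge0_integral_mscale//.
have -> : \int[P 0]_(w in stopD a @^-1` A) f (thetaD a w) =
    \int[mrestr (P 0) mS]_w f (thetaD a w).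
  by rewrite integral_mrestr.
rewrite -(ge0_integral_image_measure (mrestr (P 0) mS) (measurable_thetaD a) mf f0).
apply: eq_measure_integral => B mB _; rewrite image_measureE.
by transitivity (c%:num%:E * P 0 B) => //; rewrite cE -markov// setIC.
Qed.

End markov.

(** Cauchy's equation for a nonnegative, hence monotone, function: comparing [f] at [(n + 1) c] with
    its values at the neighbouring integers shows that [f c] and [c f(1)] differ by at most
    [f(1) / (n + 1)]. *)
Lemma additive_linear (R : realType) (f : R -> \bar R) :
  (forall a, 0 <= f a)%E ->
  (forall a b, 0 <= a -> 0 <= b -> f (a + b) = (f a + f b)%E) ->
  (f 1%R < +oo)%E -> forall c, 0 <= c -> f c = (c%:E * f 1%R)%E.
Proof.
move=> f0 fD f1 c c0.
have mono a b : 0 <= a -> a <= b -> (f a <= f b)%E.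
  by move=> a0 ab; rewrite -(subrK a b) addrC fD ?subr_ge0// leeDl.
have fn n a : 0 <= a -> f (n.+1%:R * a) = (n.+1%:R%:E * f a)%E.
  move=> a0; elim: n => [|n IH]; first by rewrite mul1r mul1e.
  rewrite -[n.+2%:R]natr1 mulrDl mul1r fD// ?mulr_ge0// IH EFinD.
  by rewrite ge0_muleDl ?lee_fin// mul1e.
have ffin a : 0 <= a -> f a \is a fin_num.
  move=> a0; rewrite ge0_fin_numE//; have := archi_boundP a0.
  set N := Num.bound a => aN; apply: (@le_lt_trans _ _ (f (N.+1%:R * 1))).
    by apply: mono => //; rewrite mulr1 (le_trans (ltW aN))// ler_nat.
  by rewrite fn// lte_mul_pinfty// lee_fin.
have f1f := ffin 1 ler01; have fcf := ffin c c0.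
have [F1 E1] : exists F1, f 1 = F1%:E by exists (fine (f 1)); rewrite fineK.
have [F E] : exists F, f c = F%:E by exists (fine (f c)); rewrite fineK.
have F1_ge0 : 0 <= F1 by rewrite -lee_fin -E1.
rewrite E E1 -EFinM; congr EFin.
have key n : `|F - c * F1| * n.+1%:R <= F1.
  have nc0 : 0 <= n.+1%:R * c by rewrite mulr_ge0.
  pose k := Num.truncn (n.+1%:R * c).
  have /andP[k1 k2] : k%:R <= n.+1%:R * c < k.+1%:R by exact: truncn_itv.
  have fk m : f m%:R = (m%:R * F1)%:E.
    case: m => [|m]; last by rewrite -[X in f X]mulr1 fn// E1 -EFinM.
    rewrite mul0r; have : f (0 + 0) = (f 0%R + f 0%R)%E by exact: fD.
    have := ffin 0 (lexx _); rewrite addr0; case: (f 0) => // r _ /eqP.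
    by rewrite -EFinD eqe -subr_eq subrr => /eqP <-.
  have h1 := mono _ _ (ler0n _ k) k1.
  have h2 := mono _ _ nc0 (ltW k2).
  move: h1 h2; rewrite !fk fn// E -!EFinM !lee_fin -[k.+1%:R]natr1 => h1 h2.
  rewrite -(ger0_norm (ler0n R n.+1)) -normrM ler_norml; apply/andP; split; nra.
apply/eqP; rewrite -subr_eq0 -normr_le0 leNgt; apply/negP => pos.
have := archi_boundP (divr_ge0 F1_ge0 (ltW pos)).
rewrite ltr_pdivrMr// => h; have := key (Num.bound (F1 / `|F - c * F1|)).
move: h; set N := Num.bound _; rewrite -(natr1 N) mulrDr mulr1 mulrC.
move=> h1 /le_lt_trans/(_ h1); rewrite gtrDl => /lt_trans/(_ pos).
by rewrite ltxx.
Qed.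

(** * Mean number of large jumps *)

Section expected_jumps.
Variables (R : realType) (P : R -> probability (D R) R).
Hypothesis levyP : levy_family P.
Implicit Types (w : D R) (y a b c : R).

Lemma measurable_has_jump y a b : 0 < y -> 0 <= a -> a < b ->
  measurable [set w : D R | Om w /\ has_jump w y a b].
Proof.
move=> y0 a0 ab.
rewrite (_ : [set _ | _] = @Om R `&` \bigcup_m \bigcup_N \bigcap_(n in [set n | (N <= n)%N])
    \bigcup_(j in [set j | (j <= n)%N])
    [set w : D R | y + m.+1%:R^-1 < pval w (cell a b n j.+1) - pval w (cell a b n j)]).
  apply: measurableI; first exact: measurable_Om.
  apply: bigcupT_measurable => m; apply: bigcupT_measurable => N.
  apply: bigcap_measurable => [|n _]; first by exists N => /=.
  apply: bigcup_measurable => j _; apply: measurable_ltr_set => //.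
  by apply: measurable_funB; exact: (measurable_pvald_coord 0).
apply/seteqP; split => w [Ow h]; split => //; have cw := dcadlag w; have [aw _] := Ow.
  have [m [N hN]] := (jump_detection cw aw y0 a0 ab).1 h.
  by exists m => //; exists N => // n /= /hN[j jn ?]; exists j.
apply/(jump_detection cw aw y0 a0 ab).
move: h => [m _ [N _ h]]; exists m, N => n Nn.
by have [j jn ?] := h n Nn; exists j.
Qed.

(** The count is set to 0 off [Om], as its measurability rests on paths that are alive. *)
Definition njumpsO y a b : D R -> \bar R := (fun w : D R => njumps w y a b) \_ (@Om R).

Lemma njumpsO_ge0 y a b w : (0 <= njumpsO y a b w)%E.
Proof. by rewrite /njumpsO patchE; case: ifP => // _; exact: njumps_ge0. Qed.

Lemma njumpsOE y a b w : Om w -> njumpsO y a b w = njumps w y a b.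
Proof. by move=> Ow; rewrite /njumpsO patchE mem_set. Qed.

Lemma measurable_njumpsO y a b : 0 < y -> 0 <= a ->
  measurable_fun setT (njumpsO y a b).
Proof.
move=> y0 a0; have [ab|ba] := ltP a b; last first.
  rewrite (_ : njumpsO y a b = cst 0%E)//; apply/funext => w.
  rewrite /njumpsO patchE; case: ifP => // _; rewrite /njumps.
  rewrite (_ : _ `&` _ = set0) ?measure0//; apply/seteqP; split => // s [_] /=.
  by rewrite in_itv/= => /andP[? ?]; lra.
suff : measurable_fun (@Om R) (fun w : D R => njumps w y a b).
  by move=> h; apply/(measurable_restrictT _ (@measurable_Om R)).
pose f n (w : D R) : \bar R :=
  (\sum_(k < n.+1) (\1_[set w : D R | Om w /\ has_jump w y (cell a b n k) (cell a b n k.+1)] w)%:E)%E.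
have cell_a n j : 0 <= cell a b n j.
  by rewrite (le_trans a0)// -[leLHS](cell0 a b n) cell_le// ltW.
apply: (@emeasurable_fun_cvg _ _ _ _ f).
  move=> n; apply: (@measurable_funS _ _ _ _ setT) => //.
  apply: emeasurable_sum => k; apply/measurable_EFinP; apply: measurable_indic.
  apply: measurable_has_jump => //.
  by rewrite cellS ltrDl divr_gt0// subr_gt0.
move=> w Ow; have [aw _] := Ow.
apply: cvg_near_cst; apply: filterS (njumps_cells (dcadlag w) aw y0 a0 ab) => n ->.
apply: eq_bigr => k _; rewrite indicE; congr ((nat_of_bool _)%:R%:E); apply/idP/asboolP.
  by rewrite inE => -[].
by move=> h; apply/mem_set.
Qed.

Lemma thetaD_Om a w : 0 <= a -> Om w -> Om (thetaD a w).
Proof.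
move=> a0 [aw w0]; rewrite /Om/= /thetaD; split.
  by rewrite shiftDE//; exact: alive_shift_sub.
by rewrite shiftDE// /shift_sub ltxx addr0 (alive_pval aw)//= subrr.
Qed.

Lemma stopD_Om a w : 0 <= a -> Om w -> Om (stopD a w).
Proof.
move=> a0 [aw w0]; rewrite /Om/=; split.
  by rewrite stopDE//; exact: alive_stop.
by rewrite stopDE// /stop ltxx min_l.
Qed.

Lemma njumpsO_shift y a c w : 0 < y -> 0 <= a -> Om w ->
  njumpsO y 0 c (thetaD a w) = njumpsO y a (a + c) w.
Proof.
move=> y0 a0 Ow; rewrite !njumpsOE//; last exact: thetaD_Om.
rewrite /thetaD shiftDE//; apply: njumps_shift_sub => //; last by case: Ow.
exact: dcadlag.
Qed.

Lemma njumpsOD y a b c w : 0 < y -> 0 <= a -> a <= b -> b <= c ->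
  njumpsO y a c w = (njumpsO y a b w + njumpsO y b c w)%E.
Proof.
move=> y0 a0 ab bc; rewrite /njumpsO !patchE; case: ifPn; last by rewrite adde0.
move=> /set_mem[aw _]; apply: njumpsD => //; exact: dcadlag.
Qed.

Local Open Scope ereal_scope.

Definition mean_jumps y c := \int[P 0]_w njumpsO y 0 c w.

Lemma thetaD_integral a (f : D R -> \bar R) : (0 <= a)%R ->
  measurable_fun setT f -> (forall w, 0 <= f w) ->
  \int[P 0]_w f (thetaD a w) = \int[P 0]_w f w.
Proof.
move=> a0 mf f0; have := markov_integral levyP a0 measurableT mf f0.
by rewrite preimage_setT probability_setT mul1e.
Qed.

Lemma mean_jumps_shift y a c : (0 < y)%R -> (0 <= a)%R ->
  \int[P 0]_w njumpsO y a (a + c) w = mean_jumps y c.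
Proof.
move=> y0 a0; transitivity (\int[P 0]_w njumpsO y 0 c (thetaD a w)).
  by apply: (levy_ae_eq_integral levyP) => w /set_mem Ow; rewrite njumpsO_shift.
apply: thetaD_integral => //; first exact: measurable_njumpsO.
by move=> w; exact: njumpsO_ge0.
Qed.

Lemma mean_jumpsD y a b : (0 < y)%R -> (0 <= a)%R -> (0 <= b)%R ->
  mean_jumps y (a + b) = mean_jumps y a + mean_jumps y b.
Proof.
move=> y0 a0 b0; rewrite -(@mean_jumps_shift y a b)// /mean_jumps -ge0_integralD//.
- by apply: eq_integral => w _; rewrite (@njumpsOD _ _ a)// lerDl.
- by move=> w _; exact: njumpsO_ge0.
- exact: measurable_njumpsO.
- by move=> w _; exact: njumpsO_ge0.
- exact: measurable_njumpsO.
Qed.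

Lemma esum_counting (T : choiceType) (A : set T) : finite_set A ->
  \esum_(s in A) 1 = counting A :> \bar R.
Proof.
move=> fA; rewrite esum_fset// /counting asboolT// fsbig_finite//=.
by rewrite sumEFin big_const_seq count_predT iter_addr_0.
Qed.

Lemma mean_jumps1 y : (0 < y)%R -> mean_jumps y 1 = Pibar P y.
Proof.
move=> y0; apply: (levy_ae_eq_integral levyP) => w /set_mem Ow; have [aw _] := Ow.
have cw := dcadlag w.
rewrite njumpsOE// /njumps -esum_counting; last exact: finite_jumps.
congr (esum _ _); apply/seteqP; split => s /=.
  move=> [[s0 Js]]; rewrite in_itv/= => /andP[_ s1]; split; first by rewrite s0.
  exists (pval w s), (llim w s); split; first by rewrite -alive_pval// ltW.
  by split => //; apply: left_conv_leftlim; exact: alive_left_conv.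
move=> [/andP[s0 s1] [a [b [wa [lb yab]]]]]; split; last by rewrite in_itv/= s0.
split => //; rewrite /jump /pval wa/=.
by move: lb; rewrite (left_conv_leftlim (alive_left_conv cw aw s0)) => -[->].
Qed.

(** Stationarity and additivity over adjacent intervals make the mean additive in the length [c],
    hence linear by [additive_linear]. *)
Lemma mean_jumpsE y c : (0 < y)%R -> Pibar P y < +oo -> (0 <= c)%R ->
  mean_jumps y c = c%:E * Pibar P y.
Proof.
move=> y0 fin c0; rewrite -mean_jumps1//.
apply: (additive_linear (f := mean_jumps y)) => //.
- by move=> a; apply: integral_ge0 => w _; exact: njumpsO_ge0.
- by move=> a b; exact: mean_jumpsD.
- by rewrite mean_jumps1.
Qed.

End expected_jumps.

(** * Marked jumps and the compensation formula *)

Section finite_measures.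
Local Open Scope ereal_scope.
Context d (T : measurableType d) (R : realType) (f : set T -> \bar R).
Hypotheses (f0 : f set0 = 0) (f_ge0 : forall A, 0 <= f A)
  (f_sadd : semi_sigma_additive f) (f_fin : fin_num_fun f).

Let mk := f.
HB.instance Definition _ := isMeasure.Build _ _ _ mk f0 f_ge0 f_sadd.
HB.instance Definition _ := Measure_isFinite.Build _ _ _ mk f_fin.

Lemma ex_finite_measure : exists m : {finite_measure set T -> \bar R},
  forall A, m A = f A.
Proof. by exists mk. Qed.

End finite_measures.

Lemma finite_measure_of d (T : measurableType d) (R : realType)
    (m : {measure set T -> \bar R}) : (m setT < +oo)%E ->
  exists m' : {finite_measure set T -> \bar R}, forall A, m' A = m A.
Proof.
move=> mfin; apply: ex_finite_measure => //.
- exact: measure_semi_sigma_additive.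
- move=> A mA; rewrite ge0_fin_numE//; apply: le_lt_trans mfin.
  by apply: le_measure; rewrite ?inE.
Qed.

Section rays.
Variable R : realType.

(** [setT] is included because the pi-system of a product must contain the whole space. *)
Definition rays : set (set R) := [set B | B = setT \/ exists y, B = `]y, +oo[%classic].

Lemma raysT : rays setT. Proof. by left. Qed.

Lemma setI_closed_rays : setI_closed rays.
Proof.
move=> A B [->|[y ->]]; first by rewrite setTI.
move=> [->|[z ->]]; first by rewrite setIT; right; exists y.
right; exists (Num.max y z); apply/seteqP; split => x /=.
  by rewrite !in_itv/= !andbT gt_max => -[-> ->].
by rewrite !in_itv/= !andbT gt_max => /andP[-> ->].
Qed.

Lemma measurable_rays : @measurable _ R = <<s rays >>.
Proof.
apply/seteqP; split; last first.
  apply: smallest_sub; first exact: sigma_algebra_measurable.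
  by move=> _ [->|[y ->]]; [exact: measurableT|exact: measurable_itv].
move=> A mA; have : (@RGenOInfty.G R).-sigma.-measurable A.
  by rewrite -RGenOInfty.measurableE.
move: A {mA}; apply: sub_smallest2r.
- exact: smallest_sigma_algebra.
- by move=> _ [y ->]; right; exists y.
Qed.

End rays.

(** The last clause makes [a] the least such bound: a path killed at [s > 0] can still satisfy
    conditions at all the times [t i] only if [a < s]. *)
Lemma max_time (R : realType) n (t : nat -> R) : exists a : R, [/\ 0 <= a,
  forall i, (i < n)%N -> t i <= a &
  forall s, 0 < s -> (forall i, (i < n)%N -> t i < s) -> a < s].
Proof.
elim: n => [|n [a [a0 ta h]]]; first by exists 0; split.
exists (Num.max a (t n)); split; first by rewrite le_max a0.
  move=> i; rewrite ltnS leq_eqVlt => /predU1P[->|/ta ti].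
    by rewrite le_max lexx orbT.
  by rewrite le_max ti.
move=> s s0 ts; rewrite gt_max ts ?ltnSn// andbT; apply: h => // i iN.
by apply: ts; rewrite ltnW.
Qed.

Section compensation.
Variables (R : realType) (P : R -> probability (D R) R).
Hypothesis levyP : levy_family P.
Variable v : R.
Hypothesis v0 : 0 < v.

Local Notation DR := (D R * R)%type.

(** The mark of a jump is the path killed at its time, which keeps only the strict past, together
    with the jump size. *)
Definition marked_jumps (c : R) (w : D R) (Z : set DR) : set R :=
  jumps w v `&` `]0, c] `&` [set s | Z (killD s w, jump w s)].

Definition mark_count c (Z : set DR) : D R -> \bar R :=
  (fun w => counting (marked_jumps c w Z)) \_ (@Om R).

Lemma finite_marked_jumps c w Z : Om w -> finite_set (marked_jumps c w Z).
Proof.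
move=> [aw _]; apply: sub_finite_set (finite_jumps c (dcadlag w) aw v0).
by move=> s [].
Qed.

Lemma mark_count_ge0 c Z w : (0 <= mark_count c Z w)%E.
Proof.
by rewrite /mark_count patchE; case: ifP.
Qed.

Lemma counting_fin (A : set R) : finite_set A -> counting A \is a @fin_num R.
Proof. by move=> fA; rewrite /counting asboolT. Qed.

(** For [s > 0], the path killed at [s] is in the box exactly when the path is and [a < s]. The
    count is then a past event times a number of later jumps, and the threshold [v] merges with the
    ray into [Num.max y v]. *)
Lemma mark_count_hbox c n (t e : nat -> R) y : exists a, [/\ 0 <= a,
  (forall i, (i < n)%N -> t i <= a),
  (forall s, 0 < s -> (forall i, (i < n)%N -> t i < s) -> a < s) &
  forall w, mark_count c (hbox n t e `*` `]y, +oo[) w =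
    ((\1_(hbox n t e) w)%:E * njumpsO (Num.max y v) a c w)%E].
Proof.
have [a [a0 ta h]] := max_time n t; exists a; split => // w.
rewrite /mark_count /njumpsO !patchE; case: ifP => [/set_mem Ow|_]; last by rewrite mule0.
rewrite indicE; have [/set_mem hw|hw] := boolP (w \in hbox n t e).
  rewrite mul1e /njumps; congr counting; apply/seteqP; split => s /=.
    move=> [[[s0 Js] /=]]; rewrite in_itv/= => /andP[_ sc] [/= hk].
    rewrite in_itv/= andbT => ys.
    split; first by split => //; rewrite gt_max ys.
    rewrite in_itv/= sc andbT; apply: h => // i iN.
    have [b []] := hk i iN; rewrite killDE /kill lte_fin; by case: ifP.
  move=> [[s0]]; rewrite gt_max => /andP[ys vs]; rewrite in_itv/= => /andP[as_ sc].
  split; first by split => //=; rewrite in_itv/= s0.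
  split => /=; last by rewrite in_itv/= ys.
  move=> i iN; have [b [wb eb]] := hw i iN.
  by exists b; rewrite killDE /kill lte_fin (le_lt_trans (ta i iN)).
rewrite mul0e (_ : marked_jumps _ _ _ = set0) ?measure0//.
apply/seteqP; split => // s [_ /= [hk _]]; move/negP: hw; apply; apply/mem_set.
move=> i iN; have [b []] := hk i iN; rewrite killDE /kill.
by case: ifP => // _ wb eb; exists b.
Qed.

Lemma mark_count_rayT c (A : set (D R)) :
  mark_count c (A `*` setT) = mark_count c (A `*` `]v, +oo[).
Proof.
apply/funext => w; rewrite /mark_count !patchE; case: ifP => // _.
congr counting; apply/seteqP; split => s /=.
  by move=> [[[s0 Js] sc] [Ak _]]; do !split => //=; rewrite in_itv/= Js.
by move=> [? [Ak _]]; split.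
Qed.

Lemma measurable_hbox_rays : @measurable _ (D R * R)%type =
  <<s [set A `*` B | A in @hboxes R & B in @rays R] >>.
Proof.
apply: measurable_prod_generated.
- exact: measurable_hboxes.
- exact: measurable_rays.
- exact: hboxesT.
- exact: raysT.
Qed.

Lemma setI_closed_hbox_rays :
  setI_closed [set A `*` B | A in @hboxes R & B in @rays R].
Proof.
move=> _ _ [A hA [B hB <-]] [A' hA' [B' hB' <-]].
exists (A `&` A'); first exact: setI_closed_hboxes.
exists (B `&` B'); first exact: setI_closed_rays.
by rewrite setXI.
Qed.

(** A monotone class argument from boxes times rays: finiteness of the counts allows proper
    differences, and increasing unions follow from the continuity of the counting measure. *)
Lemma measurable_mark_count c Z : measurable Z -> measurable_fun setT (mark_count c Z).
Proof.
pose H := [set Z : set DR | measurable Z /\ measurable_fun setT (mark_count c Z)].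
have key n t e y : measurable_fun setT (mark_count c (hbox n t e `*` `]y, +oo[)).
  have [a [a0 _ _ hE]] := mark_count_hbox c n t e y.
  rewrite (funext hE); apply: emeasurable_funM; last first.
    by apply: measurable_njumpsO => //; rewrite lt_max v0 orbT.
  by apply/measurable_EFinP/measurable_indic; exact: measurable_hbox.
suff : measurable `<=` H by move=> + mZ => /(_ _ mZ)[].
rewrite measurable_hbox_rays; apply: lambda_system_subset => //.
- exact: setI_closed_hbox_rays.
- split => //.
  + split; first exact: measurableT.
    rewrite -setXTT mark_count_rayT.
    have := key 0%N (fun=> 0) (fun=> 0) v.
    by rewrite (_ : hbox _ _ _ = setT)//; apply/seteqP; split.
  + move=> A B BA [mA mkA] [mB mkB]; split; first exact: measurableD.
    rewrite (_ : mark_count c (A `\` B) = (mark_count c A \- mark_count c B)%E).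
      exact: emeasurable_funB.
    apply/funext => w; rewrite /mark_count !patchE/=.
    case: ifP => [/set_mem Ow|_]; last by rewrite sube0.
    have mj C := finite_measurable (@finite_marked_jumps c w C Ow).
    rewrite -[X in (_ - counting X)%E](@setIidr _ (marked_jumps c w A)); last first.
      by move=> s [h /BA]; split.
    rewrite -measureD//; last first.
      by rewrite -ge0_fin_numE//; apply: counting_fin; exact: finite_marked_jumps.
    congr counting; apply/seteqP; split => s; rewrite /marked_jumps/=; tauto.
  + move=> F ndF hF; split; first by apply: bigcup_measurable => k _; case: (hF k).
    apply: (@emeasurable_fun_cvg _ _ _ _ (fun n => mark_count c (F n))).
      by move=> n; case: (hF n).
    move=> w _; rewrite /mark_count !patchE/=.
    case: ifP => [/set_mem Ow|Ow]; last first.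
      by under eq_fun do rewrite patchE Ow; exact: cvg_cst.
    under eq_fun do rewrite patchE mem_set//.
    have mj C := finite_measurable (@finite_marked_jumps c w C Ow).
    rewrite (_ : marked_jumps c w _ = \bigcup_n marked_jumps c w (F n)).
      apply: nondecreasing_cvg_mu => //; first exact: bigcup_measurable.
      move=> i j ij; apply/subsetPset => s [h Fs]; split => //.
      by have /subsetPset := ndF _ _ ij; apply.
    apply/seteqP; split => [s [h [k _ Fs]]|s [k _ [h Fs]]].
      by exists k.
    by split => //; exists k.
- move=> _ [_ [n [t [e [t0 ->]]]] [B hB <-]]; split.
    apply: measurableX; first exact: measurable_hbox.
    by rewrite measurable_rays; exact: sub_sigma_algebra.
  by case: hB => [->|[y ->]] //; rewrite mark_count_rayT.
Qed.

Lemma mark_count_sigma_additive c w (F : (set DR)^nat) : trivIset setT F ->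
  mark_count c (\bigcup_n F n) w = (\sum_(n <oo) mark_count c (F n) w)%E.
Proof.
move=> tF; rewrite /mark_count patchE; case: ifP => [/set_mem Ow|Ow]; last first.
  by under eq_eseriesr do rewrite patchE Ow; rewrite eseries0.
under eq_eseriesr do rewrite patchE mem_set//.
have mj C := finite_measurable (@finite_marked_jumps c w C Ow).
rewrite (_ : marked_jumps c w _ = \bigcup_n marked_jumps c w (F n)).
  rewrite measure_semi_bigcup//; last exact: bigcup_measurable.
  apply/trivIsetP => i j _ _ ij; apply/seteqP; split => // s [[_ Fi] [_ Fj]].
  move/trivIsetP : tF => /(_ i j I I ij) /seteqP[h _].
  by have := h (killD s w, jump w s); apply.
apply/seteqP; split => [s [h [k _ Fs]]|s [k _ [h Fs]]]; first by exists k.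
by split => //; exists k.
Qed.

Local Open Scope ereal_scope.

Lemma ex_mark_measure c : exists m : {measure set DR -> \bar R},
  forall Z, measurable Z -> m Z = \int[P 0]_w mark_count c Z w.
Proof.
have [||F mF tF mUF|m mE] :=
  @ex_measure _ DR R (fun Z => \int[P 0]_w mark_count c Z w); last first.
- by exists m => Z _; rewrite mE.
- rewrite (_ : (fun n => _) = (fun n => \sum_(0 <= i < n) \int[P 0]_w mark_count c (F i) w))//.
  rewrite (_ : \int[P 0]_w mark_count c (\bigcup_n F n) w =
    \sum_(i <oo) \int[P 0]_w mark_count c (F i) w); last first.
    rewrite -integral_nneseries//.
    + by apply: eq_integral => w _; exact: mark_count_sigma_additive.
    + by move=> n; exact: measurable_mark_count.
    + by move=> n w _; exact: mark_count_ge0.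
  by apply: is_cvg_nneseries => n _ _; apply: integral_ge0 => w _; exact: mark_count_ge0.
- by move=> Z; apply: integral_ge0 => w _; exact: mark_count_ge0.
- apply: integral0_eq => w _; rewrite /mark_count patchE; case: ifP => // _.
  rewrite (_ : marked_jumps _ _ _ = set0) ?measure0//.
  by apply/seteqP; split => // s [].
Qed.

(** The box is an event of the past of [a] and the jumps are counted after [a]: the Markov property
    factors the mean, and the mean number of jumps is linear in the length. *)
Lemma mean_mark_hbox c n (t e : nat -> R) y : (forall i, 0 <= t i)%R ->
  Pibar P (Num.max y v) < +oo -> (0 <= c)%R ->
  exists a, [/\ (0 <= a)%R,
  (forall i, (i < n)%N -> (t i <= a)%R),
  (forall s, 0 < s -> (forall i, (i < n)%N -> t i < s) -> a < s)%R &
  \int[P 0]_w mark_count c (hbox n t e `*` `]y, +oo[) w =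
  (Num.max (c - a) 0)%:E * P 0 (hbox n t e) * Pibar P (Num.max y v)].
Proof.
move=> t0 fin c0; have [a [a0 ta ha hE]] := mark_count_hbox c n t e y.
exists a; split => //.
have y0 : (0 < Num.max y v)%R by rewrite lt_max v0 orbT.
under eq_integral do rewrite hE.
have [ca|ac] := leP c a.
  have -> : Num.max (c - a)%R 0%R = 0%R by apply/max_r; rewrite subr_le0.
  rewrite 2!mul0e; apply: integral0_eq => w _.
  rewrite /njumpsO patchE; case: ifP => _; last by rewrite mule0.
  rewrite /njumps (_ : _ `&` _ = set0) ?measure0 ?mule0//.
  apply/seteqP; split => // s [_] /=; rewrite in_itv/= => /andP[as_ sc].
  by have := lt_le_trans as_ (le_trans sc ca); rewrite ltxx.
have -> : Num.max (c - a)%R 0%R = (c - a)%R by apply/max_l; rewrite subr_ge0 ltW.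
have hs : hbox n t e = stopD a @^-1` hbox n t e.
  apply/seteqP; split => w h i iN; have := h i iN; rewrite stopDE// /stop;
    by rewrite (ltNge (t i) 0%R) t0/= min_l// ta.
transitivity (\int[P 0]_(w in stopD a @^-1` hbox n t e)
    njumpsO (Num.max y v) 0 (c - a) (thetaD a w)).
  rewrite [RHS]integral_mkcond; apply: (levy_ae_eq_integral levyP) => w /set_mem Ow.
  rewrite patchE -hs indicE; case: ifP => _; last by rewrite mul0e.
  by rewrite mul1e njumpsO_shift// addrC subrK.
rewrite (markov_integral levyP)//.
- rewrite -/(mean_jumps P _ _) (mean_jumpsE levyP)//; last by rewrite subr_ge0 ltW.
  by rewrite -hs muleA; congr (_ * _); rewrite muleC.
- exact: measurable_hbox.
- exact: measurable_njumpsO.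
- by move=> w; exact: njumpsO_ge0.
Qed.

End compensation.

Section compensation_formula.
Variables (R : realType) (P : R -> probability (D R) R).
Hypothesis levyP : levy_family P.
Local Open Scope ereal_scope.

Lemma Pibar_le y z : (0 < y)%R -> (y <= z)%R -> Pibar P z <= Pibar P y.
Proof.
move=> y0 yz; have z0 := lt_le_trans y0 yz.
rewrite -!(mean_jumps1 levyP)//; apply: ge0_le_integral => //.
- by move=> w _; exact: njumpsO_ge0.
- exact: measurable_njumpsO.
- exact: measurable_njumpsO.
- move=> w _; rewrite /njumpsO !patchE; case: ifP => // /set_mem[aw _].
  have cw := dcadlag w.
  apply: le_measure; rewrite ?inE.
  + by apply: finite_measurable; exact: finite_jumps.
  + by apply: finite_measurable; exact: finite_jumps.
  + by apply: setSI => s [s0 Js]; split => //; exact: le_lt_trans yz Js.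
Qed.

Variable v : R.
Hypothesis v0 : (0 < v)%R.
Hypothesis Pv : Pibar P v < +oo.

Let Pfin y : Pibar P (Num.max y v) < +oo.
Proof. by apply: le_lt_trans Pv; apply: Pibar_le => //; rewrite le_max lexx orbT. Qed.

Definition kill_pair (x : (R * D R) * R) : D R * R := (killD x.1.1 x.1.2, x.2).

Lemma measurable_kill_pair : measurable_fun setT kill_pair.
Proof.
apply: measurable_fun_pair => //.
apply: (@measurableT_comp _ _ _ _ _ _ (fun x : R * D R => killD x.1 x.2)) => //.
exact: measurable_killD.
Qed.

(** Both sides are finite measures in [Z]. They agree on boxes times rays, where each is the length
    of []a, c]] times the mass of the box times the mass of the ray under [Pi]. *)
Lemma compensation : exists Pi : {finite_measure set R -> \bar R},
  [/\ forall y, Pi `]y, +oo[%classic = Pibar P (Num.max y v), Pi setT = Pibar P v &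
  forall c (Z : set (D R * R)), (0 <= c)%R -> measurable Z ->
    \int[P 0]_w mark_count v c Z w =
    (((@lebesgue_measure R) \x P 0) \x Pi)
      ([set x | (0 < x.1.1 <= c)%R] `&` kill_pair @^-1` Z)].
Proof.
have [m1 m1E] := @ex_mark_measure R P v v0 1.
(* The mean measure of the jump sizes over a unit time: the Levy measure restricted to jumps above
   [v]. *)
pose Pi0 := image_measure m1 (@measurable_snd _ _ (D R) R).
have Pi0ray y : Pi0 `]y, +oo[%classic = Pibar P (Num.max y v).
  have -> : Pi0 `]y, +oo[%classic = m1 (hbox 0 (fun=> 0%R) (fun=> 0%R) `*` `]y, +oo[).
    by congr (m1 _); apply/seteqP; split => -[w z] //= [].
  rewrite m1E; last by apply: measurableX; [exact: measurable_hbox|exact: measurable_itv].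
  have [a [a0 _ ha ->]] := mean_mark_hbox levyP v0 0 (fun=> 0%R)
    (t := fun=> 0%R) (fun=> lexx _) (Pfin y) ler01.
  (* For a box without conditions, the last property of [a] gives [a < s] for every positive [s]. *)
  have -> : a = 0%R.
    apply/eqP; rewrite eq_le a0 andbT leNgt; apply/negP => a1.
    by have : (a < a)%R by [apply: ha]; rewrite ltxx.
  have -> : Num.max (1 - 0)%R 0%R = 1%R :> R by rewrite subr0 max_l.
  rewrite mul1e (_ : hbox _ _ _ = setT); last by apply/seteqP; split.
  by rewrite probability_setT mul1e.
have Pi0T : Pi0 setT = Pibar P v.
  transitivity (m1 (setT `*` setT)); first by congr (m1 _); apply/seteqP; split.
  rewrite m1E; last exact: measurableX.
  rewrite mark_count_rayT -m1E; last by apply: measurableX => //; exact: measurable_itv.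
  by rewrite -[v in RHS]maxxx -Pi0ray; congr (m1 _); apply/seteqP; split => -[w z] //= [].
have Pi0fin : Pi0 setT < +oo by rewrite Pi0T.
have [Pi PiE] := finite_measure_of Pi0fin.
exists Pi; split; [by move=> y; rewrite PiE|by rewrite PiE|move=> c Z c0 mZ].
have [m mE] := @ex_mark_measure R P v v0 c.
have mI : measurable [set x : (R * D R) * R | (0 < x.1.1 <= c)%R].
  rewrite (_ : [set _ | _] = (`]0%R, c]%classic `*` setT) `*` setT).
    by apply: measurableX => //; apply: measurableX.
  by apply/seteqP; split => -[[t w] y] /=; rewrite in_itv/=; tauto.
pose m' := image_measure (mrestr ((lebesgue_measure \x P 0) \x Pi) mI) measurable_kill_pair.
rewrite -mE// setIC; transitivity (m' Z); last by [].
have rect n (t e : nat -> R) : (forall i : nat, 0 <= t i)%R -> exists q,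
    [/\ q \is a fin_num,
      (forall y, m (hbox n t e `*` `]y, +oo[) = q * Pi `]y, +oo[%classic) &
      (forall B, measurable B -> m' (hbox n t e `*` B) = q * Pi B)].
  move=> t0; have [a [a0 ta ha _]] := mark_count_hbox v c n t e 0%R.
  exists ((Num.max (c - a) 0)%:E * P 0 (hbox n t e)); split=> [|y|B mB].
    by rewrite fin_numM// fin_num_measure//; exact: measurable_hbox.
    rewrite mE; last by apply: measurableX; [exact: measurable_hbox|exact: measurable_itv].
    rewrite PiE Pi0ray.
    have [b [b0 tb hb ->]] := mean_mark_hbox levyP v0 n e t0 (Pfin y) c0.
    (* [a] and [b] come from the same times, and the minimality clause of [max_time] determines
       them. *)
    suff -> : a = b by [].
    by apply/eqP; rewrite eq_le; apply/andP; split; rewrite leNgt; apply/negP => ab;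
      [have : (a < a)%R by [apply: (ha _ (le_lt_trans b0 ab)) => i /tb/le_lt_trans; apply]
      |have : (b < b)%R by [apply: (hb _ (le_lt_trans a0 ab)) => i /ta/le_lt_trans; apply]];
      rewrite ltxx.
  rewrite /m' image_measureE /= /mrestr.
  rewrite (_ : _ `&` _ = (`]a, c] `*` hbox n t e) `*` B); last first.
    apply/seteqP; split => -[[s w] z] /=; rewrite !in_itv/=.
      move=> [[hk Bz]] /andP[s0 sc]; split => //; split.
        rewrite sc andbT; apply: ha => // i iN; have [b []] := hk i iN.
        by rewrite killDE /kill lte_fin; case: ifP.
      move=> i iN; have [b []] := hk i iN; rewrite killDE /kill lte_fin.
      by case: ifP => // _ wb eb; exists b.
    move=> [[/andP[as_ sc] hw] Bz]; rewrite sc (le_lt_trans a0 as_); split => //.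
    split => // i iN; have [b [wb eb]] := hw i iN; exists b; split => //.
    by rewrite killDE /kill lte_fin (le_lt_trans (ta i iN) as_).
  rewrite product_measure1E//; last first.
    by apply: measurableX => //; exact: measurable_hbox.
  congr (_ * _); transitivity (lebesgue_measure `]a, c]%classic * P 0 (hbox n t e)).
    by apply: product_measure1E => //; exact: measurable_hbox.
  rewrite lebesgue_measure_itv/= lte_fin; congr (_ * _).
  case: ltP => ac; first by rewrite max_l// subr_ge0 ltW.
  by rewrite max_r// subr_le0.
have mT (A : set (D R)) : measurable A -> m (A `*` setT) = m (A `*` `]v, +oo[).
  by move=> mA; rewrite !mE ?mark_count_rayT//; apply: measurableX.
have PiT : Pi setT = Pi `]v, +oo[%classic by rewrite !PiE Pi0T Pi0ray maxxx.
have rectB A B : hboxes A -> rays B -> m (A `*` B) = m' (A `*` B).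
  move=> [n [t [e [t0 ->]]]] rB; have [q [_ h1 h2]] := rect n t e t0.
  case: rB => [->|[y ->]]; last by rewrite h1 h2//; exact: measurable_itv.
  by rewrite mT ?h1 ?h2// ?PiT//; exact: measurable_hbox.
apply: (measure_unique_pi (@measurable_hbox_rays R)) => //.
- exact: setI_closed_hbox_rays.
- by rewrite -setXTT; exists setT; [exact: hboxesT|exists setT => //; exact: raysT].
- rewrite -setXTT mT//.
  have [q [qf h1 _]] := rect 0%N (fun=> 0%R) (fun=> 0%R) (fun=> lexx _).
  rewrite (_ : setT = hbox 0 (fun=> 0%R) (fun=> 0%R)); last by apply/seteqP; split.
  by rewrite h1 -ge0_fin_numE// ?fin_numM// ?fin_num_measure// -h1.
- by move=> _ [A hA [B hB <-]]; exact: rectB.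
Qed.

End compensation_formula.

(** * Bounded convergence *)

Lemma finite_measure_lty d (T : measurableType d) (R : realType)
    (m : {finite_measure set T -> \bar R}) (A : set T) :
  measurable A -> (m A < +oo)%E.
Proof. by move=> mA; rewrite ltey_eq fin_num_measure. Qed.

Section bounded_convergence_ae.
Local Open Scope ereal_scope.

Lemma ae_bounded_convergence d (T : measurableType d) (R : realType)
    (m : {measure set T -> \bar R}) (A : set T) (f : nat -> T -> R)
    (g : T -> R) (M : R) :
  measurable A -> m A < +oo ->
  (forall n, measurable_fun A (f n)) -> measurable_fun A g ->
  (forall n x, A x -> (`|f n x| <= M)%R) ->
  {ae m, forall x, A x -> f n x @[n --> \oo] --> g x} ->
  \int[m]_(x in A) (f n x)%:E @[n --> \oo] --> \int[m]_(x in A) (g x)%:E.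
Proof.
move=> mA Afin mf mg fM fg.
have h1 n : measurable_fun A (fun x => (f n x)%:E) by apply/measurable_EFinP.
have h2 : measurable_fun A (fun x => (g x)%:E) by apply/measurable_EFinP.
have h3 : {ae m, forall x, A x -> (f n x)%:E @[n --> \oo] --> (g x)%:E}.
  apply: filterS fg => x fgx Ax.
  by apply: cvg_EFin; [exact: nearW|exact: fgx].
have h4 : m.-integrable A (EFin \o cst M).
  apply/integrableP; split; first exact/measurable_EFinP.
  by rewrite /= integral_cst// lte_mul_pinfty.
have h5 : {ae m, forall x n, A x -> `|(f n x)%:E| <= (EFin \o cst M) x}.
  by apply: aeW => x n Ax; rewrite lee_fin; exact: fM.
by have [] := dominated_convergence mA h1 h2 h3 h4 h5.
Qed.

End bounded_convergence_ae.

Lemma bounded_convergence d (T : measurableType d) (R : realType)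
    (m : {finite_measure set T -> \bar R}) (A : set T) (f : nat -> T -> R)
    (g : T -> R) (M : R) :
  measurable A -> (forall n, measurable_fun A (f n)) -> measurable_fun A g ->
  (forall n x, A x -> `|f n x| <= M) ->
  (forall x, A x -> f n x @[n --> \oo] --> g x) ->
  (\int[m]_(x in A) (f n x)%:E)%E @[n --> \oo] --> (\int[m]_(x in A) (g x)%:E)%E.
Proof.
move=> mA mf mg fM fg; apply: ae_bounded_convergence fM _ => //; last exact: aeW.
exact: (finite_measure_lty m mA).
Qed.

(** * Hitting times and the strong Markov property *)

Section hitting_paths.
Variable R : realType.
Implicit Types (p : R -> option R) (w : D R) (z : R).

Lemma tau_ge0 z p : (0 <= tau z p)%E.
Proof. by apply: le_ereal_inf_tmp => _ [t [t0 _] <-]; rewrite lee_fin ltW. Qed.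

(** An infimum below [b] is decided by the elements below [b]; hence a hitting time before [b] is
    read on the path stopped at [b]. *)
Lemma ereal_inf_local (S S' : set R) (b : R) :
  (forall t, t < b -> S t <-> S' t) ->
  (ereal_inf [set t%:E | t in S] < b%:E)%E ->
  ereal_inf [set t%:E | t in S'] = ereal_inf [set t%:E | t in S].
Proof.
have half (U V : set R) : (forall t, t < b -> U t -> V t) ->
    (ereal_inf [set t%:E | t in U] < b%:E)%E ->
    (ereal_inf [set t%:E | t in V] <= ereal_inf [set t%:E | t in U])%E.
  move=> UV Ub; apply: le_ereal_inf_tmp => _ [t Ut <-].
  have [tb|bt] := ltP t b; first by apply: ereal_inf_lbound; exists t => //; exact: UV.
  move/ereal_inf_lt : Ub => [_ [s Us <-]]; rewrite lte_fin => sb.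
  apply: (@le_trans _ _ s%:E); last by rewrite lee_fin (le_trans (ltW sb)).
  by apply: ereal_inf_lbound; exists s => //; exact: UV.
move=> SS' Sb; have h1 := half S S' (fun t tb => (SS' t tb).1) Sb.
apply/eqP; rewrite eq_le h1/=; apply: half; last exact: le_lt_trans h1 Sb.
by move=> t tb; exact: (SS' t tb).2.
Qed.

Lemma tau_stop z p b : cadlag p -> (tau z p < b%:E)%E -> tau z (stop p b) = tau z p.
Proof.
move=> cp; apply: ereal_inf_local => t tb /=.
by split => -[t0]; rewrite /stop (ltNge t 0) (ltW t0)/= min_l// ltW.
Qed.

Lemma tau_stop_lt z p b : cadlag p -> (tau z (stop p b) < b%:E)%E ->
  tau z (stop p b) = tau z p.
Proof.
move=> cp sb; apply/esym; apply: ereal_inf_local sb => t tb /=.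
by split => -[t0]; rewrite /stop (ltNge t 0) (ltW t0)/= min_l// ltW.
Qed.

Lemma tau_before z w t s : Om w -> 0 <= z -> tau z w = t%:E -> 0 <= s -> s < t ->
  pval w s <= z.
Proof.
move=> [aw w0] z0 tE s0 st; rewrite leNgt; apply/negP => zs.
move: s0; rewrite le_eqVlt => /predU1P[s0|s0].
  by move: zs; rewrite -s0 /pval w0/= ltNge z0.
have : (tau z w <= s%:E)%E.
  by apply: ereal_inf_lbound; exists s => //; split => //; exists (pval w s);
    rewrite -alive_pval// ltW.
by rewrite tE lee_fin leNgt st.
Qed.

(** Right-continuity yields only a weak inequality: the path may sit on the level at its hitting
    time and exceed it right after. This is the origin of [touching]. *)
Lemma tau_at z w t : Om w -> tau z w = t%:E -> z <= pval w t.
Proof.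
move=> [aw w0] tE; rewrite leNgt; apply/negP => tz.
have t0 : 0 <= t by rewrite -lee_fin -tE tau_ge0.
have [_ rc _] := dcadlag w; have := rc _ t0.
rewrite /right_cont (alive_pval aw t0) => /(_ (z - pval w t)).
rewrite subr_gt0 => /(_ tz)[d [d0 hd]].
have : (tau z w < (t + d)%:E)%E by rewrite tE lte_fin ltrDl.
move/ereal_inf_lt => [_ [s [s0 [a [wa za]]] <-]]; rewrite lte_fin => sd.
have ts : t <= s.
  by rewrite -lee_fin -tE; apply: ereal_inf_lbound; exists s => //; split => //; exists a.
have [|b [wb ab]] := hd s; first by rewrite ts sd.
move: wb; rewrite wa => -[ab']; move: ab; rewrite -ab' ltr_norml => /andP[_]; lra.
Qed.

Lemma tau_gt0 z w : Om w -> 0 < z -> (0 < tau z w)%E.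
Proof.
move=> Ow z0; rewrite lt_neqAle tau_ge0 andbT; apply/eqP => /esym tE.
by have [_ w0] := Ow; have := tau_at Ow tE; rewrite /pval w0/= leNgt z0.
Qed.

Lemma tau_eq z w t : Om w -> 0 <= z -> 0 < t -> z < pval w t ->
  (forall s, 0 <= s -> s < t -> pval w s <= z) -> tau z w = t%:E.
Proof.
move=> [aw _] z0 t0 zt h; apply/eqP; rewrite eq_le; apply/andP; split.
  apply: ereal_inf_lbound; exists t => //; split => //; exists (pval w t).
  by rewrite -alive_pval// ltW.
apply: le_ereal_inf_tmp => _ [s [s0 [a [wa za]]] <-]; rewrite lee_fin leNgt.
apply/negP => st; have := h s (ltW s0) st; rewrite /pval wa/= leNgt za//.
Qed.

End hitting_paths.

Section strong_markov.
Variables (R : realType) (P : R -> probability (D R) R).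
Hypothesis levyP : levy_family P.
Variables (z T : R).

Definition hit (w : D R) : R := fine (tau z w).
(** The same kind of mark as in [marked_jumps], taken at the hitting time, so that the compensation
    formula can describe its law. *)
Definition pre_hit (w : D R) : D R * R := (killD (hit w) w, jump w (hit w)).
Definition post_hit (w : D R) : D R := thetaD (hit w) w.

Lemma measurable_hit : measurable_fun setT hit.
Proof. by apply: measurableT_comp => //; exact: measurable_tau. Qed.

Lemma measurable_hit_pair : measurable_fun setT (fun w : D R => (hit w, w)).
Proof. by apply: measurable_fun_pair => //; exact: measurable_hit. Qed.

Lemma measurable_pre_hit : measurable_fun setT pre_hit.
Proof.
apply: measurable_fun_pair.
  exact: (measurableT_comp (@measurable_killD R) measurable_hit_pair).
apply: measurable_funB.
  exact: (measurableT_comp (@measurable_pval R) measurable_hit_pair).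
exact: (measurableT_comp (@measurable_llim R) measurable_hit_pair).
Qed.

Lemma measurable_post_hit : measurable_fun setT post_hit.
Proof. exact: (measurableT_comp (@measurable_thetaD2 R) measurable_hit_pair). Qed.

Lemma killD_stop t b (w : D R) : 0 <= b -> t <= b -> killD t (stopD b w) = killD t w.
Proof.
move=> b0 tb; rewrite /killD; congr toD; apply/funext => s.
rewrite /kill lte_fin; case: ltP => // st; rewrite stopDE// /stop.
rewrite min_l; last by rewrite (le_trans (ltW st)).
by case: ltP => // s0; have [neg _ _] := dcadlag w; rewrite neg.
Qed.

Definition hit_event (Z : set (D R * R)) : set (D R) :=
  [set w | Om w /\ (tau z w < T%:E)%E] `&` pre_hit @^-1` Z.

Lemma measurable_hit_event Z : measurable Z -> measurable (hit_event Z).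
Proof.
move=> mZ; apply: measurableI.
  apply: measurableI; first exact: measurable_Om.
  rewrite -[X in measurable X]setTI.
  by apply: emeasurable_fun_infty_o => //; exact: measurable_tau.
by apply: measurable_preimage_set => //; exact: measurable_pre_hit.
Qed.

Lemma hit_event_stop Z b w : Om w -> 0 <= b -> (tau z w < b%:E)%E ->
  hit_event Z w -> hit_event Z (stopD b w).
Proof.
move=> Ow b0 tb [[_ tT] Zw].
have tS : tau z (stopD b w) = tau z w by rewrite stopDE// tau_stop//; exact: dcadlag.
have tf : tau z w \is a fin_num.
  by rewrite ge0_fin_numE ?tau_ge0// (lt_trans tb) ?ltry.
have hb : hit w <= b by rewrite -lee_fin /hit fineK// ltW.
split; first by split => /=; [exact: stopD_Om|rewrite tS].
rewrite /preimage/= /pre_hit /hit tS -/(hit w) killD_stop// stopDE// jump_stop//.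
exact: dcadlag.
Qed.

Lemma hit_event_unstop Z b w : Om w -> 0 <= b -> (tau z (stopD b w) < b%:E)%E ->
  hit_event Z (stopD b w) -> hit_event Z w.
Proof.
move=> Ow b0 tb [[_ tT] Zw].
have tS : tau z (stopD b w) = tau z w.
  by move: tb; rewrite stopDE// => /tau_stop_lt; apply; exact: dcadlag.
have tf : tau z w \is a fin_num.
  by rewrite -tS ge0_fin_numE ?tau_ge0// (lt_trans tb) ?ltry.
have hb : hit w <= b by rewrite -lee_fin /hit fineK// -tS ltW.
split; first by split => //=; rewrite -tS.
move: Zw; rewrite /preimage/= /pre_hit /hit tS -/(hit w) killD_stop// stopDE// jump_stop//.
exact: dcadlag.
Qed.

Definition hit_cell Z (n k : nat) : set (D R) :=
  hit_event Z `&` [set w | Num.floor (hit w * n.+1%:R) = k%:Z].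

Lemma measurable_hit_cell Z n k : measurable Z -> measurable (hit_cell Z n k).
Proof.
move=> mZ; apply: measurableI; first exact: measurable_hit_event.
exact: (measurable_preimage_set measurable_hit (measurable_floor_fiber _ _)).
Qed.

(** The hitting time is strictly less than the right end of its cell, so the event is decided by the
    path stopped there. *)
Lemma hit_cell_stop Z n k w : Om w ->
  hit_cell Z n k w <-> hit_cell Z n k (stopD (k.+1%:R / n.+1%:R) w).
Proof.
move=> Ow; set b := k.+1%:R / n.+1%:R.
have b0 : 0 <= b by rewrite divr_ge0.
have key w' : hit_cell Z n k w' -> (tau z w' < b%:E)%E.
  move=> [[[_ tT] _]/= fk].
  have tf : tau z w' \is a fin_num.
    by rewrite ge0_fin_numE ?tau_ge0// (lt_trans tT) ?ltry.
  rewrite -(fineK tf) lte_fin -/(hit w') /b ltr_pdivlMr//.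
  have := real_floorD1_gt (num_real (hit w' * n.+1%:R)).
  by rewrite fk -[k.+1%:R]natr1 intrD.
split=> wk; have tb := key _ wk; case: wk => wZ wk.
  have tS : tau z (stopD b w) = tau z w by rewrite stopDE// tau_stop//; exact: dcadlag.
  by split; [exact: hit_event_stop|rewrite /= /hit tS].
have tS : tau z (stopD b w) = tau z w.
  by move: tb; rewrite stopDE// => /tau_stop_lt; apply; exact: dcadlag.
split; first exact: hit_event_unstop wZ.
by move: wk; rewrite /= /hit tS.
Qed.

(** On the cell, [grid_above n (hit w)] is the constant right end, and the Markov property applies
    at that fixed time. *)
Lemma hit_cell_integral Z n k (f : D R -> \bar R) : measurable Z ->
  measurable_fun setT f -> (forall w, (0 <= f w)%E) ->
  (\int[P 0]_(w in hit_cell Z n k) f (thetaD (grid_above n (hit w)) w) =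
   P 0%R (hit_cell Z n k) * \int[P 0]_w f w)%E.
Proof.
move=> mZ mf f0; pose b : R := k.+1%:R / n.+1%:R.
have b0 : 0 <= b by rewrite divr_ge0.
have mC := @measurable_hit_cell Z n k mZ.
have mS : measurable (stopD b @^-1` hit_cell Z n k).
  by apply: measurable_preimage_set => //; exact: measurable_stopD.
have := markov_integral levyP b0 mC mf f0.
rewrite (@levy_eq_set _ P levyP (stopD b @^-1` hit_cell Z n k) (hit_cell Z n k))//; last first.
  by move=> w Ow; apply: iff_sym; exact: hit_cell_stop.
move=> <-.
rewrite [LHS]integral_mkcond [RHS]integral_mkcond.
apply: (levy_ae_eq_integral levyP) => w; rewrite inE => Ow.
rewrite !patchE; have := @hit_cell_stop Z n k w Ow; rewrite -/b => hs.
case: ifPn; rewrite ?inE ?notin_setE => wC.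
  rewrite mem_set/=; last exact/hs.
  congr (f (thetaD _ w)); rewrite /grid_above /b.
  by case: wC => _ /= ->; rewrite intrD natr1.
by rewrite memNset//= => /hs.
Qed.

Lemma hit_grid_integral Z n (f : D R -> \bar R) : measurable Z ->
  measurable_fun setT f -> (forall w, (0 <= f w)%E) -> (\int[P 0]_w f w < +oo)%E ->
  (\int[P 0]_(w in hit_event Z) f (thetaD (grid_above n (hit w)) w) =
   P 0%R (hit_event Z) * \int[P 0]_w f w)%E.
Proof.
move=> mZ mf f0 foo.
have HU : hit_event Z = \bigcup_k hit_cell Z n k.
  apply/seteqP; split => [w wZ|w [k _ []]//].
  have : 0 <= Num.floor (hit w * n.+1%:R).
    by rewrite real_floor_ge0 ?num_real// mulr_ge0// fine_ge0// tau_ge0.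
  case E : (Num.floor _) => [k|//] _.
  by exists k => //; split.
have mC k := @measurable_hit_cell Z n k mZ.
have tI : trivIset setT (hit_cell Z n).
  by move=> i j _ _ [w [[_ /= wi] [_ /= wj]]]; apply/eqP; rewrite -eqz_nat -wi -wj.
have mg : measurable_fun setT (fun w : D R => f (thetaD (grid_above n (hit w)) w)).
  apply: measurableT_comp => //.
  apply: (@measurableT_comp _ _ _ _ _ _ (fun x : R * D R => thetaD x.1 x.2) setT
    (fun w => (grid_above n (hit w), w))); first exact: measurable_thetaD2.
  apply: measurable_fun_pair => //.
  apply: (measurableT_comp (f := grid_above n)); last exact: measurable_hit.
  apply: nondecreasing_measurable => // s t st.
  by rewrite /grid_above ler_pM2r ?invr_gt0// ler_int lerD2r le_floor// ler_pM2r.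
rewrite {1}HU ge0_integral_bigcup//; last exact: measurable_funTS.
under eq_eseriesr do rewrite hit_cell_integral// muleC.
have <- : ((fine (\int[P 0]_w f w))%:E = \int[P 0]_w f w)%E.
  by rewrite fineK// ge0_fin_numE// integral_ge0.
rewrite nneseriesZl// [RHS]muleC; congr (_ * _)%E; rewrite HU.
by apply: cvg_lim => //; apply: measure_sigma_additive.
Qed.

End strong_markov.

Section clamp.
Variable R : realType.
Implicit Types x : R.

(** Continuous approximations of the indicator of [0 < x]: they let the right-continuity of paths
    act on boxes, whose indicators are not continuous. *)
Definition clamp (i : nat) x : R := Num.min 1 (Num.max 0 (i%:R * x)).

Lemma clamp_itv i x : 0 <= clamp i x <= 1.
Proof. by rewrite /clamp ge_min lexx/= le_min ler01/= le_max lexx. Qed.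

Lemma continuous_clamp i x : {for x, continuous (clamp i)}.
Proof.
apply: (@continuous_min _ _ (fun=> 1) (fun x => Num.max 0 (i%:R * x))).
  exact: cst_continuous.
apply: (@continuous_max _ _ (fun=> 0) (fun x => i%:R * x)); first exact: cst_continuous.
by apply: cvgM; [exact: cvg_cst|exact: cvg_id].
Qed.

Lemma cvg_clamp x : clamp i x @[i --> \oo] --> (ind R (0 < x)).
Proof.
rewrite /ind; have [x0|x0] := ltP 0 x; last first.
  rewrite (_ : (fun i => clamp i x) = fun=> 0); first exact: cvg_cst.
  apply/funext => i; rewrite /clamp.
  have -> : Num.max 0 (i%:R * x) = 0 by apply/max_l; rewrite mulr_ge0_le0.
  by apply/min_r.
have [N hN] : exists N : nat, 1 <= N%:R * x.
  exists (Num.truncn x^-1).+1; rewrite -ler_pdivrMr// div1r.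
  by apply: ltW; rewrite truncnS_gt.
apply: cvg_near_cst; exists N => // i /= Ni; apply/min_l.
by rewrite le_max; apply/orP; right; apply: le_trans hN _; rewrite ler_pM2r// ler_nat.
Qed.

Lemma prod_itv n (f : nat -> R) : (forall i, 0 <= f i <= 1) ->
  0 <= \prod_(i < n) f i <= 1.
Proof.
move=> f01; elim: n => [|n /andP[h1 h2]]; first by rewrite big_ord0 ler01 lexx.
by have /andP[h3 h4] := f01 n; rewrite big_ord_recr/= mulr_ge0//= mulr_ile1.
Qed.

Lemma cvg_prod n (f : nat -> nat -> R) (g : nat -> R) :
  (forall j, f i j @[i --> \oo] --> g j) ->
  \prod_(j < n) f i j @[i --> \oo] --> \prod_(j < n) g j.
Proof.
move=> fg; elim: n => [|n IH].
  by under eq_fun do rewrite big_ord0; rewrite big_ord0; exact: cvg_cst.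
under eq_fun do rewrite big_ord_recr.
by rewrite big_ord_recr; apply: cvgM.
Qed.

Lemma prod_ind n (b : nat -> bool) :
  \prod_(j < n) ind R (b j) = ind R [forall j : 'I_n, b j].
Proof.
rewrite /ind; case: ifPn => [/forallP h|]; first by rewrite big1// => j _; rewrite h.
rewrite negb_forall => /existsP[j bj].
by rewrite (bigD1 j)//= (negbTE bj) mul0r.
Qed.

End clamp.

Section strong_markov_property.
Variables (R : realType) (P : R -> probability (D R) R).
Hypothesis levyP : levy_family P.
Variables (z T : R).

Let boxf m (r e : nat -> R) i (w : D R) := \prod_(j < m) clamp i (pval w (r j) - e j).

Let measurable_boxf m r e i : measurable_fun setT (boxf m r e i).
Proof.
rewrite /boxf.
elim: m => [|m IH]; first by under eq_fun do rewrite big_ord0; exact: measurable_cst.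
under eq_fun do rewrite big_ord_recr/=; apply: measurable_funM => //.
apply: (measurableT_comp (f := clamp i)).
  by apply: continuous_measurable_fun => x; exact: continuous_clamp.
by apply: measurable_funB => //; exact: measurable_pvald_coord.
Qed.

Let boxf_itv m r e i w : 0 <= boxf m r e i w <= 1.
Proof. by apply: (@prod_itv _ m (fun j => clamp i (pval w (r j) - e j))) => j; exact: clamp_itv. Qed.

Let boxf_abs m r e i w : `|boxf m r e i w| <= 1.
Proof. by have /andP[h1 h2] := boxf_itv m r e i w; rewrite ger0_norm. Qed.

(** The times [grid_above n (hit w)] tend to the hitting time from the right while the right-hand
    side does not depend on [n]; continuity of [clamp] and bounded convergence give the limit. *)
Lemma hit_boxf_integral Z m r e i : measurable Z -> (forall j, 0 <= r j) ->
  (\int[P 0]_(w in hit_event z T Z) (boxf m r e i (post_hit z w))%:E =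
   P 0%R (hit_event z T Z) * \int[P 0]_w (boxf m r e i w)%:E)%E.
Proof.
move=> mZ r0.
have mE := measurable_hit_event z T mZ.
have h n : (\int[P 0]_(w in hit_event z T Z)
    (boxf m r e i (thetaD (grid_above n (hit z w)) w))%:E =
    P 0%R (hit_event z T Z) * \int[P 0]_w (boxf m r e i w)%:E)%E.
  apply: (hit_grid_integral levyP z T n mZ (f := fun w => (boxf m r e i w)%:E)).
  - by apply/measurable_EFinP; exact: measurable_boxf.
  - by move=> w; rewrite lee_fin; have /andP[] := boxf_itv m r e i w.
  - apply: (@le_lt_trans _ _ (\int[P 0]_w (cst 1%:E w))%E); last first.
      by rewrite integral_cst//= mul1e -ge0_fin_numE//; exact: fin_num_measure.
    apply: ge0_le_integral => //.
    + by move=> w _; rewrite lee_fin; have /andP[] := boxf_itv m r e i w.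
    + by apply/measurable_EFinP; exact: measurable_boxf.
    + by move=> w _; rewrite lee_fin; have /andP[] := boxf_itv m r e i w.
have mth n : measurable_fun setT
    (fun w : D R => boxf m r e i (thetaD (grid_above n (hit z w)) w)).
  apply: (measurableT_comp (@measurable_boxf m r e i)).
  apply: (@measurableT_comp _ _ _ _ _ _ (fun x : R * D R => thetaD x.1 x.2) setT
    (fun w => (grid_above n (hit z w), w))); first exact: measurable_thetaD2.
  apply: measurable_fun_pair => //.
  apply: (measurableT_comp (f := grid_above n)); last exact: measurable_hit.
  apply: nondecreasing_measurable => // s t st.
  by rewrite /grid_above ler_pM2r ?invr_gt0// ler_int lerD2r le_floor// ler_pM2r.
have := @bounded_convergence _ _ _ (P 0) (hit_event z T Z)
  (fun n w => boxf m r e i (thetaD (grid_above n (hit z w)) w))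
  (fun w => boxf m r e i (post_hit z w)) 1 mE.
move=> /(_ (fun n => measurable_funTS (mth n))).
move=> /(_ (measurable_funTS (measurableT_comp (@measurable_boxf m r e i)
  (@measurable_post_hit R z)))).
move=> /(_ (fun n w _ => boxf_abs m r e i _)).
under eq_fun do rewrite h.
move=> H; apply/esym; apply: (cvg_unique _ (cvg_cst _) (H _)) => //.
move=> w [[[aw w0] tT] _]; rewrite /boxf /post_hit.
have t0 : 0 <= hit z w by rewrite /hit fine_ge0// tau_ge0.
apply: (@cvg_prod _ m (fun n j => clamp i (pval (thetaD (grid_above n (hit z w)) w) (r j) - e j))
  (fun j => clamp i (pval (thetaD (hit z w) w) (r j) - e j))) => j.
apply: continuous_cvg; first exact: continuous_clamp.
apply: cvgB; last exact: cvg_cst.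
have pth a : 0 <= a -> pval (thetaD a w) (r j) = pval w (a + r j) - pval w a.
  by move=> a0; rewrite /thetaD shiftDE// pval_shift_sub.
under eq_fun do rewrite pth ?(le_trans t0 (ltW (grid_above_gt _ _)))//.
rewrite pth//; apply: cvgB; apply: right_cvg => //; try exact: dcadlag.
- by rewrite addr_ge0.
- by move=> n; rewrite lerD2r ltW// grid_above_gt.
- by apply: cvgD; [exact: cvg_grid_above|exact: cvg_cst].
- by move=> n; rewrite ltW// grid_above_gt.
- exact: cvg_grid_above.
Qed.

Let boxf_hbox m r e w : Om w -> (forall j, 0 <= r j) ->
  boxf m r e i w @[i --> \oo] --> (\1_(hbox m r e) w : R).
Proof.
move=> [aw _] r0.
have : \prod_(j < m) clamp i (pval w (r j) - e j) @[i --> \oo] -->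
    \prod_(j < m) ind R (0 < pval w (r j) - e j).
  by apply: (@cvg_prod _ m (fun i j => clamp i (pval w (r j) - e j))
      (fun j => ind R (0 < pval w (r j) - e j))) => j; exact: cvg_clamp.
rewrite (@prod_ind R m (fun j => 0 < pval w (r j) - e j)) indicE.
set a := ind _ _; set b := _%:R; suff -> : a = b by [].
rewrite /a /b /ind; case: ifPn => [/forallP h|/forallP h].
  rewrite mem_set// => j jm; exists (pval w (r j)); split; first exact: alive_pval.
  by have := h (Ordinal jm); rewrite subr_gt0.
rewrite memNset// => wh; apply: h => j; rewrite subr_gt0.
by have [a0 [wa]] := wh j (ltn_ord j); rewrite /pval wa.
Qed.

(** Letting [i] grow turns the products of [clamp] into indicators of boxes on both sides. *)
Lemma hit_hbox Z m r e : measurable Z -> (forall j, 0 <= r j) ->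
  P 0%R (hit_event z T Z `&` post_hit z @^-1` hbox m r e) =
  (P 0%R (hit_event z T Z) * P 0%R (hbox m r e))%E.
Proof.
move=> mZ r0.
have mE := measurable_hit_event z T mZ.
have mh : measurable (hbox m r e) by exact: measurable_hbox.
have mph := @measurable_post_hit R z.
have h1 : (\int[P 0]_(w in hit_event z T Z) (boxf m r e i (post_hit z w))%:E)%E
    @[i --> \oo] --> P 0%R (hit_event z T Z `&` post_hit z @^-1` hbox m r e).
  have -> : P 0%R (hit_event z T Z `&` post_hit z @^-1` hbox m r e) =
     (\int[P 0]_(w in hit_event z T Z) (\1_(hbox m r e) (post_hit z w))%:E)%E.
    under eq_integral => w _ do rewrite -[_ (post_hit z w)]/(\1_(post_hit z @^-1` hbox m r e) w).
    by rewrite integral_indic 1?setIC//; exact: measurable_preimage_set.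
  apply: (@bounded_convergence _ _ _ (P 0) _ _ _ 1 mE).
  - move=> i; apply: measurable_funTS; apply: (measurableT_comp _ mph).
    exact: measurable_boxf.
  - by apply: measurable_funTS; apply: (measurableT_comp _ mph).
  - by move=> i w _; exact: boxf_abs.
  - move=> w [[Ow _] _]; apply: boxf_hbox => //; apply: thetaD_Om => //.
    by rewrite /hit fine_ge0// tau_ge0.
have h2 : (\int[P 0]_(w in @Om R) (boxf m r e i w)%:E)%E
    @[i --> \oo] --> (\int[P 0]_(w in @Om R) (\1_(hbox m r e) w)%:E)%E.
  apply: (@bounded_convergence _ _ _ (P 0) _ _ _ 1); first exact: measurable_Om.
  - by move=> i; apply: measurable_funTS; exact: measurable_boxf.
  - exact: measurable_funTS.
  - by move=> i w _; exact: boxf_abs.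
  - by move=> w Ow; exact: boxf_hbox.
have Omi (f : D R -> \bar R) : (\int[P 0]_(w in @Om R) f w = \int[P 0]_w f w)%E.
  rewrite integral_mkcond; apply: (levy_ae_eq_integral levyP) => w wO.
  by rewrite patchE wO.
move: h2; rewrite Omi integral_indic// setIT; under eq_fun do rewrite Omi.
move=> h2.
have h3 := cvgeZl (fin_num_measure (P 0) _ mE) h2.
have e1 : (fun i => \int[P 0]_(w in hit_event z T Z) (boxf m r e i (post_hit z w))%:E)%E =
    (fun i => P 0 (hit_event z T Z) * \int[P 0]_w (boxf m r e i w)%:E)%E.
  by apply/funext => i; rewrite hit_boxf_integral.
by move: h1; rewrite e1 => h1; exact: (cvg_unique _ h1 h3).
Qed.

Lemma strong_markov Z C : measurable Z -> measurable C ->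
  P 0%R (hit_event z T Z `&` post_hit z @^-1` C) = (P 0%R (hit_event z T Z) * P 0%R C)%E.
Proof.
move=> mZ; move: C.
have mE := measurable_hit_event z T mZ.
pose c : {nonneg R} := NngNum (fine_ge0 (measure_ge0 (P 0) (hit_event z T Z))).
have cE : ((c%:num)%:E = P 0%R (hit_event z T Z))%E.
  by rewrite fineK//; exact: fin_num_measure.
move=> C mC; rewrite -cE setIC.
apply: (@path_measure_unique R
  (image_measure (mrestr (P 0) mE) (@measurable_post_hit R z)) (mscale c (P 0))) => //.
- rewrite image_measureE preimage_setT /= /mrestr setTI.
  by rewrite -ge0_fin_numE//; exact: fin_num_measure.
- move=> n t d t0; rewrite image_measureE /= /mrestr /mscale/= setIC cE.
  exact: hit_hbox.
Qed.

End strong_markov_property.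

(** * Crossing and touching a level *)

Section crossing.
Variables (R : realType).
Implicit Types (w : D R).

(** On a path killed at [t] this recovers [X_(t-)]: conditions on the left limit become conditions
    on the mark. *)
Definition lastv w : R := llim w (fine (tauD w)).

Lemma measurable_lastv : measurable_fun setT lastv.
Proof.
apply: (@measurableT_comp _ _ _ _ _ _ (fun x : R * D R => llim x.2 x.1) setT
  (fun w => (fine (tauD w), w))); first exact: measurable_llim.
apply: measurable_fun_pair => //; apply: measurableT_comp => //.
exact: measurable_tauD.
Qed.

Lemma tauD_killD t w : alive w -> 0 < t -> tauD (killD t w) = t%:E.
Proof.
move=> aw t0; rewrite killDE; apply/eqP; rewrite eq_le; apply/andP; split.
  by apply: ereal_inf_lbound; exists t => //; split => //; rewrite /kill ltxx.
apply: le_ereal_inf_tmp => _ [s [s0]] + <-; rewrite /kill lte_fin lee_fin.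
by case: ltP => // st /aw; rewrite ltW// => /(_ isT).
Qed.

Lemma lastv_killD t w : alive w -> 0 < t -> lastv (killD t w) = llim w t.
Proof. by move=> aw t0; rewrite /lastv tauD_killD//= killDE llim_kill. Qed.

(** Tested at rational times for measurability. Dead and negative times are read as 0, which is
    harmless for a level [z >= 0]. *)
Definition below z : set (D R) := [set w | forall q : rat, pval w (ratr q) <= z].

Lemma measurable_below z : measurable (below z).
Proof.
rewrite (_ : below z = ~` \bigcup_(q : rat) [set w | z < pval w (ratr q)]); last first.
  apply/seteqP; split => w /=; first by move=> h [q _ /=]; rewrite ltNge h.
  by move=> h q; rewrite leNgt; apply/negP => zq; apply: h; exists q.
apply: measurableC; apply: bigcupT_measurable_rat => q.
by apply: measurable_ltr_set => //; exact: measurable_pvald_coord.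
Qed.

Lemma below_killD z t w : Om w -> 0 <= z -> 0 < t ->
  below z (killD t w) <-> forall s, 0 <= s -> s < t -> pval w s <= z.
Proof.
move=> [aw _] z0 t0; split => [h s s0 st|h q].
  rewrite leNgt; apply/negP => zs.
  have ts : 0 < t - s by rewrite subr_gt0.
  have [q [sq qt [b [wb zb]]]] := right_cont_rat s0 (alive_pval aw s0) zs ts.
  have qt' : ratr q < t by lra.
  by have := h q; rewrite killDE pval_kill// /pval wb/= leNgt zb.
rewrite killDE; have [tq|qt] := leP t (ratr q).
  by rewrite /pval /kill lte_fin ltNge tq.
rewrite pval_kill//; have [q0|q0] := leP 0 (ratr q : R); first exact: h.
by have [neg _ _] := dcadlag w; rewrite /pval neg.
Qed.

(* A jump [x.2] after the killed path [x.1] crosses the level [z], respectively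
   lands exactly on it. *)
Definition ladder (b : R -> bool) (z T K : R) : set (D R * R) :=
  [set x : D R * R | [/\ (tauD x.1 < T%:E)%E, below z x.1, lastv x.1 < K &
               b (lastv x.1 + x.2)]].
Definition crossing z := ladder (fun a => z < a) z.
Definition touching z := ladder (fun a => z == a) z.

Lemma measurable_ladder (b : R -> bool) z T K : measurable [set a | b a] -> measurable (ladder b z T K).
Proof.
move=> mb.
have m1 : measurable [set x : D R * R | (tauD x.1 < T%:E)%E].
  rewrite -[X in measurable X]setTI; apply: emeasurable_fun_infty_o => //.
  exact: (measurableT_comp (@measurable_tauD R) measurable_fst).
have m2 : measurable [set x : D R * R | below z x.1].
  exact: (measurable_preimage_set measurable_fst (measurable_below z)).
have ml := measurableT_comp measurable_lastv (@measurable_fst _ _ (D R) R).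
have m3 : measurable [set x : D R * R | lastv x.1 < K].
  exact: measurable_ltr_set.
have m4 : measurable [set x : D R * R | b (lastv x.1 + x.2)].
  by apply: (measurable_preimage_set _ mb); exact: measurable_funD.
rewrite (_ : ladder _ _ _ _ = ([set x : D R * R | (tauD x.1 < T%:E)%E] `&`
  [set x : D R * R | below z x.1]) `&` ([set x : D R * R | lastv x.1 < K] `&`
  [set x : D R * R | b (lastv x.1 + x.2)])).
  by apply: measurableI; apply: measurableI.
by apply/seteqP; split => x /=; [move=> []|move=> [[? ?] [? ?]]].
Qed.

Lemma measurable_crossing (z T K : R) : measurable (crossing z T K).
Proof. by apply: measurable_ladder; exact: measurable_ltr_set. Qed.

Lemma measurable_touching (z T K : R) : measurable (touching z T K).
Proof.
apply: measurable_ladder; rewrite (_ : [set a | _] = [set z]) //.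
by apply/seteqP; split => a /=; [move/eqP|move=> ->].
Qed.

Variables (v z T K : R).
Hypotheses (v0 : 0 < v) (z0 : 0 < z) (Kz : K + v <= z).

Lemma hit_finite w : (tau z w < T%:E)%E -> tau z w = (hit z w)%:E.
Proof.
by move=> h; rewrite /hit fineK// ge0_fin_numE ?tau_ge0// (lt_trans h) ?ltry.
Qed.

Lemma hit_gt0 w : Om w -> (tau z w < T%:E)%E -> 0 < hit z w.
Proof. by move=> Ow h; rewrite -lte_fin -hit_finite// tau_gt0. Qed.

Lemma pre_hit_ladder (b : R -> bool) w : Om w -> (tau z w < T%:E)%E ->
  llim w (hit z w) < K -> b (pval w (hit z w)) ->
  ladder b z T K (pre_hit z w).
Proof.
move=> Ow wT lK bw; have [aw _] := Ow; have t0 := hit_gt0 Ow wT.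
split; rewrite /pre_hit/=.
- by rewrite tauD_killD// -hit_finite.
- apply/below_killD => //; first exact: ltW.
  by move=> s s0 st; apply: (tau_before Ow (ltW z0) (hit_finite wT)).
- by rewrite lastv_killD.
- by rewrite lastv_killD// /jump addrC subrK.
Qed.

(** A path that stayed below the level until [s] and is above it at [s] hits it at [s], so at most
    one jump is a crossing. *)
Lemma marked_crossing Z w s : Om w ->
  marked_jumps v T w (Z `&` crossing z T K) s -> s = hit z w /\ (tau z w < T%:E)%E.
Proof.
move=> Ow [[[s0 Js] _] /= [_ [sT /= bel lK zl]]]; have [aw _] := Ow.
have tE : tau z w = s%:E.
  apply: (tau_eq Ow (ltW z0) s0).
    by move: zl; rewrite lastv_killD// /jump addrC subrK.
  by apply/(below_killD Ow (ltW z0) s0).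
by rewrite /hit tE; move: sT; rewrite tauD_killD.
Qed.

(** The count is 0 or 1. The crossing jump is among the counted ones, since it leads from below [K]
    to above [z] and [K + v <= z]. *)
Lemma mark_count_crossing Z w : Om w ->
  mark_count v T (Z `&` crossing z T K) w =
  (\1_(hit_event z T (Z `&` crossing z T K)) w)%:E.
Proof.
move=> Ow; have [aw _] := Ow.
rewrite /mark_count patchE mem_set// indicE.
have [/set_mem wE|/negP wE] := boolP (w \in _).
  rewrite (_ : marked_jumps _ _ _ _ = [set hit z w]); last first.
    apply/seteqP; split => s /=; first by move=> /(marked_crossing Ow)[].
    move=> ->; case: wE => -[_ wT] [Zw Cw]; have t0 := hit_gt0 Ow wT.
    split; last by split.
    split; last by rewrite /= in_itv/= t0/= ltW// -lte_fin -hit_finite.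
    split => //; case: Cw => _ _; rewrite /pre_hit/= lastv_killD//.
    by move: (llim w _) (jump w _) => l j lK zl; move: Kz; lra.
  by rewrite /counting asboolT ?finite_set1// fset_set1 cardfs1.
rewrite (_ : marked_jumps _ _ _ _ = set0) ?measure0//.
apply/seteqP; split => // s ms; apply: wE; apply/mem_set.
have [sE wT] := marked_crossing Ow ms.
by case: ms => _ /=; rewrite sE; split.
Qed.

(** Without strict crossing, the hitting value is exactly [z], reached by a jump above [v]. There is
    only an inequality, because earlier jumps may also have landed on the level. *)
Lemma mark_count_touching Z w :
  hit_event z T (Z `&` [set x : D R * R | lastv x.1 < K] `&` ~` crossing z T K) w ->
  (1 <= mark_count v T (Z `&` touching z T K) w)%E.
Proof.
move=> [[Ow wT] [[Zw]]]; have t0 := hit_gt0 Ow wT; have [aw _] := Ow.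
rewrite [X in X -> _]/= lastv_killD// => lK nC.
have zE : z = pval w (hit z w).
  apply/eqP; rewrite eq_le (tau_at Ow (hit_finite wT)) leNgt/=; apply/negP => zw.
  by apply: nC; exact: pre_hit_ladder.
rewrite /mark_count patchE mem_set//.
have hs : [set hit z w] `<=` marked_jumps v T w (Z `&` touching z T K).
  move=> _ ->; split; last first.
    by split => //=; apply: pre_hit_ladder => //; rewrite -zE.
  split; last by rewrite /= in_itv/= t0/= ltW// -lte_fin -hit_finite.
  split => //; rewrite /jump -zE.
  by move: (llim w _) lK => l lK; move: Kz; lra.
have <- : (counting [set hit z w] : \bar R) = 1%E.
  by rewrite /counting asboolT ?finite_set1// fset_set1 cardfs1.
apply: le_measure => //; rewrite inE; first exact: finite_measurable.
by apply: finite_measurable; exact: finite_marked_jumps.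
Qed.

End crossing.

(** The joint law of [f] and [q] is the product of the image of [m] with [m2], and Fubini applies.
    The finite mass of [m] is arbitrary, so that [m] can be [P 0] restricted to an event. *)
Lemma integral_independent d d1 d2 (T : measurableType d) (S1 : measurableType d1)
    (S2 : measurableType d2) (R : realType) (m : {measure set T -> \bar R})
    (m2 : {finite_measure set S2 -> \bar R}) (f : T -> S1) (q : T -> S2)
    (g : S1 * S2 -> \bar R) :
  (m setT < +oo)%E -> measurable_fun setT f -> measurable_fun setT q ->
  (forall A B, measurable A -> measurable B ->
    m (f @^-1` A `&` q @^-1` B) = (m (f @^-1` A) * m2 B)%E) ->
  measurable_fun setT g -> (\int[m]_x \int[m2]_y `|g (f x, y)| < +oo)%E ->
  (\int[m]_x g (f x, q x) = \int[m]_x \int[m2]_y g (f x, y))%E.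
Proof.
move=> mfin mf mq ind mg gfin.
have mfq : measurable_fun setT (fun x => (f x, q x)) by exact: measurable_fun_pair.
have ifin : (image_measure m mf setT < +oo)%E by rewrite image_measureE preimage_setT.
have [m1 m1E] := finite_measure_of ifin.
have eqm (h : S1 -> \bar R) : (\int[m1]_x h x = \int[image_measure m mf]_x h x)%E.
  by apply: eq_measure_integral => A _ _; exact: m1E.
have prodE : forall X, measurable X -> (m1 \x m2)%E X = image_measure m mfq X.
  apply: product_measure_unique => A B mA mB.
  transitivity (image_measure m mf A * m2 B)%E; last first.
    by congr (_ * _)%E; exact/esym/m1E.
  change (m ((fun x => (f x, q x)) @^-1` (A `*` B)) = (m (f @^-1` A) * m2 B)%E).
  by rewrite -ind//; congr (m _); apply/seteqP; split.
have mF : measurable_fun setT (fun x => \int[m2]_y g (x, y))%E.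
  exact: measurable_fun_integral_snd.
have ig : (m1 \x m2)%E.-integrable setT g.
  apply/integrable12ltyP => //; rewrite eqm ge0_integral_image_measure//.
    by apply: (@measurable_fun_integral_snd _ _ _ _ _ m2 (fun z => `|g z|%E)); exact: measurableT_comp.
  by move=> x; exact: integral_ge0.
transitivity (\int[image_measure m mfq]_z g z)%E.
  by rewrite integral_image_measure.
transitivity (\int[(m1 \x m2)%E]_z g z)%E.
  by apply: eq_measure_integral => A mA _; exact/esym/prodE.
by rewrite -integral12_prod_meas1// eqm integral_image_measure.
Qed.

(** * Law of the path and of the jump at the hitting time *)

Section hitting_jump.
Variables (R : realType) (P : R -> probability (D R) R).
Hypothesis levyP : levy_family P.

Lemma hit_eventI (z T : R) Z A :
  hit_event z T (Z `&` A) = hit_event z T Z `&` pre_hit z @^-1` A.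
Proof. by rewrite /hit_event preimage_setI setIA. Qed.

Lemma strong_markov_integral (z T : R) Z (g : (D R * R) * D R -> \bar R) :
  measurable Z -> measurable_fun setT g ->
  (\int[P 0]_(w in hit_event z T Z) \int[P 0]_w' `|g (pre_hit z w, w')| < +oo)%E ->
  (\int[P 0]_(w in hit_event z T Z) g (pre_hit z w, post_hit z w) =
   \int[P 0]_(w in hit_event z T Z) \int[P 0]_w' g (pre_hit z w, w'))%E.
Proof.
move=> mZ mg gfin; have mE := measurable_hit_event z T mZ.
rewrite -!(integral_mrestr (P 0) mE); apply: integral_independent => //.
- by rewrite /= /mrestr setTI -ge0_fin_numE//; exact: fin_num_measure.
- exact: measurable_pre_hit.
- exact: measurable_post_hit.
- move=> A B mA mB; rewrite /= /mrestr.
  rewrite [X in (_ = P 0 X * _)%E]setIC -hit_eventI -strong_markov//; last exact: measurableI.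
  by rewrite hit_eventI setIC setIA.
- by rewrite integral_mrestr.
Qed.

Variables (v z T K : R) (Pi : {finite_measure set R -> \bar R}).
Hypotheses (v0 : 0 < v) (z0 : 0 < z) (T0 : 0 < T) (Kz : K + v <= z).
Hypothesis compE : forall c (Z : set (D R * R)), 0 <= c -> measurable Z ->
  (\int[P 0]_w mark_count v c Z w =
   (((@lebesgue_measure R) \x P 0) \x Pi)
      ([set x | (0 < x.1.1 <= c)%R] `&` @kill_pair R @^-1` Z))%E.

Local Notation base := (((@lebesgue_measure R) \x P 0) \x Pi)%E.

Lemma measurable_time_slab (c : R) :
  measurable [set x : (R * D R) * R | (0 < x.1.1 <= c)%R].
Proof.
rewrite (_ : [set _ | _] = (`]0%R, c]%classic `*` setT) `*` setT).
  by apply: measurableX => //; apply: measurableX.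
by apply/seteqP; split => -[[t w] y] /=; rewrite in_itv/=; tauto.
Qed.

Definition jump_measure : {measure set (D R * R) -> \bar R} :=
  image_measure (mrestr base (measurable_time_slab T)) (@measurable_kill_pair R).

Lemma jump_measureE Z : measurable Z ->
  jump_measure Z = (\int[P 0]_w mark_count v T Z w)%E.
Proof. by move=> mZ; rewrite compE ?(ltW T0)// setIC. Qed.

Lemma integral_jump_measure C (f : D R * R -> \bar R) :
  measurable C -> measurable_fun setT f ->
  (\int[jump_measure]_(x in C) f x =
   \int[base]_(x in [set x | (0 < x.1.1 <= T)%R] `&` @kill_pair R @^-1` C) f (kill_pair x))%E.
Proof.
move=> mC mf.
rewrite integral_mkcond integral_image_measure; last first.
  by apply/(measurable_restrictT _ mC); exact: measurable_funTS.
rewrite integral_mrestr integral_mkcond [RHS]integral_mkcond.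
apply: eq_integral => x _; rewrite !patchE in_setI; case: ifP => //= _.
Qed.

Let mC := measurable_crossing z T K.
Let mTo := measurable_touching z T K.

(** By [mark_count_crossing] the probability is the mean of a count, to which the compensation
    formula applies. *)
Lemma hit_crossing Z : measurable Z ->
  P 0%R (hit_event z T (Z `&` crossing z T K)) = jump_measure (Z `&` crossing z T K).
Proof.
move=> mZ; have mZC : measurable (Z `&` crossing z T K) by exact: measurableI.
rewrite jump_measureE// -[X in P 0 X = _]setIT -integral_indic//; last exact: measurable_hit_event.
by apply: (levy_ae_eq_integral levyP) => w /set_mem Ow; rewrite mark_count_crossing.
Qed.

Definition last_below : set (D R * R) := [set x | lastv x.1 < K].

Lemma measurable_last_below : measurable last_below.
Proof.
apply: measurable_ltr_set => //.
exact: (measurableT_comp (@measurable_lastv R) (@measurable_fst _ _ (D R) R)).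
Qed.
Let mL := measurable_last_below.

Lemma hit_touching Z : measurable Z ->
  (P 0%R (hit_event z T (Z `&` last_below `&` ~` crossing z T K)) <=
   jump_measure (Z `&` touching z T K))%E.
Proof.
move=> mZ; have mZT : measurable (Z `&` touching z T K) by exact: measurableI.
have mZC : measurable (Z `&` last_below `&` ~` crossing z T K).
  by apply: measurableI; [exact: measurableI|exact: measurableC].
rewrite jump_measureE// -[X in (P 0 X <= _)%E]setIT -integral_indic//; last exact: measurable_hit_event.
apply: ge0_le_integral => //.
- by apply/measurable_EFinP/measurable_indic; exact: measurable_hit_event.
- exact: measurable_mark_count.
- move=> w _; rewrite indicE.
  have [/set_mem wE|_] := boolP (w \in _); last exact: mark_count_ge0.
  exact: (mark_count_touching v0 z0 Kz).
Qed.

Lemma integral_hit_crossing (f : D R * R -> \bar R) : measurable_fun setT f ->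
  (\int[P 0]_(w in hit_event z T (crossing z T K)) f (pre_hit z w) =
   \int[base]_(x in [set x | (0 < x.1.1 <= T)%R] `&` @kill_pair R @^-1` crossing z T K)
      f (kill_pair x))%E.
Proof.
move=> mf; have mE := measurable_hit_event z T mC.
rewrite -integral_jump_measure// -(integral_mrestr _ mE) -(integral_mrestr _ mC).
rewrite -(integral_image_measure _ (measurable_pre_hit z))//.
apply: eq_measure_integral => A mA _.
rewrite image_measureE /= /mrestr; apply: etrans (hit_crossing mA); congr (P 0 _).
by rewrite [A `&` _]setIC [RHS]hit_eventI setIC.
Qed.

Lemma integral_hit_touching (f : D R * R -> \bar R) : measurable_fun setT f ->
  (forall x, (0 <= f x)%E) ->
  (\int[P 0]_(w in hit_event z T (last_below `&` ~` crossing z T K)) f (pre_hit z w) <=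
   \int[base]_(x in [set x | (0 < x.1.1 <= T)%R] `&` @kill_pair R @^-1` touching z T K)
      f (kill_pair x))%E.
Proof.
move=> mf f0.
have mLC : measurable (last_below `&` ~` crossing z T K).
  by apply: measurableI => //; exact: measurableC.
have mE := measurable_hit_event z T mLC.
rewrite -integral_jump_measure// -(integral_mrestr _ mE) -(integral_mrestr _ mTo).
rewrite -(integral_image_measure _ (measurable_pre_hit z))//.
apply: ge0_integral_le_measure => // A mA.
rewrite image_measureE /= /mrestr; apply: le_trans (hit_touching mA).
rewrite le_eqVlt; apply/orP; left; apply/eqP; congr (P 0 _).
by rewrite -setIA [A `&` _]setIC [RHS]hit_eventI setIC.
Qed.

End hitting_jump.

(** * Densities and exponential tails *)

Section density.
Local Open Scope ereal_scope.

(** [h] has the same integrals over measurable sets as the Radon-Nikodym derivative of [nu], hence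
    equals it almost everywhere. *)
Lemma integral_density d (T : measurableType d) (R : realType)
    (mu : {sigma_finite_measure set T -> \bar R})
    (nu : {finite_measure set T -> \bar R}) (h : T -> R) (E : set T)
    (f : T -> \bar R) :
  measurable_fun setT h -> (forall x, (0 <= h x)%R) -> measurable E ->
  (forall A, measurable A -> nu A = \int[mu]_(x in A) (h x)%:E) ->
  nu.-integrable E f ->
  \int[nu]_(x in E) f x = \int[mu]_(x in E) (f x * (h x)%:E).
Proof.
move=> mh h0 mE nuE intf.
have dom : nu `<< mu.
  apply/null_content_dominatesP => A mA A0; rewrite nuE//.
  by apply: null_set_integral => //; exact/measurable_funTS/measurable_EFinP.
have inth : mu.-integrable setT (EFin \o h).
  apply/integrableP; split; first exact/measurable_EFinP.
  under eq_integral do rewrite /= ger0_norm//.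
  by rewrite -nuE// fin_num_fun_lty//; exact: fin_num_measure.
have mf : measurable_fun E f by case/integrableP: intf.
have mRN : measurable_fun E (Radon_Nikodym (charge_of_finite_measure nu) mu).
  apply: (measurable_int mu); apply: (integrableS _ _ (@subsetT _ _)) => //=.
  by apply: Radon_Nikodym_integrable.
rewrite -(Radon_Nikodym_change_of_variables dom mE intf).
apply: ae_eq_integral => //.
- exact: emeasurable_funM.
- by apply: emeasurable_funM => //; exact/measurable_funTS/measurable_EFinP.
- apply: ae_eqe_mul2l; apply: integral_ae_eq => //=.
  + apply: (integrableS _ _ (@subsetT _ _)) => //=.
    by apply: Radon_Nikodym_integrable.
  + exact/measurable_funTS/measurable_EFinP.
  + by move=> A AE mA; rewrite -nuE// -Radon_Nikodym_integral.
Qed.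

End density.

Section exponential_tail.
Variable R : realType.
Variable a : R.
Hypothesis a0 : 0 < a.

Lemma continuous_exp_scale : continuous (fun z : R => expR (- a * z)).
Proof.
move=> z; apply: continuous_comp; last exact: continuous_expR.
by apply: continuousM => //; exact: cst_continuous.
Qed.

Lemma measurable_exp_scale : measurable_fun setT (fun z : R => expR (- a * z)).
Proof. exact: continuous_measurable_fun continuous_exp_scale. Qed.

Lemma cvg_exp_scale : expR (- a * z) @[z --> +oo] --> (0 : R).
Proof.
rewrite (_ : (fun z => _) = (fun z => expR (- z)) \o (fun z => a * z)); last first.
  by apply/funext => z /=; rewrite mulNr.
apply: (@cvg_comp _ _ _ _ _ _ (pinfty_nbhs R)); last exact: cvgr_expR.
exact: gt0_cvgMry.
Qed.

Lemma exp_tail z : (\int[@lebesgue_measure R]_(y in `]z, +oo[) (a * expR (- a * y))%:E =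
  (expR (- a * z))%:E)%E.
Proof.
have cd : continuous (fun y : R => a * expR (- a * y)).
  move=> y; apply: (@continuousM _ R^o (fun=> a) (fun x => expR (- a * x))).
    exact: cst_continuous.
  exact: continuous_exp_scale.
rewrite integral_itv_obnd_cbnd; last first.
  by apply/measurable_EFinP/measurable_funTS; exact: continuous_measurable_fun.
rewrite (@ge0_continuous_FTC2y _ _ (fun y => - expR (- a * y)) z 0).
- by rewrite EFinN oppeK add0e.
- by move=> y _; rewrite mulr_ge0 ?expR_ge0 ?ltW.
- exact: continuous_subspaceT.
- by rewrite -oppr0; apply: cvgN; exact: cvg_exp_scale.
- by move=> y _; exact: ex_derive.
- by apply/cvg_at_right_filter; apply: cvgN; exact: continuous_exp_scale.
- move=> y _; rewrite derive1_comp// derive1N// derive1_id mulN1r derive1_comp// derive1E.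
  have /funeqP -> := @derive_expR R.
  by rewrite derive1Ml// derive1_id mulr1 mulrN opprK mulrC.
Qed.

End exponential_tail.

(** * Quantiles and weak convergence *)

Section quantile.
Variable R : realType.
Implicit Types (m : {finite_measure set R -> \bar R}) (a s z : R).

Definition tail m z : R := fine (m `]z, +oo[%classic).

Lemma tailE m z : m `]z, +oo[%classic = (tail m z)%:E.
Proof. by rewrite fineK// fin_num_measure. Qed.

Lemma tail_ge0 m z : 0 <= tail m z.
Proof. exact: fine_ge0. Qed.

Lemma tail_le m z y : z <= y -> tail m y <= tail m z.
Proof.
move=> zy; rewrite -lee_fin -!tailE le_measure ?inE//.
by move=> t /=; rewrite !in_itv/= !andbT; exact: le_lt_trans.
Qed.

Lemma tail_near_infty m s : 0 < s -> exists z, tail m z < s.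
Proof.
move=> s0; pose F (n : nat) := `](n%:R : R), +oo[%classic.
have F0 : \bigcap_n F n = set0.
  apply/seteqP; split => // z Fz.
  have [n] : exists n : nat, z < n%:R.
    by exists (Num.truncn z).+1; exact: truncnS_gt.
  by have := Fz n I; rewrite /F/= in_itv/= andbT => /ltW; rewrite leNgt => /negbTE->.
have : m \o F @ \oo --> m (\bigcap_n F n).
  apply: nonincreasing_cvg_mu => //.
  - have h : (m (F 0%N) < +oo)%E by rewrite /F/= tailE ltry.
    exact: h.
  - by move=> i; exact: measurable_itv.
  - by rewrite F0.
  - move=> i j ij; apply/subsetPset => z; rewrite /F/= !in_itv/= !andbT.
    by apply: le_lt_trans; rewrite ler_nat.
rewrite F0 measure0 => /fine_cvgP[_ /cvgrPdist_lt/(_ s s0)[n _ /(_ n (leqnn n))]].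
by rewrite sub0r normrN ger0_norm ?fine_ge0// => ?; exists n%:R.
Qed.

Lemma tail_right_cvg m z : tail m (z + n.+1%:R^-1) @[n --> \oo] --> tail m z.
Proof.
pose F (n : nat) := `]z + n.+1%:R^-1, +oo[%classic.
have FE : \bigcup_n F n = `]z, +oo[%classic.
  apply/seteqP; split => y; rewrite /F/= in_itv/= andbT.
    by move=> [n _]; rewrite /= in_itv/= andbT; apply: le_lt_trans; rewrite lerDl.
  move=> zy; have yz0 : 0 < y - z by rewrite subr_gt0.
  have [n _ /(_ n (leqnn n)) ny] := near_infty_natSinv_lt (PosNum yz0).
  by exists n => //=; rewrite in_itv/= andbT addrC -ltrBrDr.
suff : m \o F @ \oo --> m (\bigcup_n F n) by rewrite FE tailE => /fine_cvgP[_].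
apply: nondecreasing_cvg_mu.
- by move=> i; exact: measurable_itv.
- have h : measurable (\bigcup_n F n) by rewrite FE; exact: measurable_itv.
  exact: h.
move=> i j ij; apply/subsetPset => y; rewrite /F/= !in_itv/= !andbT.
by apply: le_lt_trans; rewrite lerD2l lef_pV2 ?posrE// ler_nat.
Qed.

(** The generalized inverse of the tail: it carries Lebesgue measure on []0, tail m a[] to [m] on
    []a, +oo[]. The value [a] for [s <= 0] makes it total and bounded below by [a]. *)
Definition quantile m a s : R :=
  if 0 < s then inf [set z | a <= z /\ tail m z <= s] else a.

(** The infimum is attained because tails are right-continuous, which makes [quantile] and [tail]
    adjoint. *)
Lemma quantile_le m a s z : 0 < s -> a <= z ->
  (quantile m a s <= z) = (tail m z <= s).
Proof.
move=> s0 az; rewrite /quantile s0; set S := [set _ | _].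
have Slb : lbound S a by move=> y [].
have Sne : S !=set0.
  have [y ys] := tail_near_infty m s0; exists (Num.max a y); split; first by rewrite le_max lexx.
  by apply: le_trans (ltW ys); apply: tail_le; rewrite le_max lexx orbT.
apply/idP/idP => [qz|Sz]; last by apply: ge_inf => //; exists a.
apply: (cvgr_to_le (@tail_right_cvg m z)); near=> n.
have [y [_ ys] yq] : exists2 y, S y & y < inf S + n.+1%:R^-1.
  by apply: inf_adherent => //; split => //; exists a.
apply: le_trans ys; apply: tail_le; apply: le_trans (ltW yq) _.
by rewrite lerD2r.
Unshelve. all: by end_near. Qed.

Lemma quantile_gt m a s z : 0 < s -> a <= z ->
  (z < quantile m a s) = (s < tail m z).
Proof. by move=> s0 az; rewrite ltNge quantile_le// -ltNge. Qed.

Lemma quantile_ge m a s : a <= quantile m a s.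
Proof.
rewrite /quantile; case: ifPn => // s0; apply: lb_le_inf; last by move=> y [].
have [y ys] := tail_near_infty m s0; exists (Num.max a y); split; first by rewrite le_max lexx.
by apply: le_trans (ltW ys); apply: tail_le; rewrite le_max lexx orbT.
Qed.

Lemma quantile_ray m a z : a <= z ->
  quantile m a @^-1` `]z, +oo[%classic = `]0, tail m z[%classic.
Proof.
move=> az; apply/seteqP; split => s; rewrite /preimage/= !in_itv/= !andbT; last first.
  by move=> /andP[s0]; rewrite quantile_gt.
have [s0|s0] := ltP 0 s; first by rewrite quantile_gt// s0.
by rewrite /quantile (ltNge 0) s0/= => /(le_lt_trans az); rewrite ltxx.
Qed.

Lemma measurable_quantile m a : measurable_fun setT (quantile m a).
Proof.
apply: (measurability _ (RGenOInfty.measurableE R)) => _ [_ [z ->] <-]; rewrite setTI.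
have [az|za] := leP a z; first by rewrite quantile_ray.
rewrite (_ : _ @^-1` _ = setT)//; apply/seteqP; split => // s _.
by rewrite /preimage/= in_itv/= andbT (lt_le_trans za)// quantile_ge.
Qed.

Lemma integral_quantile m a (f : R -> \bar R) : measurable_fun setT f ->
  (\int[m]_(z in `]a, +oo[) f z =
   \int[@lebesgue_measure R]_(s in `]0%R, tail m a[) f (quantile m a s))%E.
Proof.
move=> mf.
have mI : measurable `]a, +oo[%classic by exact: measurable_itv.
have mJ : measurable `]0, tail m a[%classic by exact: measurable_itv.
rewrite -(integral_mrestr _ mI).
apply: etrans _ (integral_mrestr (@lebesgue_measure R) mJ _).
transitivity (\int[image_measure (mrestr (@lebesgue_measure R) mJ)
    (@measurable_quantile m a)]_y f y)%E; last exact: integral_image_measure.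
apply: eq_measure_integral => A mA _.
apply: (measure_unique_pi (@measurable_rays R) (@setI_closed_rays R)) => //.
- exact: raysT.
- by change (m (setT `&` `]a, +oo[) < +oo)%E; rewrite setTI tailE ltry.
- move=> B HB; change (m (B `&` `]a, +oo[) =
    @lebesgue_measure R (quantile m a @^-1` B `&` `]0%R, tail m a[))%E.
  suff [z az [-> ->]] : exists2 z, a <= z & (B `&` `]a, +oo[ = `]z, +oo[%classic /\
      quantile m a @^-1` B `&` `]0, tail m a[ = quantile m a @^-1` `]z, +oo[%classic).
    rewrite quantile_ray// lebesgue_measure_itv/= lte_fin tailE.
    by case: ltP => [_|]; [rewrite ?sube0 ?subr0|move=> h; congr EFin; apply/eqP; rewrite eq_le h tail_ge0].
  case: HB => [->|[y ->]].
    exists a => //; split; first by rewrite setTI.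
    by rewrite preimage_setT setTI quantile_ray.
  exists (Num.max a y); first by rewrite le_max lexx.
  have E : `]y, +oo[ `&` `]a, +oo[ = `]Num.max a y, +oo[%classic.
    apply/seteqP; split => t /=; rewrite !in_itv/= !andbT gt_max.
      by move=> [-> ->].
    by move=> /andP[-> ->].
  by rewrite E -(@quantile_ray m a a)// -preimage_setI E.
Qed.

(** Strict decrease of the limiting tail rules out flat stretches, at which the inverse would
    jump. *)
Lemma cvg_quantile (mn : nat -> {finite_measure set R -> \bar R}) m a s :
  (forall z, a <= z -> tail (mn n) z @[n --> \oo] --> tail m z) ->
  (forall z y, a <= z -> z < y -> tail m y < tail m z) ->
  0 < s -> quantile (mn n) a s @[n --> \oo] --> quantile m a s.
Proof.
move=> mnm dec s0; set q := quantile m a s.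
have aq : a <= q by exact: quantile_ge.
apply/cvgrPdist_le => e e0.
have h1 : \forall n \near \oo, quantile (mn n) a s <= q + e.
  have qe : a <= q + e by rewrite (le_trans aq)// lerDl ltW.
  have : tail m (q + e) < s.
    by apply: (@lt_le_trans _ _ (tail m q)); [apply: dec => //; rewrite ltrDl|rewrite -(quantile_le m s0 aq)].
  move=> /(cvgr_lt _ (mnm _ qe)); apply: filterS => n.
  by rewrite quantile_le// => /ltW.
have h2 : \forall n \near \oo, q - e <= quantile (mn n) a s.
  have [aqe|] := leP a (q - e); last first.
    by move=> /ltW qe; apply: nearW => n; apply: le_trans qe (quantile_ge _ _ _).
  have : s < tail m (q - e) by rewrite -(quantile_gt _ s0 aqe) gtrBl.
  move=> /(cvgr_gt _ (mnm _ aqe)); apply: filterS => n.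
  by rewrite -(quantile_gt _ s0 aqe) => /ltW.
near=> n; rewrite ler_distlC; apply/andP; split; near: n; [exact: h2|exact: h1].
Unshelve. all: by end_near. Qed.

(** Skorokhod's representation: after the change of variables by quantiles, the integrands converge
    for Lebesgue-almost every [s], and bounded convergence applies. *)
Lemma weak_cvg (mn : nat -> {finite_measure set R -> \bar R}) m a (f : R -> R) (M : R) :
  measurable_fun setT f -> (forall z, `|f z| <= M) ->
  (forall z, a <= z -> tail (mn n) z @[n --> \oo] --> tail m z) ->
  (forall z y, a <= z -> z < y -> tail m y < tail m z) ->
  m.-negligible [set z | a < z /\ ~ (f y @[y --> z] --> f z)] ->
  (\int[mn n]_(z in `]a, +oo[) (f z)%:E @[n --> \oo] -->
   \int[m]_(z in `]a, +oo[) (f z)%:E)%E.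
Proof.
move=> mf fM mnm dec disc; have mEf : measurable_fun setT (EFin \o f) by exact/measurable_EFinP.
have M0 : 0 <= M by exact: le_trans (fM 0).
(* A common bound of the masses, so that all the integrals run over the same interval []0, C[]. *)
have [C CE mnC] : exists2 C, tail m a <= C & forall n, tail (mn n) a <= C.
  have cv : cvgn (fun n => tail (mn n) a) by apply/cvg_ex; eexists; exact: mnm.
  have [C0 [_ hC]] := cvg_seq_bounded cv; exists (Num.max (tail m a) (C0 + 1)).
    by rewrite le_max lexx.
  move=> n; rewrite le_max; apply/orP; right.
  by apply: le_trans (ler_norm _) _; apply: hC => //; rewrite ltrDl.
have mkE (k : {finite_measure set R -> \bar R}) : tail k a <= C ->
    (\int[k]_(z in `]a, +oo[) (f z)%:E =
     \int[@lebesgue_measure R]_(s in `]0%R, C[)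
       (((f \o quantile k a) \_ `]0%R, tail k a[) s)%:E)%E.
  move=> kC; rewrite (integral_quantile k a mEf) -[in LHS](_ : `]0, C[ `&` `]0, tail k a[ = `]0, tail k a[%classic); last first.
    apply: setIidr => s /=; rewrite !in_itv/= => /andP[-> /=]; move/lt_le_trans; exact.
  by rewrite integral_mkcondr; apply: eq_integral => s _; rewrite !patchE; case: ifP.
rewrite mkE//; under eq_fun do rewrite mkE//.
have mfq (k : {finite_measure set R -> \bar R}) : measurable_fun setT (f \o quantile k a).
  by apply: measurableT_comp => //; exact: measurable_quantile.
have mpatch (k : {finite_measure set R -> \bar R}) :
    measurable_fun `]0%R, C[ ((f \o quantile k a) \_ `]0%R, tail k a[).
  apply: measurable_funTS; apply/measurable_restrict => //.
  exact: measurable_funTS.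
apply: (@ae_bounded_convergence _ _ _ _ _ _ _ M) => //.
- have h : (@lebesgue_measure R `]0%R, C[ < +oo)%E.
    by rewrite lebesgue_measure_itv/=; case: ifP => _; rewrite ?sube0 ?ltry.
  exact: h.
- by move=> n; exact: mpatch.
- exact: mpatch.
- by move=> n s _; rewrite patchE; case: ifP => _ /=; rewrite ?normr0 ?fM.
have nq : (@lebesgue_measure R).-negligible
    [set s | 0 < s < tail m a /\ ~ (f y @[y --> quantile m a s] --> f (quantile m a s))].
  have [N [mN N0 Nd]] := disc.
  pose NI := N `&` `]a, +oo[; pose Nq := quantile m a @^-1` NI.
  have mI : measurable `]a, +oo[%classic by exact: measurable_itv.
  have mNI : measurable NI by exact: measurableI.
  have mNq : measurable Nq.
    by have := measurable_quantile m a measurableT mNI; rewrite setTI.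
  have mE : measurable_fun setT (fun z => (\1_NI z)%:E : \bar R).
    exact/measurable_EFinP/measurable_indic.
  have e1 : (\int[m]_(z in `]a, +oo[) (\1_NI z)%:E = m NI)%E.
    by rewrite integral_indic// setIidl// => ? [].
  have e2 : (\int[@lebesgue_measure R]_(s in `]0%R, tail m a[) (\1_NI (quantile m a s))%:E =
      @lebesgue_measure R Nq)%E.
    transitivity (\int[@lebesgue_measure R]_(s in `]0%R, tail m a[) (\1_Nq s)%:E)%E.
      by apply: eq_integral => s _; rewrite !indicE.
    rewrite integral_indic// setIidl// => s Nqs.
    by rewrite -(@quantile_ray m a a)//; case: Nqs.
  have NI0 : m NI = 0%E by apply: (subset_measure0 mNI mN _ N0) => ? [].
  exists Nq; split => //.
  - by rewrite -NI0 -e1 -e2; exact/esym/integral_quantile.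
  - move=> s /= [s01 ndc]; suff aq : a < quantile m a s.
      by split; [apply: Nd|rewrite /= in_itv/= andbT].
    by move: s01 => /andP[s0 s1]; rewrite quantile_gt.
(* At the endpoint [s = tail m a] membership in the varying intervals may fail to converge; it is a
   single point. *)
have n1 : (@lebesgue_measure R).-negligible [set tail m a].
  by exists [set tail m a]; split => //; exact: lebesgue_measure_set1.
apply: negligibleS (negligibleU nq n1) => s /= /not_implyP[].
rewrite in_itv/= => /andP[s0 sC] ndc.
have [st|st|] := ltgtP s (tail m a); last by right.
- left; split; first by rewrite s0.
  apply: contra_not ndc => fc; rewrite patchE mem_set/= ?in_itv/= ?s0//.
  have : {near \oo, (fun n => f (quantile (mn n) a s)) =1
      (fun n => (f \o quantile (mn n) a) \_ `]0, tail (mn n) a[ s)}.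
    near=> n; have sn : s < tail (mn n) a.
      by near: n; exact: (cvgr_gt _ (mnm a (lexx a)) _ st).
    by rewrite patchE mem_set//= in_itv/= s0.
  by move/near_eq_cvg => h; apply: cvg_trans h _; exact: (cvg_comp _ _ (cvg_quantile mnm dec s0) fc).
- exfalso; apply: ndc; rewrite patchE memNset/= ?in_itv/= ?s0/=; last by apply/negP; rewrite -leNgt ltW.
  have : {near \oo, (fun n => 0) =1
      (fun n => (f \o quantile (mn n) a) \_ `]0, tail (mn n) a[ s)}.
    near=> n; have sn : tail (mn n) a < s.
      by near: n; exact: (cvgr_lt _ (mnm a (lexx a)) _ st).
    by rewrite patchE memNset//= in_itv/= s0/=; apply/negP; rewrite -leNgt ltW.
  by move/near_eq_cvg => h; apply: cvg_trans h _; exact: cvg_cst.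
Unshelve. all: by end_near. Qed.

End quantile.

(** * Tails in the class [L^(alpha)] and Potter's bound *)

Section regular_tail.
Variables (R : realType) (f : R -> R) (alpha x0 : R).
Hypotheses (alpha0 : 0 < alpha) (f_gt0 : forall u, x0 <= u -> 0 < f u).
Hypothesis f_le : forall u v, x0 <= u -> u <= v -> f v <= f u.
Hypothesis f_ratio : forall y, f (u + y) / f u @[u --> +oo] --> expR (- alpha * y).

Lemma tail_step g : g < alpha ->
  exists2 U, x0 <= U & forall u, U <= u -> f (u + 1) <= expR (- g) * f u.
Proof.
move=> ga; have lt : expR (- alpha * 1) < expR (- g) by rewrite ltr_expR mulr1 ltrN2.
have [U [_ hU]] := cvgr_le _ (@f_ratio 1) _ lt.
(* The limit speaks of [u] strictly beyond [U], hence [U + 1]. *)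
exists (Num.max x0 (U + 1)); first by rewrite le_max lexx.
move=> u; rewrite ge_max => /andP[xu Uu].
have := hU u (lt_le_trans _ Uu); rewrite ltrDl => /(_ ltr01).
by rewrite ler_pdivrMr// f_gt0.
Qed.

(** The unit step is iterated [Num.truncn y] times; the fractional part of [y] costs at most the
    factor [expR g]. *)
Lemma potter g : 0 <= g < alpha -> exists2 U, x0 <= U &
  forall u y, U <= u -> 0 <= y -> f (u + y) <= expR g * expR (- (g * y)) * f u.
Proof.
move=> /andP[g0 ga]; have [U xU hU] := tail_step ga; exists U => // u y Uu y0.
have iter n : f (u + n%:R) <= expR (- (g * n%:R)) * f u.
  elim: n => [|n IH]; first by rewrite addr0 mulr0 oppr0 expR0 mul1r.
  rewrite -natr1 addrA; apply: le_trans (hU _ _) _; first by rewrite (le_trans Uu)// lerDl.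
  rewrite (_ : - (g * (n%:R + 1)) = - g + - (g * n%:R)); last by ring.
  by rewrite expRD -mulrA; apply: ler_wpM2l => //; exact: expR_ge0.
have [n1 n2] : (Num.truncn y)%:R <= y /\ y < (Num.truncn y).+1%:R.
  by split; [rewrite truncn_le|exact: truncnS_gt].
apply: (@le_trans _ _ (f (u + (Num.truncn y)%:R))).
  apply: f_le; last by rewrite lerD2l.
  by rewrite (le_trans xU)// (le_trans Uu)// lerDl.
apply: le_trans (iter _) _; apply: ler_wpM2r.
  by apply/ltW/f_gt0/(le_trans xU).
rewrite -expRD ler_expR (_ : g + - (g * y) = g * (1 - y)); last by ring.
by rewrite -mulrN; apply: ler_wpM2l => //; rewrite -natr1 in n2; lra.
Qed.

Definition neg_part (y : R) : R := Num.max 0 (- y).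

(** For [phi <= 0] Potter's bound at base [u - x] cancels the exponential growth; for [0 < phi <= K]
    monotonicity reduces the claim to the ratio at the fixed shift [x + k]. *)
Lemma tail_domination g x K : 0 <= g < alpha -> 0 <= x ->
  exists U C : R, [/\ 0 <= C, forall u, U <= u -> x0 <= u - x - K &
  forall u phi, U <= u -> phi <= K ->
    expR (g * neg_part phi) * f (u - x - phi) <= C * f u].
Proof.
move=> gE xpos; have [U0 xU0 pot] := potter gE; have [g0 ga] := andP gE.
pose k := `|K|; have k0 : 0 <= k by exact: normr_ge0.
have lt : expR (- alpha * (- (x + k))) < expR (- alpha * (- (x + k))) + 1 by rewrite ltrDl.
have [U1 [_ hU1]] := cvgr_le _ (@f_ratio (- (x + k))) _ lt.
set c := _ + 1 in hU1 lt *.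
have c0 : 0 <= c by rewrite addr_ge0 ?expR_ge0.
have Kk : K <= k by exact: ler_norm.
(* The first term puts [u - x - k] beyond [U0]; the [+ 1] is for the ratio bound, which needs
   [U1 < u]. *)
exists (Num.max (U0 + (x + k)) (U1 + 1)), (expR g * c); split.
- by rewrite mulr_ge0 ?expR_ge0.
- by move=> u; rewrite ge_max => /andP[h _]; lra.
move=> u phi; rewrite ge_max => /andP[uU0 uU1] phiK.
have fu : 0 < f u by apply: f_gt0; lra.
have hb : f (u - (x + k)) <= c * f u.
  have := hU1 u (lt_le_trans _ uU1); rewrite ltrDl => /(_ ltr01).
  by rewrite ler_pdivrMr.
have e1 : 1 <= expR g by rewrite -expR0 ler_expR.
have [p0|p0] := leP phi 0.
  rewrite /neg_part max_r ?oppr_ge0//.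
  have := pot (u - x) (- phi) ltac:(lra) ltac:(lra).
  set d := f (u - x - phi) => hd.
  have hx : f (u - x) <= c * f u by apply: le_trans hb; apply: f_le; lra.
  apply: (@le_trans _ _ (expR (g * - phi) * (expR g * expR (- (g * - phi)) * (c * f u)))).
    apply: ler_wpM2l; first exact: expR_ge0.
    by apply: le_trans hd _; apply: ler_wpM2l => //; rewrite mulr_ge0 ?expR_ge0.
  have exp1 := expRxMexpNx_1 (g * - phi).
  set E := expR (g * - phi) in exp1 *; set E' := expR (- (g * - phi)) in exp1 *.
  rewrite (_ : E * _ = E * E' * (expR g * c * f u)); last by ring.
  by rewrite exp1 mul1r.
rewrite /neg_part max_l ?oppr_le0 ?(ltW p0)// mulr0 expR0 mul1r.
apply: (@le_trans _ _ (c * f u)); first by apply: le_trans hb; apply: f_le; lra.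
by rewrite -mulrA; apply: ler_peMl => //; apply: mulr_ge0 => //; exact: ltW.
Qed.

Lemma cvg_tail_ratio (u : nat -> R) y : u n @[n --> \oo] --> +oo ->
  f (u n + y) / f (u n) @[n --> \oo] --> expR (- alpha * y).
Proof. by move=> uoo; exact: (cvg_comp _ _ uoo (@f_ratio y)). Qed.

End regular_tail.

Lemma bounded_integrable d (T : measurableType d) (R : realType)
    (m : {measure set T -> \bar R}) (A : set T) (f : T -> R) (M : R) :
  measurable A -> (m A < +oo)%E -> measurable_fun A f ->
  (forall x, A x -> `|f x| <= M) -> m.-integrable A (EFin \o f).
Proof.
move=> mA Afin mf fM; apply: (@le_integrable _ _ _ _ A mA _ (EFin \o cst M)).
- exact/measurable_EFinP.
- by move=> x Ax /=; rewrite lee_fin (le_trans (fM x Ax))// ler_norm.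
- apply/integrableP; split; first exact/measurable_EFinP.
  by rewrite /= integral_cst// lte_mul_pinfty.
Qed.

Lemma integral_image_measure_in d d' (T1 : measurableType d)
    (T2 : measurableType d') (R : realType) (m : {measure set T1 -> \bar R})
    (f : T1 -> T2) (mf : measurable_fun setT f) (D : set T2) (g : T2 -> \bar R) :
  measurable D -> measurable_fun D g ->
  (\int[image_measure m mf]_(y in D) g y = \int[m]_(x in f @^-1` D) g (f x))%E.
Proof.
move=> mD mg; rewrite [LHS]integral_mkcond [RHS]integral_mkcond.
rewrite integral_image_measure; last exact/(measurable_restrictT _ mD).
by apply: eq_integral => x _; rewrite !patchE/=.
Qed.

(** * Weak limit of the shifted Levy measure *)

Section overshoot.
Variables (R : realType) (f : R -> R) (alpha x0 : R) (Pi : {finite_measure set R -> \bar R}).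
Hypotheses (alpha0 : 0 < alpha) (f_gt0 : forall u, x0 <= u -> 0 < f u).
Hypothesis f_ratio : forall y, f (u + y) / f u @[u --> +oo] --> expR (- alpha * y).
Hypothesis PiE : forall y, tail Pi y = f (Num.max y x0).
Local Notation leb := (@lebesgue_measure R).

(** The density of the limit of [Pi], translated by [phi - u] and divided by its tail at [u]. The
    cut at [- x] makes the mass finite. *)
Definition exp_density (phi x z : R) : R :=
  (alpha * expR (alpha * phi) * expR (- alpha * z)) * \1_(`]- x, +oo[%classic) z.

Lemma exp_density_ge0 phi x z : 0 <= exp_density phi x z.
Proof. by rewrite !mulr_ge0 ?expR_ge0 ?(ltW alpha0)// indicE. Qed.

Lemma measurable_exp_density phi x : measurable_fun setT (exp_density phi x).
Proof.
apply: measurable_funM; last exact: measurable_indic.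
by apply: measurable_funM => //; exact: measurable_exp_scale.
Qed.

Lemma exp_density_tail phi x z : - x <= z ->
  (\int[leb]_(y in `]z, +oo[) (exp_density phi x y)%:E = (expR (alpha * phi) * expR (- alpha * z))%:E)%E.
Proof.
move=> xz; transitivity (\int[leb]_(y in `]z, +oo[) ((expR (alpha * phi))%:E * (alpha * expR (- alpha * y))%:E))%E.
  apply: eq_integral => y /[!inE]/=; rewrite in_itv/= andbT => zy.
  rewrite /exp_density indicE mem_set/= ?mulr1; last by rewrite in_itv/= andbT (le_lt_trans xz).
  by rewrite -EFinM; congr EFin; ring.
rewrite ge0_integralZl ?exp_tail//.
- apply/measurable_EFinP/measurable_funTS/measurable_funM => //.
  exact: measurable_exp_scale.
- by move=> y _; rewrite lee_fin mulr_ge0 ?expR_ge0 ?ltW.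
Qed.

Lemma ex_exp_measure phi x : exists m : {finite_measure set R -> \bar R},
  (forall A, measurable A -> m A = (\int[leb]_(y in A) (exp_density phi x y)%:E)%E) /\
  (forall (A : set R) (g : R -> R) M, measurable A -> measurable_fun setT g ->
    (forall y, `|g y| <= M) ->
    (\int[m]_(y in A) (g y)%:E = \int[leb]_(y in A) ((g y)%:E * (exp_density phi x y)%:E))%E).
Proof.
pose h (A : set (measurableTypeR R)) : \bar R :=
  (\int[leb]_(y in A) (exp_density phi x y)%:E)%E.
have mh : measurable_fun setT (EFin \o exp_density phi x).
  by apply/measurable_EFinP; exact: measurable_exp_density.
have h0 : h set0 = 0%E by rewrite /h integral_set0.
have hge0 A : (0 <= h A)%E.
  by apply: integral_ge0 => y _; rewrite lee_fin exp_density_ge0.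
have hadd : semi_sigma_additive h.
  move=> F mF tF mUF; rewrite /h; apply: cvg_toP.
    apply: ereal_nondecreasing_is_cvgn => m n mn.
    apply: lee_sum_nneg_natr => // k _ _; exact: hge0.
  rewrite ge0_integral_bigcup//=; first exact: measurable_funTS.
  by move=> y _; rewrite lee_fin exp_density_ge0.
have [m1 m1E] := ex_measure h0 hge0 hadd.
have m1T : (m1 setT < +oo)%E.
  rewrite m1E; suff -> : h setT = (\int[leb]_(y in `](- x)%R, +oo[) (exp_density phi x y)%:E)%E.
    by rewrite exp_density_tail ?ltry.
  rewrite /h [RHS]integral_mkcond; apply: eq_integral => y _.
  rewrite patchE; case: ifPn => // /negP yx; rewrite /exp_density indicE.
  by rewrite (_ : _ \in _ = false) ?mulr0//; exact/negP.
have [m2 m2E] := finite_measure_of m1T.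
(* Lebesgue measure lives on [measurableTypeR R]; the identity transports the new measure to [R]
   itself. *)
have mid : measurable_fun setT (id : measurableTypeR R -> R) by exact: measurable_id.
have m3T : (image_measure m2 mid setT < +oo)%E.
  by rewrite image_measureE; exact: (finite_measure_lty m2 measurableT).
have [m m3E] := finite_measure_of m3T.
exists m; split=> [A mA|A g M mA mg gM]; first exact: etrans (m3E A) (etrans (m2E A) (m1E A)).
transitivity (\int[image_measure m2 mid]_(y in A) (g y)%:E)%E.
  by apply: eq_measure_integral => B _ _; exact: m3E.
rewrite integral_image_measure_in//; last exact/measurable_EFinP/measurable_funTS.
apply: (integral_density (nu := m2) (h := exp_density phi x)) => //.
- exact: measurable_exp_density.
- by move=> y; exact: exp_density_ge0.
- by move=> B _; exact: etrans (m2E B) (m1E B).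
- apply: (@bounded_integrable _ _ _ _ _ _ M) => //; first exact: (finite_measure_lty m2 mA).
  exact: measurable_funTS.
Qed.

Variables (u : nat -> R) (phi x M : R) (G : R -> R).
Hypotheses (u_ge : forall n, x0 <= u n) (u_oo : u n @[n --> \oo] --> +oo).
Hypotheses (mG : measurable_fun setT G) (GM : forall z, `|G z| <= M).
Hypothesis G_cont : leb.-negligible [set z | ~ (G y @[y --> z] --> G z)].

(** The translated and normalized measures have tails [f (u n + (z - phi)) / f (u n)] for large [n],
    which tend to the strictly decreasing tail of [exp_density]; [weak_cvg] concludes. *)
Lemma overshoot_cvg :
  (\int[Pi]_(y in `](u n - x - phi)%R, +oo[) (G (phi + y - u n) / f (u n))%:E @[n --> \oo] -->
   \int[leb]_(z in `](- x)%R, +oo[) (G z * (alpha * expR (alpha * phi) * expR (- alpha * z)))%:E)%E.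
Proof.
pose sh n (y : R) := phi + y - u n.
have msh n : measurable_fun setT (sh n).
  by apply: measurable_funB => //; exact: measurable_funD.
have f0 n : 0 < f (u n) by exact: f_gt0.
have intc (q : {finite_measure set R -> \bar R}) (c : R) (A : set R) : measurable A ->
    (\int[q]_(y in A) (cst c y)%:E = c%:E * q A)%E.
  by move=> mA; exact: (integral_cst q mA c%:E).
(* The normalization is stated as a constant density with respect to the translated measure [q], the
   form expected by [integral_density]. *)
have [mn mnE] : exists mn : nat -> {finite_measure set R -> \bar R},
    forall n, exists2 q : {finite_measure set R -> \bar R},
      (forall A, q A = Pi (sh n @^-1` A)) &
      (forall A, measurable A -> mn n A = \int[q]_(y in A) (cst (f (u n))^-1 y)%:E)%E.
  suff : forall n, exists mn : {finite_measure set R -> \bar R},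
    exists2 q : {finite_measure set R -> \bar R},
      (forall A, q A = Pi (sh n @^-1` A)) &
      (forall A, measurable A -> mn A = \int[q]_(y in A) (cst (f (u n))^-1 y)%:E)%E.
    by move=> /choice[mn mnE]; exists mn.
  move=> n; have fin1 : (image_measure Pi (msh n) setT < +oo)%E.
    by rewrite image_measureE; exact: (finite_measure_lty Pi measurableT).
  have [q qE] := finite_measure_of fin1.
  have p0 : 0 <= (f (u n))^-1 by rewrite invr_ge0 ltW.
  have fin2 : (mscale (NngNum p0) q setT < +oo)%E.
    by apply: lte_mul_pinfty; rewrite ?lee_fin//; exact: (finite_measure_lty q measurableT).
  have [m mE] := finite_measure_of fin2; exists m, q => // A mA.
  by rewrite intc// mE.
have [m [mE mG_]] := ex_exp_measure phi x.
have tm z : - x <= z -> tail m z = expR (alpha * phi) * expR (- alpha * z).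
  by move=> xz; rewrite /tail mE// exp_density_tail.
have tn n z : tail (mn n) z = f (Num.max (u n + (z - phi)) x0) / f (u n).
  rewrite {1}/tail; have [q qE ->//] := mnE n; rewrite intc//.
  rewrite [X in (_ * X)%E](_ : _ = (tail Pi (u n + (z - phi)))%:E).
    by rewrite PiE -EFinM /= mulrC.
  rewrite -tailE qE; congr (Pi _); apply/seteqP; split => y;
    rewrite /preimage/= !in_itv/= !andbT /sh; lra.
have mI : measurable `](- x)%R, +oo[%classic by exact: measurable_itv.
have intmE : (\int[m]_(z in `](- x)%R, +oo[) (G z)%:E =
    \int[leb]_(z in `](- x)%R, +oo[) (G z * (alpha * expR (alpha * phi) * expR (- alpha * z)))%:E)%E.
  have e : (\int[leb]_(z in `](- x)%R, +oo[) ((G z)%:E * (exp_density phi x z)%:E) =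
      \int[leb]_(z in `](- x)%R, +oo[) (G z * (alpha * expR (alpha * phi) * expR (- alpha * z)))%:E)%E.
    apply: eq_integral => z /[!inE] xz; rewrite -EFinM; congr EFin.
    by rewrite /exp_density indicE mem_set// mulr1.
  by rewrite -e; exact: mG_ GM.
have intnE n : (\int[mn n]_(z in `](- x)%R, +oo[) (G z)%:E =
    \int[Pi]_(y in `](u n - x - phi)%R, +oo[) (G (phi + y - u n) / f (u n))%:E)%E.
  have [q qE mnq] := mnE n.
  rewrite (@integral_density _ _ _ q (mn n) (cst (f (u n))^-1)) //.
  - transitivity (\int[image_measure Pi (msh n)]_(z in `](- x)%R, +oo[) (G z * (f (u n))^-1)%:E)%E.
      by apply: eq_measure_integral => A mA _; exact: qE.
    rewrite integral_image_measure_in//; last first.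
      apply/measurable_EFinP/measurable_funM => //.
      exact: measurable_funTS.
    rewrite (_ : sh n @^-1` _ = `]u n - x - phi, +oo[%classic)//.
    apply/seteqP; split => y; rewrite /preimage/= !in_itv/= !andbT /sh; lra.
  - by move=> z; rewrite invr_ge0 ltW.
  - apply: (@bounded_integrable _ _ _ _ _ _ M) => //.
      exact: (finite_measure_lty (mn n) mI).
    exact: measurable_funTS.
rewrite -intmE; under eq_fun do rewrite -intnE.
apply: (weak_cvg mG GM).
- move=> z xz; rewrite tm// -expRD.
  rewrite (_ : alpha * phi + - alpha * z = - alpha * (z - phi)); last by ring.
  have hn : {near \oo, (fun n => f (u n + (z - phi)) / f (u n)) =1 (fun n => tail (mn n) z)}.
    have [N _ hN] := (cvgryPge u).1 u_oo (x0 - (z - phi)).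
    exists N => // n /= Nn; rewrite tn max_l//.
    by have := hN n Nn; rewrite /=; lra.
  move/near_eq_cvg : hn => hn; apply: cvg_trans hn _.
  exact: (cvg_tail_ratio f_ratio u_oo).
- move=> z y xz zy; rewrite !tm ?(le_trans xz) ?(ltW zy)//.
  by rewrite ltr_pM2l ?expR_gt0// ltr_expR !mulNr ltrN2 ltr_pM2l.
- have [N [mN N0 Nd]] := G_cont; exists N; split => //.
    rewrite mE//; apply: null_set_integral => //.
    by apply/measurable_EFinP/measurable_funTS; exact: measurable_exp_density.
  by move=> z [_ nc]; exact: Nd.
Qed.

End overshoot.

(** * Passing to the limit under a product measure *)

Section sections_cvg.
Context d (S : measurableType d) (R : realType).
Variables (m : {sigma_finite_measure set S -> \bar R}) (Pi : {finite_measure set R -> \bar R}).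
Variables (A : set S) (E : nat -> set (S * R)) (q : nat -> S * R -> R) (L : S -> \bar R) (C : R).
Hypotheses (mA : measurable A) (Afin : (m A < +oo)%E) (mE : forall n, measurable (E n)).
Hypotheses (mq : forall n, measurable_fun setT (q n)) (EA : forall n p, E n p -> A p.1).
Hypothesis qC : forall n s, A s ->
  (\int[Pi]_y `|(q n \_ (E n)) (s, y)|%:E <= C%:E)%E.
Hypothesis mL : measurable_fun setT L.
Hypothesis qL : {ae m, forall s, A s ->
  (\int[Pi]_y ((q n \_ (E n)) (s, y))%:E @[n --> \oo] --> L s)%E}.

Let F n s := (\int[Pi]_y ((q n \_ (E n)) (s, y))%:E)%E.

Let mqE n : measurable_fun setT (EFin \o (q n \_ (E n))).
Proof.
apply/measurable_EFinP; apply/(measurable_restrictT _ (mE n)).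
exact: measurable_funTS.
Qed.

Let mF n : measurable_fun setT (F n).
Proof. exact: (measurable_fun_integral_snd Pi (mqE n)). Qed.

Let F_abs n s : A s -> (`|F n s| <= C%:E)%E.
Proof.
move=> As; apply: le_trans (qC n As); apply: le_abse_integral => //.
exact: (measurableT_comp (mqE n) (measurable_pair1 s)).
Qed.

Let F_out n s : ~ A s -> F n s = 0%E.
Proof.
move=> nAs; apply: integral0_eq => y _; rewrite patchE; case: ifPn => // /set_mem /EA.
by [].
Qed.

Lemma sections_integrable n : (m \x Pi)%E.-integrable (E n) (EFin \o q n).
Proof.
(* If [A] is empty nothing forces [0 <= C], and the integral is 0. *)
have C0 : (0 <= C%:E)%E \/ (forall s, ~ A s).
  have [[s As]|nA] := pselect (exists s, A s); last by right=> s As; apply: nA; exists s.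
  by left; apply: le_trans (qC n As); apply: integral_ge0 => y _; rewrite lee_fin.
apply/(integrable_mkcond _ (mE n)).
rewrite (_ : _ \_ _ = EFin \o (q n \_ (E n))); last by rewrite restrict_EFin.
apply/(integrable12ltyP m Pi (@mqE n)).
apply: (@le_lt_trans _ _ (\int[m]_s ((cst C%:E) \_ A) s)%E).
  apply: ge0_le_integral => //.
  - by move=> s _; exact: integral_ge0.
  - apply: (@measurable_fun_integral_snd _ _ _ _ _ Pi (fun z => `|(EFin \o (q n \_ (E n))) z|%E)).
    exact: measurableT_comp.
  - by apply/(measurable_restrictT _ mA).
  - move=> s _; rewrite patchE; case: ifPn => [/set_mem As|/negP nAs].
      exact: qC.
    rewrite integral0_eq// => y _; rewrite /= patchE; case: ifPn; rewrite ?normr0//.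
    by move=> /set_mem/EA/mem_set.
rewrite -integral_mkcond integral_cst//; case: C0 => [C0|nA].
  by rewrite lte_mul_pinfty.
by rewrite (_ : A = set0) ?measure0 ?mule0// -subset0 => s /nA.
Qed.

(** Fubini reduces the claim to sections over [A], a set of finite measure, where they are bounded
    by [C] and converge almost everywhere. *)
Lemma sections_cvg :
  (\int[(m \x Pi)]_(p in E n) (q n p)%:E @[n --> \oo] --> \int[m]_(s in A) L s)%E.
Proof.
have FE n : (\int[(m \x Pi)]_(p in E n) (q n p)%:E = \int[m]_(s in A) (fine (F n s))%:E)%E.
  have := sections_integrable n => /(integrable_mkcond _ (mE n)) iq.
  rewrite integral_mkcond -(@integral12_prod_meas1 _ _ _ _ _ m Pi _ iq) [RHS]integral_mkcond.
  apply: eq_integral => s _; rewrite patchE; case: ifPn => [/set_mem As|/negP nAs].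
    rewrite fineK; first by apply: eq_integral => y _; rewrite !patchE; case: ifP.
    by rewrite fin_num_abs (le_lt_trans (F_abs n As))// ltry.
  transitivity (F n s); last by apply: F_out => As; apply/nAs/mem_set.
  by apply: eq_integral => y _; rewrite !patchE; case: ifP.
have L_abs : {ae m, forall s, A s -> (`|L s| <= C%:E)%E}.
  apply: filterS qL => s sL As; have := cvge_to_le (cvg_abse (sL As)); apply.
  by apply: nearW => n; exact: F_abs.
have LE : (\int[m]_(s in A) L s = \int[m]_(s in A) (fine (L s))%:E)%E.
  apply: ae_eq_integral => //.
  - exact: measurable_funTS.
  - by apply/measurable_EFinP/measurable_funTS/measurableT_comp.
  - apply: filterS L_abs => s sL As; rewrite fineK//.
    by rewrite fin_num_abs (le_lt_trans (sL As))// ltry.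
rewrite LE; under eq_fun do rewrite FE.
apply: (@ae_bounded_convergence _ _ _ _ _ _ _ C) => //.
- by move=> n; apply/measurable_funTS/measurableT_comp.
- by apply/measurable_funTS/measurableT_comp.
- move=> n s As; have Ffin : F n s \is a fin_num.
    by rewrite fin_num_abs (le_lt_trans (F_abs n As))// ltry.
  by move: (F_abs n As); rewrite -{1}(fineK Ffin) /= lee_fin.
- apply: filterS2 qL L_abs => s sL sA As.
  have Lfin : L s \is a fin_num.
    by rewrite fin_num_abs (le_lt_trans (sA As))// ltry.
  by have := sL As; rewrite -(fineK Lfin) => /fine_cvgP[].
Qed.

End sections_cvg.

(** * Limits of the crossing and touching integrals *)

Section jump_limits.
Context d (S : measurableType d) (R : realType).
Variables (f : R -> R) (alpha x0 : R) (Pi : {finite_measure set R -> \bar R}).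
Hypotheses (alpha0 : 0 < alpha) (f_gt0 : forall u, x0 <= u -> 0 < f u).
Hypothesis f_le : forall u v, x0 <= u -> u <= v -> f v <= f u.
Hypothesis f_ratio : forall y, f (u + y) / f u @[u --> +oo] --> expR (- alpha * y).
Hypothesis PiE : forall y, tail Pi y = f (Num.max y x0).
Variables (m : {sigma_finite_measure set S -> \bar R}) (A : set S) (phi : S -> R).
Variables (g M x K : R).
Hypotheses (mA : measurable A) (Afin : (m A < +oo)%E) (mphi : measurable_fun setT phi).
Hypotheses (gE : 0 <= g < alpha) (M0 : 0 <= M) (xpos : 0 <= x).
Hypothesis phiK : forall s, A s -> phi s <= K.
Local Notation leb := (@lebesgue_measure R).

Let weight s := M * expR (g * neg_part (phi s)).

(** The level is lowered from [u - x] to [u - (x + 1)], so that the open ray also contains the jump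
    that lands exactly on the level and one bound serves both crossing and touching. *)
Lemma section_bound : exists U C : R, (forall u, U <= u -> x0 <= u) /\
  forall u s (E : set (S * R)) (q : S * R -> R), U <= u -> A s ->
    measurable E -> measurable_fun setT q ->
    (forall y, E (s, y) -> u - (x + 1) - phi s < y) ->
    (forall y, `|q (s, y)| <= weight s / f u) ->
    (\int[Pi]_y `|(q \_ E) (s, y)|%:E <= C%:E)%E.
Proof.
have [U [C [C0 Ux Uf]]] := tail_domination f_gt0 f_le f_ratio K gE (addr_ge0 xpos ler01).
exists (Num.max U x0), (M * C); split; first by move=> u; rewrite ge_max => /andP[].
move=> u s E q; rewrite ge_max => /andP[Uu x0u] As mE mq Ey qw.
have w0 : 0 <= weight s / f u by rewrite !mulr_ge0 ?expR_ge0 ?invr_ge0 ?(ltW (f_gt0 x0u)).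
have mI : measurable `](u - (x + 1) - phi s), +oo[%classic by exact: measurable_itv.
apply: (@le_trans _ _ (\int[Pi]_y ((weight s / f u)%:E * (\1_(`](u - (x + 1) - phi s), +oo[%classic) y)%:E))%E).
  apply: ge0_le_integral => //.
  - apply/measurable_EFinP/measurableT_comp => //.
    suff : measurable_fun setT ((q \_ E) \o (pair s)) by [].
    apply: measurableT_comp; last exact: measurable_pair1.
    by apply/(measurable_restrictT _ mE); exact: measurable_funTS.
  - by apply: measurable_funeM; exact/measurable_EFinP/measurable_indic.
  - move=> y _; rewrite -EFinM lee_fin patchE; case: ifPn => [/set_mem /Ey uy|_].
      by rewrite indicE mem_set ?mulr1 ?qw//= in_itv/= andbT.
    by rewrite normr0 mulr_ge0.
rewrite ge0_integralZl//; last exact/measurable_EFinP/measurable_indic.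
have -> : (\int[Pi]_y (\1_(`](u - (x + 1) - phi s), +oo[%classic) y)%:E =
    (tail Pi (u - (x + 1) - phi s))%:E)%E.
  by rewrite integral_indic// setIT; exact: (tailE Pi (u - (x + 1) - phi s)).
rewrite PiE max_l; last first.
  by have := Ux _ Uu; have := phiK As; lra.
rewrite -EFinM lee_fin /weight -!mulrA ler_wpM2l// mulrCA mulrC -ler_pdivlMr; last first.
  by rewrite invr_gt0 f_gt0.
by rewrite invrK; apply: Uf => //; exact: phiK.
Qed.

Section crossing_limit.
Variables (Gs : S -> R -> R) (B : R -> set S).
Hypothesis mG : measurable_fun setT (fun p : S * R => Gs p.1 p.2).
Hypothesis GM : forall s z, `|Gs s z| <= weight s.
Hypothesis Gcont : forall s, leb.-negligible [set z | ~ (Gs s y @[y --> z] --> Gs s z)].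
Hypothesis mB : forall u, measurable (B u).
Hypothesis AeB : {ae m, forall s, A s -> forall u : nat -> R,
  u n @[n --> \oo] --> +oo -> \forall n \near \oo, B (u n) s}.

Definition over_level (u : R) : set (S * R) :=
  [set p | [/\ A p.1, B u p.1 & u - x < phi p.1 + p.2]].

Let mphi1 : measurable_fun setT (fun p : S * R => phi p.1).
Proof. exact: measurableT_comp. Qed.

Lemma measurable_over_level u : measurable (over_level u).
Proof.
rewrite (_ : over_level u = (A `*` setT) `&` (B u `*` setT) `&` [set p | u - x < phi p.1 + p.2]).
  apply: measurableI; first by apply: measurableI; exact: measurableX.
  by apply: measurable_ltr_set => //; exact: measurable_funD.
by apply/seteqP; split => p /=; [move=> [? ? ?]|move=> [[[? _] [? _]] ?]].
Qed.

(** [B u] stands for the path having stayed below the level. By [AeB] almost every section is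
    eventually free of this constraint, and [overshoot_cvg] gives its limit under the domination of
    [section_bound]. *)
Lemma crossing_limit : exists U : R, forall u : nat -> R, (forall n, U <= u n) ->
  u n @[n --> \oo] --> +oo ->
  (forall n, (m \x Pi)%E.-integrable (over_level (u n))
    (fun p => (Gs p.1 (phi p.1 + p.2 - u n) / f (u n))%:E)) /\
  (\int[m \x Pi]_(p in over_level (u n)) (Gs p.1 (phi p.1 + p.2 - u n) / f (u n))%:E
     @[n --> \oo] -->
   \int[m]_(s in A) \int[leb]_(z in `](- x)%R, +oo[)
     (Gs s z * (alpha * expR (alpha * phi s) * expR (- alpha * z)))%:E)%E.
Proof.
have [U [C [Ux UC]]] := section_bound.
exists U => u Uu u_oo.
pose q n (p : S * R) := Gs p.1 (phi p.1 + p.2 - u n) / f (u n).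
have mq n : measurable_fun setT (q n).
  apply: measurable_funM => //.
  apply: (measurableT_comp mG (_ : measurable_fun setT (fun p : S * R => (p.1, phi p.1 + p.2 - u n)))).
  apply: measurable_fun_pair => //; apply: measurable_funB => //.
  exact: measurable_funD.
have mE n : measurable (over_level (u n)) by exact: measurable_over_level.
have EA n p : over_level (u n) p -> A p.1 by case.
have qC n s : A s -> (\int[Pi]_y `|(q n \_ (over_level (u n))) (s, y)|%:E <= C%:E)%E.
  move=> As; apply: (UC (u n)) => //.
    by move=> y [_ _ /=]; lra.
  have fn : 0 <= (f (u n))^-1 by rewrite invr_ge0 ltW// f_gt0// Ux.
  by move=> y; rewrite /q/= normrM (ger0_norm fn); exact: ler_wpM2r.
pose L s := (\int[leb]_(z in `](- x)%R, +oo[)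
     (Gs s z * (alpha * expR (alpha * phi s) * expR (- alpha * z)))%:E)%E.
have mL : measurable_fun setT L.
  rewrite /L; under eq_fun do rewrite integral_mkcond.
  pose h (p : S * measurableTypeR R) := ((Gs p.1 p.2 * (alpha * expR (alpha * phi p.1) *
    expR (- alpha * p.2))) * \1_(`](- x)%R, +oo[%classic) p.2)%:E.
  have mh : measurable_fun setT h.
    apply/measurable_EFinP/measurable_funM; last first.
      exact: (measurableT_comp (measurable_indic _)).
    apply: measurable_funM; first exact: mG.
    apply: measurable_funM; last first.
      exact: (measurableT_comp (@measurable_exp_scale R alpha)).
    apply: measurable_funM => //; apply: measurableT_comp => //.
    by apply: measurable_funM => //; exact: measurableT_comp.
  have := measurable_fun_integral_snd leb mh; apply: eq_measurable_fun => s _.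
  apply: eq_integral => z _; rewrite /h patchE indicE.
  by case: ifP => _; rewrite ?mulr1 ?mulr0.
have qL : {ae m, forall s, A s ->
    (\int[Pi]_y ((q n \_ (over_level (u n))) (s, y))%:E @[n --> \oo] --> L s)%E}.
  apply: filterS AeB => s sB As; have {}sB := sB As u u_oo.
  have := overshoot_cvg alpha0 f_gt0 f_ratio PiE (phi := phi s) (x := x)
    (fun n => Ux _ (Uu n)) u_oo (measurableT_comp mG (measurable_pair1 s)) (GM s) (Gcont s).
  suff hn : {near \oo, (fun n => \int[Pi]_(y in `](u n - x - phi s)%R, +oo[)
      (Gs s (phi s + y - u n) / f (u n))%:E)%E =1
      (fun n => \int[Pi]_y ((q n \_ (over_level (u n))) (s, y))%:E)%E}.
    by move/near_eq_cvg : hn => hn; apply: cvg_trans hn.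
  apply: filterS sB => n sB; rewrite integral_mkcond; apply: eq_integral => y _.
  rewrite !patchE; have [yI|yI] := boolP (y \in _).
    rewrite mem_set//; split => //=.
    by move: yI; rewrite inE/= in_itv/= andbT; lra.
  rewrite memNset// => -[_ _ /= h]; move/negP: yI; apply.
  by rewrite inE/= in_itv/= andbT; lra.
split; first by move=> n; exact: (sections_integrable mA Afin mE mq EA qC).
exact: (sections_cvg mA Afin mE mq EA qC mL qL).
Qed.

End crossing_limit.

Section touching_limit.

Definition at_level (u : R) : set (S * R) := [set p | A p.1 /\ u - x = phi p.1 + p.2].

Lemma measurable_at_level u : measurable (at_level u).
Proof.
rewrite (_ : at_level u = (A `*` setT) `&` [set p | u - x = phi p.1 + p.2]).
  apply: measurableI; first exact: measurableX.
  apply: measurable_eqr_set => //; apply: measurable_funD => //.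
  exact: measurableT_comp.
by apply/seteqP; split => p /=; [move=> [? ?]|move=> [[? _] ?]].
Qed.

(** For [b < c] the atom at [u + c] is at most [f (u + b) - f (u + c)]. The normalized limit of this
    difference is small when [b] is close to [c], the limiting tail being continuous. *)
Let atom_cvg (u : nat -> R) (c : R) : (forall n, x0 <= u n) ->
  u n @[n --> \oo] --> +oo ->
  fine (Pi [set u n + c]) / f (u n) @[n --> \oo] --> (0 : R).
Proof.
move=> ux u_oo; apply/cvgrPdist_le => e e0.
have /cvgrPdist_lt/(_ e e0)[dl /= dl0 hd] := @continuous_exp_scale R alpha c.
pose b := c - dl / 2.
have be : expR (- alpha * b) - expR (- alpha * c) < e.
  apply: le_lt_trans (ler_norm _) _; rewrite distrC; apply: hd.
  by rewrite /= /b opprB addrCA subrr addr0 ger0_norm ?ltr_pdivrMr//; lra.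
have cv : (f (u n + b) / f (u n) - f (u n + c) / f (u n)) @[n --> \oo] -->
    expR (- alpha * b) - expR (- alpha * c).
  by apply: cvgB; exact: cvg_tail_ratio.
have [N1 _ hN1] := cvgr_le _ cv _ be.
have [N2 _ hN2] := (cvgryPge u).1 u_oo (x0 - b).
exists (maxn N1 N2) => // n /=; rewrite geq_max => /andP[n1 n2].
have fn : 0 <= (f (u n))^-1 by rewrite invr_ge0 ltW// f_gt0.
have bx : x0 <= u n + b by have := hN2 n n2; rewrite /=; lra.
have bc : b < c by rewrite /b; lra.
rewrite sub0r normrN ger0_norm ?mulr_ge0 ?fine_ge0//.
apply: le_trans (hN1 n n1) => /=; rewrite -mulrBl; apply: ler_wpM2r => //.
have -> : f (u n + b) = tail Pi (u n + b) by rewrite PiE max_l.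
have -> : f (u n + c) = tail Pi (u n + c) by rewrite PiE max_l//; lra.
have m1 : measurable [set u n + c] by exact: measurable_set1.
have mI : measurable `](u n + c), +oo[%classic by exact: measurable_itv.
have fin1 : Pi [set u n + c] = (fine (Pi [set u n + c]))%:E.
  by rewrite fineK// fin_num_measure.
rewrite lerBrDr -lee_fin EFinD -fin1 -!tailE -measureU//; last first.
  apply/seteqP; split => // y [/= ->]; rewrite in_itv/= andbT ltxx//.
apply: le_measure; rewrite ?inE//; first exact: measurableU.
by move=> y [/= ->|]; rewrite /= !in_itv/= !andbT; lra.
Qed.

(** The section over [s] is the single value [u - x - phi s], whose normalized mass vanishes by
    [atom_cvg]. *)
Lemma touching_limit : exists U : R, forall u : nat -> R, (forall n, U <= u n) ->
  u n @[n --> \oo] --> +oo ->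
  (forall n, (m \x Pi)%E.-integrable (at_level (u n)) (fun p => (weight p.1 / f (u n))%:E)) /\
  (\int[m \x Pi]_(p in at_level (u n)) (weight p.1 / f (u n))%:E @[n --> \oo] --> 0)%E.
Proof.
have [U [C [Ux UC]]] := section_bound.
exists U => u Uu u_oo.
have fn n : 0 <= (f (u n))^-1 by rewrite invr_ge0 ltW// f_gt0// Ux.
have w0 s : 0 <= weight s by rewrite mulr_ge0 ?expR_ge0.
pose q n (p : S * R) := weight p.1 / f (u n).
have mw : measurable_fun setT weight.
  apply: measurable_funM => //; apply: measurableT_comp => //.
  apply: measurable_funM => //; apply: measurable_maxr => //.
  exact: measurableT_comp.
have mq n : measurable_fun setT (q n).
  by apply: measurable_funM => //; exact: measurableT_comp.
have mE n : measurable (at_level (u n)) by exact: measurable_at_level.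
have EA n p : at_level (u n) p -> A p.1 by case.
have qC n s : A s -> (\int[Pi]_y `|(q n \_ (at_level (u n))) (s, y)|%:E <= C%:E)%E.
  move=> As; apply: (UC (u n)) => //.
    by move=> y [_ /=]; lra.
  by move=> y; rewrite /q/= ger0_norm// mulr_ge0.
have qL : {ae m, forall s, A s ->
    (\int[Pi]_y ((q n \_ (at_level (u n))) (s, y))%:E @[n --> \oo] --> cst 0 s)%E}.
  apply: aeW => s As; pose c := - x - phi s.
  have e n : (\int[Pi]_y ((q n \_ (at_level (u n))) (s, y))%:E =
      (weight s * (fine (Pi [set u n + c]) / f (u n)))%:E)%E.
    have m1 : measurable [set u n + c] by exact: measurable_set1.
    transitivity (\int[Pi]_y ((weight s / f (u n))%:E * (\1_[set u n + c] y)%:E))%E.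
      apply: eq_integral => y _; rewrite patchE indicE -EFinM.
      have [[-> _]|ne] := pselect (y = u n + c /\ True).
        by rewrite !mem_set ?mulr1//=; split => //=; rewrite /c; lra.
      rewrite !memNset ?mulr0//=; first by move=> yE; apply: ne.
      by move=> [_ /= h]; apply: ne; split => //; rewrite /c; lra.
    rewrite ge0_integralZl//; last 2 first.
    - exact/measurable_EFinP/measurable_indic.
    - by rewrite lee_fin mulr_ge0.
    have -> : (\int[Pi]_y (\1_[set u n + c] y)%:E = (fine (Pi [set u n + c]))%:E)%E.
      by rewrite integral_indic// setIT; apply/esym/fineK/(fin_num_measure Pi _ m1).
    by rewrite -EFinM -mulrA [_^-1 * _]mulrC.
  under eq_fun do rewrite e.
  apply: cvg_EFin; first exact: nearW.
  rewrite /comp /= -[X in _ --> X](mulr0 (weight s)).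
  by apply: cvgMr; apply: atom_cvg => // n; exact: Ux.
split; first by move=> n; exact: (sections_integrable mA Afin mE mq EA qC).
have := sections_cvg mA Afin mE mq EA qC (measurable_cst _) qL.
by rewrite integral0.
Qed.

End touching_limit.
End jump_limits.

(** * The path after the hitting time and the kernel of [H] *)

Section overshoot_path.
Variable R : realType.
Implicit Types (w : D R) (z u T x : R).

Lemma shift_subE w h u : Om w -> 0 <= h ->
  toD (shift_sub w h%:E u) = addD (pval w h - u) (thetaD h w).
Proof.
move=> [aw w0] h0; rewrite /addD {1}/shiftD; congr toD; apply/funext => s.
rewrite maxxx /shift_sub; have [//|s0] := ltP s 0.
rewrite /thetaD shiftDE// /shift_sub add0r ltNge s0/=.
by case: (dval w (h + s)) => //= a; congr Some; lra.
Qed.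

(** [tau] ignores time 0. When the path exceeds [u] already at time [h], right-continuity provides a
    positive time at which the shifted path is above 0. *)
Lemma tau_shift_sub w z u T : Om w -> 0 <= z -> z <= u -> 0 < T ->
  forall h, tau z w = h%:E -> 0 < h ->
  (tau u w - h%:E < T%:E)%E = (tau 0 (toD (shift_sub w h%:E u)) < T%:E)%E.
Proof.
move=> Ow z0 zu T0 h hE h0; have [aw w0] := Ow.
have cw : cadlag (shift_sub w h%:E u) by apply: cadlag_shift_sub; [exact: dcadlag|exact: ltW].
rewrite toDE//.
have shE s : 0 < s -> (exists a, shift_sub w h%:E u s = Some a /\ 0 < a) <-> u < pval w (h + s).
  move=> s0; rewrite /shift_sub ltNge (ltW s0)/= alive_pval//=; last by lra.
  by split => [[a [[<-]]]|us]; [lra|exists (pval w (h + s) - u); split => //; lra].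
apply/idP/idP.
- rewrite lteBlDr// => /ereal_inf_lt[_ [t [t0 [a [wt ua]]] <-]].
  have pt : u < pval w t by rewrite /pval wt.
  rewrite -EFinD lte_fin => tT.
  have ht : h <= t.
    by rewrite leNgt; apply/negP => /(tau_before Ow z0 hE (ltW t0)); lra.
  suff [s [s0 sT us]] : exists s, [/\ 0 < s, s < T & u < pval w (h + s)].
    apply: (@le_lt_trans _ _ s%:E); last by rewrite lte_fin.
    by apply: ereal_inf_lbound; exists s => //; split => //; apply/shE.
  move: ht; rewrite le_eqVlt => /predU1P[hteq|ht]; last first.
    by exists (t - h); split; [lra|lra|rewrite addrC subrK].
  have [_ rc _] := dcadlag w; have := rc t (ltW t0).
  rewrite /right_cont (alive_pval aw (ltW t0)) => /(_ (pval w t - u) ltac:(lra))[dl [dl0 hd]].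
  (* [dl / 2] keeps the path above [u], and [T / 2] keeps [s] below [T]. *)
  pose s := Num.min (dl / 2) (T / 2).
  have s0 : 0 < s by rewrite lt_min !divr_gt0.
  have [s1 s2] : s <= dl / 2 /\ s <= T / 2 by rewrite /s !ge_min !lexx orbT.
  exists s; split => //; first lra.
  have [b [wb]] := hd (h + s) ltac:(lra).
  by rewrite ltr_norml /pval wb/= => /andP[]; rewrite /pval; lra.
- move=> /ereal_inf_lt[_ [s [s0 /(shE _ s0) us] <-]]; rewrite lte_fin => sT.
  rewrite lteBlDr//; apply: (@le_lt_trans _ _ (h + s)%:E).
    apply: ereal_inf_lbound; exists (h + s) => //; split; first lra.
    by exists (pval w (h + s)); split => //; rewrite -alive_pval//; lra.
  by rewrite -EFinD lte_fin addrC ltrD2r.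
Qed.

End overshoot_path.

Section hit_decomposition.
Variables (R : realType) (P : R -> probability (D R) R).
Hypothesis levyP : levy_family P.
Variables (H : D R -> D R -> R) (T x K : R).
Hypotheses (T0 : 0 < T) (xpos : 0 <= x).

(** [H] with the indicator that defines the class [H_T]; evaluated at the shifted path, this
    indicator is the condition that [tau u - tau (u - x)] is less than [T]. *)
Definition stopped (w w' : D R) : R := H w w' * ind R (tau 0 w' < T%:E)%E.

Lemma lhs_num_hit u : 0 < u - x -> lhs_num P H T x K u =
  (\int[P 0]_(w in hit_event (u - x) T (last_below K))
    (stopped (pre_hit (u - x) w).1
      (addD (lastv (pre_hit (u - x) w).1 + (pre_hit (u - x) w).2 - u) (post_hit (u - x) w)))%:E)%E.
Proof.
set z := u - x => z0; rewrite /lhs_num [RHS]integral_mkcond.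
apply: (levy_ae_eq_integral levyP) => w /set_mem Ow; have [aw w0] := Ow.
rewrite -/z patchE; have [tT|tT] := boolP (tau z w < T%:E)%E; last first.
  rewrite /ind /= !mulr0 mul0r memNset// => -[[_ h] _].
  by rewrite h in tT.
have hE := hit_finite tT; have h0 := hit_gt0 z0 Ow tT.
have ll := alive_left_conv (dcadlag w) aw h0.
rewrite hE (_ : leftlim_at w (hit z w)%:E = Some (llim w (hit z w))); last exact: left_conv_leftlim.
have lv : lastv (killD (hit z w) w) = llim w (hit z w) by exact: lastv_killD.
rewrite [ind R true]/ind mulr1.
have [lK|lK] := ltP (llim w (hit z w)) K; last first.
  rewrite mulr0 mul0r memNset// => -[_]; rewrite /last_below /pre_hit /= lv.
  by rewrite ltNge lK.
rewrite mulr1 mem_set; last by split=> //; rewrite /last_below /pre_hit /= lv.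
rewrite (tau_shift_sub Ow (ltW z0) _ T0 hE h0); last by rewrite /z lerBlDr lerDl.
rewrite /stopped /pre_hit /post_hit /= lv /jump [llim _ _ + _]addrC subrK.
by rewrite -shift_subE//; exact: ltW.
Qed.

End hit_decomposition.

Section overshoot_kernel.
Variables (R : realType) (P : R -> probability (D R) R).
Hypothesis levyP : levy_family P.
Variables (H : D R -> D R -> R) (T g M : R).
Hypotheses (g0 : 0 <= g).
Local Notation h := (stopped H T).
Hypothesis mh : measurable_fun setT (fun p : D R * D R => h p.1 p.2).
Hypothesis hM : forall w w', `|h w w' * expfac g w| <= M.
Hypothesis h_cont : forall w, (@lebesgue_measure R).-negligible
  [set z | ~ (fine (\int[P y]_w' (h w w' * ind R (tau 0%R w' < +oo)%E)%:E)%E @[y --> z] -->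
              fine (\int[P z]_w' (h w w' * ind R (tau 0%R w' < +oo)%E)%:E)%E)].

(** Where the left limit at death is undefined, [expfac] is 1 and the bound still holds; [lastv],
    total and measurable, takes its place from here on. *)
Lemma expfac_ge w : expR (- (g * neg_part (lastv w))) <= expfac g w.
Proof.
have npos : 0 <= g * neg_part (lastv w) by rewrite mulr_ge0// le_max lexx.
have h1 : expR (- (g * neg_part (lastv w))) <= 1 by rewrite -expR0 ler_expR oppr_le0.
rewrite /expfac; case E : leftlim_at => [v|//].
suff vE : v = lastv w.
  rewrite -vE; case: ifPn => v0; last first.
    by apply: le_trans h1; rewrite vE.
  by rewrite /neg_part max_r ?oppr_ge0// mulrN opprK.
move: E; rewrite /leftlim_at /lastv; case: (tauD w) => //= t.
have [[l ll]|nl] := pselect (exists l, left_conv w t l); last first.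
  by rewrite /leftlim; case: pselect.
by rewrite (left_conv_leftlim ll) => -[<-]; rewrite (left_conv_llim ll).
Qed.

Lemma stopped_bound w w' : `|h w w'| <= M * expR (g * neg_part (lastv w)).
Proof.
have e0 : 0 <= expfac g w by exact: le_trans (expR_ge0 _) (expfac_ge w).
have := hM w w'; rewrite normrM (ger0_norm e0).
move=> hle; rewrite -ler_pdivrMr ?expR_gt0// -expRN.
by apply: le_trans hle; apply: ler_wpM2l => //; exact: expfac_ge.
Qed.

Lemma bound_ge0 : 0 <= M.
Proof. exact: le_trans (normr_ge0 _) (hM (dead_path R) (dead_path R)). Qed.

(** The expectation started from [y], written under the single law [P 0] with a translated path;
    this gives joint measurability in [w] and [y]. *)
Definition overshoot_kernel w y : R := fine (\int[P 0]_w' (h w (addD y w'))%:E)%E.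

Let mha : measurable_fun setT (fun p : (D R * R) * D R => h p.1.1 (addD p.1.2 p.2)).
Proof.
apply: (measurableT_comp mh (_ : measurable_fun setT (fun p : (D R * R) * D R => (p.1.1, addD p.1.2 p.2)))).
apply: measurable_fun_pair; first exact: measurableT_comp.
apply: (measurableT_comp (@measurable_addD R)
  (_ : measurable_fun setT (fun p : (D R * R) * D R => (p.1.2, p.2)))).
by apply: measurable_fun_pair => //; exact: measurableT_comp.
Qed.

Lemma overshoot_kernel_integrable w y :
  (P 0).-integrable setT (fun w' => (h w (addD y w'))%:E).
Proof.
apply: (@bounded_integrable _ _ _ _ _ _ (M * expR (g * neg_part (lastv w)))) => //.
- exact: (finite_measure_lty (P 0) measurableT).
- exact: (measurableT_comp mha (measurable_pair1 (w, y))).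
- by move=> w' _; exact: stopped_bound.
Qed.

Lemma overshoot_kernelE w y :
  (\int[P 0]_w' (h w (addD y w'))%:E = (overshoot_kernel w y)%:E)%E.
Proof. by rewrite fineK//; exact: integrable_fin_num (overshoot_kernel_integrable w y). Qed.

Lemma overshoot_kernel_bound w y :
  `|overshoot_kernel w y| <= M * expR (g * neg_part (lastv w)).
Proof.
rewrite -lee_fin.
have -> : (`|overshoot_kernel w y|%:E = `| \int[P 0]_w' (h w (addD y w'))%:E |)%E.
  by rewrite overshoot_kernelE.
apply: le_trans (le_abse_integral _ measurableT _) _.
  exact: measurable_int (overshoot_kernel_integrable w y).
apply: (@le_trans _ _ (\int[P 0]_w' (cst (M * expR (g * neg_part (lastv w)))%:E w'))%E).
  apply: ge0_le_integral => //.
    by apply: measurableT_comp => //; exact: measurable_int (overshoot_kernel_integrable w y).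
  by move=> w' _; rewrite /= lee_fin; exact: stopped_bound.
rewrite integral_cst// -[leRHS]mule1 le_eqVlt; apply/orP; left; apply/eqP.
by congr (_ * _)%E; exact: probability_setT.
Qed.

Lemma measurable_overshoot_kernel :
  measurable_fun setT (fun p : D R * R => overshoot_kernel p.1 p.2).
Proof.
apply: measurableT_comp => //.
have mEh : measurable_fun setT (EFin \o (fun p : (D R * R) * D R => h p.1.1 (addD p.1.2 p.2))).
  exact/measurable_EFinP.
exact: (measurable_fun_integral_snd (P 0) mEh).
Qed.

Lemma levy_start_integral z (F : D R -> \bar R) : measurable_fun setT F ->
  (\int[P z]_w F w = \int[P 0]_w F (addD z w))%E.
Proof.
move=> mF; rewrite -(integral_image_measure (P 0) (measurable_addDz z) mF).
by apply: eq_measure_integral => A mA _; exact: levy_start.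
Qed.

Lemma overshoot_kernel_start w z :
  (\int[P z]_w' (h w w')%:E = (overshoot_kernel w z)%:E)%E.
Proof.
rewrite levy_start_integral ?overshoot_kernelE//.
by apply/measurable_EFinP; exact: (measurableT_comp mh (measurable_pair1 w)).
Qed.

Lemma overshoot_kernel_cont w : (@lebesgue_measure R).-negligible
  [set z | ~ (overshoot_kernel w y @[y --> z] --> overshoot_kernel w z)].
Proof.
(* The indicator of [tau < +oo] is absorbed by that of [tau < T] inside [stopped]. *)
have e z : fine (\int[P z]_w' (h w w' * ind R (tau 0%R w' < +oo)%E)%:E)%E = overshoot_kernel w z.
  rewrite -[RHS]/(fine (overshoot_kernel w z)%:E) -overshoot_kernel_start; congr fine.
  apply: eq_integral => w' _; congr EFin; rewrite /stopped /ind -mulrA.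
  case: ifPn => [tT|_]; last by rewrite mul0r.
  by rewrite (lt_trans tT) ?ltry// mulr1.
by have := h_cont w; under eq_set do (under eq_fun do rewrite e; rewrite e).
Qed.

End overshoot_kernel.

Section sigma_finite_product.
Context d1 d2 (T1 : measurableType d1) (T2 : measurableType d2) (R : realType).
Variables (m1 : {sigma_finite_measure set T1 -> \bar R}).
Variables (m2 : {sigma_finite_measure set T2 -> \bar R}).
Local Open Scope ereal_scope.

(* The instance for finite measures of the library hides the sigma-finite one,
   hence a constant of its own. *)
Definition sigma_finite_prod : set (T1 * T2) -> \bar R := m1 \x m2.

Let prod0 : sigma_finite_prod set0 = 0.
Proof. by rewrite /sigma_finite_prod measure0. Qed.

Let prod_ge0 A : 0 <= sigma_finite_prod A.
Proof. by rewrite /sigma_finite_prod measure_ge0. Qed.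

Let prod_sadd : semi_sigma_additive sigma_finite_prod.
Proof. exact: (@measure_semi_sigma_additive _ _ _ (m1 \x m2)). Qed.

HB.instance Definition _ := isMeasure.Build _ _ _ sigma_finite_prod
  prod0 prod_ge0 prod_sadd.

Let sigma_finite_prod_subproof : sigma_finite setT sigma_finite_prod.
Proof.
have /sigma_finiteP[F [TF ndF Foo]] := sigma_finiteT m1.
have /sigma_finiteP[G [TG ndG Goo]] := sigma_finiteT m2.
exists (fun n => F n `*` G n).
  rewrite -setXTT TF TG predeqE => -[x y]; split.
    move=> [/= [n _ Fnx] [k _ Gky]]; exists (maxn n k) => //; split.
    - by move: x Fnx; exact/subsetPset/ndF/leq_maxl.
    - by move: y Gky; exact/subsetPset/ndG/leq_maxr.
  by move=> [n _ []/= ? ?]; split; exists n.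
move=> k; have [? ?] := Foo k; have [? ?] := Goo k.
split; first exact: measurableX.
by rewrite /sigma_finite_prod product_measure1E// lte_mul_pinfty// ge0_fin_numE.
Qed.

HB.instance Definition _ := Measure_isSigmaFinite.Build _ _ _ sigma_finite_prod
  sigma_finite_prod_subproof.

End sigma_finite_product.

Lemma integral_divr d (S : measurableType d) (R : realType)
    (m : {measure set S -> \bar R}) (E : set S) (q : S -> R) (c : R) :
  measurable E -> 0 < c -> m.-integrable E (fun p => (q p / c)%:E) ->
  m.-integrable E (EFin \o q) /\
  (\int[m]_(p in E) (q p / c)%:E = \int[m]_(p in E) (q p)%:E * (c^-1)%:E)%E.
Proof.
move=> mE c0 iq.
have iq1 : m.-integrable E (EFin \o q).
  have := integrableZr mE c iq; apply: eq_integrable => // p _ /=.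
  by rewrite -EFinM divfK// gt_eqF.
by split => //; rewrite -(integralZr mE iq1); apply: eq_integral => p _; rewrite /= -EFinM.
Qed.

(** * Convergence of the normalized numerator along a sequence of levels *)

Section hit_limit.
Variables (R : realType) (P : R -> probability (D R) R).
Hypothesis levyP : levy_family P.
Variables (H : D R -> D R -> R) (T x K g M alpha x0 : R).
Hypotheses (T0 : 0 < T) (xpos : 0 <= x) (alpha0 : 0 < alpha) (x00 : 0 < x0).
Hypothesis gE : 0 <= g < alpha.
Local Notation h := (stopped H T).
Local Notation f := (fun u => fine (Pibar P u)).
Local Notation leb := (@lebesgue_measure R).
Local Notation G := (overshoot_kernel P H T).
Hypothesis mh : measurable_fun setT (fun p : D R * D R => h p.1 p.2).
Hypothesis hM : forall w w', `|h w w' * expfac g w| <= M.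
Hypothesis h_cont : forall w, (@lebesgue_measure R).-negligible
  [set z | ~ (fine (\int[P y]_w' (h w w' * ind R (tau 0%R w' < +oo)%E)%:E)%E @[y --> z] -->
              fine (\int[P z]_w' (h w w' * ind R (tau 0%R w' < +oo)%E)%:E)%E)].
Hypothesis Pibar_pos : forall u, x0 <= u -> (0 < Pibar P u < +oo)%E.
Hypothesis Pibar_ratio : forall y, f (u + y) / f u @[u --> +oo] --> expR (- alpha * y).

Let g0 : 0 <= g. Proof. by case/andP: gE. Qed.
Let M0 : 0 <= M. Proof. exact: bound_ge0 hM. Qed.

Let f_gt0 u : x0 <= u -> 0 < f u.
Proof. by move=> xu; rewrite fine_gt0// Pibar_pos. Qed.

Let f_le u v : x0 <= u -> u <= v -> f v <= f u.
Proof.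
move=> xu uv; have /andP[u1 u2] := Pibar_pos xu.
have /andP[v1 v2] := Pibar_pos (le_trans xu uv).
rewrite fine_le ?ge0_fin_numE ?(ltW u1) ?(ltW v1)//.
by apply: Pibar_le => //; exact: lt_le_trans x00 xu.
Qed.

Local Notation wgt k := (M * expR (g * neg_part (lastv k))).

Let Gb := overshoot_kernel_bound P g0 mh hM.

Let shifted u (p : D R * R) := G p.1 (lastv p.1 + p.2 - u).

Let measurable_shifted u : measurable_fun setT (shifted u).
Proof.
apply: (measurableT_comp (measurable_overshoot_kernel P mh)
  (_ : measurable_fun setT (fun p : D R * R => (p.1, lastv p.1 + p.2 - u)))).
apply: measurable_fun_pair => //; apply: measurable_funB => //.
apply: measurable_funD => //; apply: measurableT_comp => //; exact: measurable_lastv.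
Qed.

Let measurable_wgt : measurable_fun setT (fun p : D R * R => wgt p.1).
Proof.
apply: measurable_funM => //; apply: measurableT_comp => //.
apply: measurable_funM => //; apply: measurable_maxr => //.
apply: measurableT_comp => //; apply: measurableT_comp => //; exact: measurable_lastv.
Qed.

(** The post-hitting path is integrated out by [strong_markov_integral]; the bound by [wgt] provides
    the integrability that this asks for. *)
Lemma lhs_num_kernel u : 0 < u - x ->
  (\int[P 0]_(w in hit_event (u - x) T (last_below K)) (wgt (pre_hit (u - x) w).1)%:E < +oo)%E ->
  lhs_num P H T x K u =
  (\int[P 0]_(w in hit_event (u - x) T (last_below K)) (shifted u (pre_hit (u - x) w))%:E)%E.
Proof.
move=> z0 wfin; rewrite (lhs_num_hit levyP H K T0 xpos z0).
pose F (p : (D R * R) * D R) : \bar R := (h p.1.1 (addD (lastv p.1.1 + p.1.2 - u) p.2))%:E.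
have mF : measurable_fun setT F.
  apply/measurable_EFinP.
  apply: (measurableT_comp mh (_ : measurable_fun setT (fun p : (D R * R) * D R =>
    (p.1.1, addD (lastv p.1.1 + p.1.2 - u) p.2)))).
  apply: measurable_fun_pair; first exact: measurableT_comp.
  apply: (measurableT_comp (@measurable_addD R)
    (_ : measurable_fun setT (fun p : (D R * R) * D R => (lastv p.1.1 + p.1.2 - u, p.2)))).
  apply: measurable_fun_pair => //; apply: measurable_funB => //.
  apply: measurable_funD; last exact: measurableT_comp.
  by apply: (measurableT_comp (@measurable_lastv R)); exact: measurableT_comp.
have mL := @measurable_last_below R K.
have Ffin : (\int[P 0]_(w in hit_event (u - x) T (last_below K))
    \int[P 0]_w' `|F (pre_hit (u - x) w, w')| < +oo)%E.
  apply: le_lt_trans wfin; apply: ge0_le_integral => //.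
  - exact: measurable_hit_event.
  - by move=> w _; exact: integral_ge0.
  - apply: measurable_funTS.
    have mAF : measurable_fun setT (abse \o F) by exact: measurableT_comp.
    exact: (measurableT_comp (measurable_fun_integral_snd (P 0) mAF) (@measurable_pre_hit R (u - x))).
  - apply/measurable_EFinP/measurable_funTS.
    exact: (measurableT_comp measurable_wgt (@measurable_pre_hit R (u - x))).
  - move=> w _; apply: (@le_trans _ _ (\int[P 0]_w' (cst (wgt (pre_hit (u - x) w).1)%:E w'))%E).
      apply: ge0_le_integral => //.
        apply: measurableT_comp => //; exact: (measurableT_comp mF (measurable_pair1 (pre_hit (u - x) w))).
      by move=> w' _; rewrite lee_fin; exact: stopped_bound g0 hM _ _.
    rewrite integral_cst// -[leRHS]mule1 le_eqVlt; apply/orP; left; apply/eqP.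
    by congr (_ * _)%E; exact: probability_setT.
apply: etrans (strong_markov_integral levyP mL mF Ffin) _.
apply: eq_integral => w _; move: (pre_hit (u - x) w) => p.
exact: (overshoot_kernelE P g0 mh hM p.1 (lastv p.1 + p.2 - u)).
Qed.

Let kl (s : R * D R) := killD s.1 s.2.
Let phi s := lastv (kl s).

(** On a living path [tauD (kl s)] is [s.1], so the second condition means [s.1 < T]; the first one
    bounds the time for every path, which gives finite measure. *)
Definition slab : set (R * D R) :=
  [set s | [/\ 0 < s.1 <= T, (tauD (kl s) < T%:E)%E & phi s < K]].

Let measurable_phi : measurable_fun setT phi.
Proof. exact: measurableT_comp (@measurable_lastv R) (@measurable_killD R). Qed.

Lemma measurable_slab : measurable slab.
Proof.
have mtT : measurable [set w : D R | (tauD w < T%:E)%E].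
  have mI : measurable `]-oo, T%:E[%classic by exact: emeasurable_itv.
  rewrite (_ : [set _ | _] = (fun w : D R => tauD w) @^-1` `]-oo, T%:E[%classic).
    exact: (measurable_preimage_set (@measurable_tauD R) mI).
  by apply/seteqP; split => w; rewrite /preimage/= in_itv.
rewrite (_ : slab = [set s | 0 < s.1] `&` [set s | s.1 <= T] `&`
  kl @^-1` [set w | (tauD w < T%:E)%E] `&` [set s | phi s < K]).
  apply: measurableI; last exact: measurable_ltr_set.
  apply: measurableI; last first.
    exact: (measurable_preimage_set (@measurable_killD R) mtT).
  by apply: measurableI; [exact: measurable_ltr_set|exact: measurable_ler_set].
apply/seteqP; split => s /=; first by move=> [/andP[-> ->] ? ?].
by move=> [[[s0 sT] ?] ?]; split => //; apply/andP.
Qed.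

Lemma slab_fin : ((leb \x P 0) slab < +oo)%E.
Proof.
have mI : measurable (`]0, T]%classic `*` [set: D R]) by exact: measurableX.
apply: (@le_lt_trans _ _ ((leb \x P 0)%E (`]0, T]%classic `*` [set: D R]))).
  apply: le_measure; rewrite ?inE//; first exact: measurable_slab.
  by move=> s [sT _ _]; split => //=; rewrite in_itv.
have lT : leb `]0, T]%classic = T%:E.
  by rewrite lebesgue_measure_itv/= lte_fin T0 sube0.
rewrite product_measure1E//; apply: lte_mul_pinfty => //.
  suff : leb `]0, T]%classic \is a fin_num by [].
  by rewrite lT.
exact: (finite_measure_lty (P 0) measurableT).
Qed.

Let B u : set (R * D R) := [set s | below (u - x) (kl s)].

Let measurable_B u : measurable (B u).
Proof. exact: (measurable_preimage_set (@measurable_killD R) (measurable_below (u - x))). Qed.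

Let Gs s y := G (kl s) y.

Let measurable_Gs : measurable_fun setT (fun p : (R * D R) * R => Gs p.1 p.2).
Proof.
apply: (measurableT_comp (measurable_overshoot_kernel P mh)
  (_ : measurable_fun setT (fun p : (R * D R) * R => (kl p.1, p.2)))).
apply: measurable_fun_pair => //.
by apply: (measurableT_comp (@measurable_killD R)).
Qed.

(** A path is bounded on [[0, s.1]], hence below [u - x] there for all large [u]; only paths outside
    [Om] are excepted. *)
Let slab_B : {ae (leb \x P 0)%E, forall s, slab s -> forall u : nat -> R,
  u n @[n --> \oo] --> +oo -> \forall n \near \oo, B (u n) s}.
Proof.
have mN : measurable ([set: R] `*` ~` @Om R).
  by apply: measurableX => //; apply: measurableC; exact: measurable_Om.
exists ([set: R] `*` ~` @Om R); split => //.
  rewrite product_measure1E//; last by apply: measurableC; exact: measurable_Om.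
  rewrite [X in (_ * X)%E](_ : _ = 0%E) ?mule0//; exact: levy_Om levyP.
move=> s /= ns; split => // Os; apply: ns => -[/andP[s0 sT] _ _] u u_oo.
have [c hc] := cadlag_bounded s.1 (dcadlag s.2) Os.1.
have [N _ hN] := (cvgryPge u).1 u_oo (x + `|c|).
exists N => // n Nn; have := hN n Nn; rewrite /= => un.
apply/below_killD => //; first by have := normr_ge0 c; lra.
move=> t t0 ts; have := hc t; rewrite t0 ltW// => /(_ erefl).
by rewrite ler_norml => /andP[_]; have := ler_norm c; lra.
Qed.

Lemma hit_limit :
  forall u : nat -> R, u n @[n --> \oo] --> +oo ->
  (lhs_num P H T x K (u n) * ((f (u n))^-1)%:E @[n --> \oo] -->
   \int[sigma_finite_prod leb (P 0)]_(s in slab) \int[leb]_(z in `](- x)%R, +oo[)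
     (Gs s z * (alpha * expR (alpha * phi s) * expR (- alpha * z)))%:E)%E.
Proof.
have P0fin : (Pibar P x0 < +oo)%E by case/andP: (Pibar_pos (lexx x0)).
have [Pi [PiE _ comp]] := compensation levyP x00 P0fin.
have tE y : tail Pi y = f (Num.max y x0) by rewrite /tail PiE.
have phiK s : slab s -> phi s <= K by case=> _ _ /ltW.
have [U1 cr] := crossing_limit alpha0 f_gt0 f_le Pibar_ratio tE (m := sigma_finite_prod leb (P 0)) measurable_slab
  slab_fin measurable_phi gE M0 xpos phiK measurable_Gs (fun s y => Gb (kl s) y)
  (fun s => overshoot_kernel_cont levyP g0 mh hM h_cont (kl s)) measurable_B slab_B.
(* The bound itself is treated as a kernel constant in the overshoot; this yields its integrability
   over the crossing set, required by [lhs_num_kernel]. *)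
pose W (s : R * D R) (y : R) := wgt (kl s).
have mW : measurable_fun setT (fun p : (R * D R) * R => W p.1 p.2).
  by apply: (measurableT_comp measurable_wgt
    (_ : measurable_fun setT (fun p : (R * D R) * R => (kl p.1, p.2)))); apply: measurable_fun_pair => //; exact: (measurableT_comp (@measurable_killD R)).
have W0 s y : 0 <= W s y by rewrite mulr_ge0 ?expR_ge0.
have WM s y : `|W s y| <= wgt (kl s) by rewrite ger0_norm.
have Wcont s : leb.-negligible [set y | ~ (W s z @[z --> y] --> W s y)].
  apply: (@negligibleS _ _ _ _ set0); last exact: negligible_set0.
  by move=> y /=; apply; exact: cvg_cst.
have [U2 cw] := crossing_limit alpha0 f_gt0 f_le Pibar_ratio tE (m := sigma_finite_prod leb (P 0)) measurable_slab
  slab_fin measurable_phi gE M0 xpos phiK mW WM Wcont measurable_B slab_B.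
have [U3 to] := touching_limit f_gt0 f_le Pibar_ratio tE (m := sigma_finite_prod leb (P 0)) measurable_slab
  slab_fin measurable_phi gE M0 xpos phiK.
move=> u u_oo.
pose U := Num.max (Num.max U1 U2) (Num.max U3 (x + x0 + `|K|)).
(* Raising the sequence to the threshold [U] changes finitely many terms and makes every estimate
   hold for all [n]. *)
pose v n := Num.max (u n) U.
have vU n : U <= v n by rewrite le_max lexx orbT.
have vu : {near \oo, v =1 u}.
  have [N _ hN] := (cvgryPge u).1 u_oo U.
  by exists N => // n Nn; rewrite /v max_l//; exact: hN.
suff : (lhs_num P H T x K (v n) * ((f (v n))^-1)%:E @[n --> \oo] -->
   \int[sigma_finite_prod leb (P 0)]_(s in slab) \int[leb]_(z in `](- x)%R, +oo[)
     (Gs s z * (alpha * expR (alpha * phi s) * expR (- alpha * z)))%:E)%E.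
  apply: cvg_trans; apply: near_eq_cvg; apply: filterS vu => n e.
  by rewrite e.
have v_oo : v n @[n --> \oo] --> +oo.
  apply/cvgryPge => A; have [N _ hN] := (cvgryPge u).1 u_oo A.
  by exists N => // n Nn; rewrite /v /= le_max hN.
have v1 n : U1 <= v n by apply: le_trans (vU n); rewrite /U !le_max lexx.
have v2 n : U2 <= v n by apply: le_trans (vU n); rewrite /U !le_max lexx orbT.
have v3 n : U3 <= v n by apply: le_trans (vU n); rewrite /U !le_max lexx !orbT.
have v4 n : x + x0 + `|K| <= v n by apply: le_trans (vU n); rewrite /U !le_max lexx !orbT.
have {cr} [icr ccr] := cr v v1 v_oo.
have {cw} [icw _] := cw v v2 v_oo.
have {to} [ito cto] := to v v3 v_oo.
have z0 n : 0 < v n - x by move: (v4 n) (normr_ge0 K) x00 xpos; move: (v n) `|K| => a b; lra.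
have Kz n : K + x0 <= v n - x by move: (v4 n) (ler_norm K) x00 xpos; move: (v n) `|K| => a b; lra.
have xv n : x0 <= v n by move: (v4 n) (normr_ge0 K) x00 xpos; move: (v n) `|K| => a b; lra.
have fv n : 0 < f (v n) by exact: f_gt0.
have overE n : [set p : (R * D R) * R | 0 < p.1.1 <= T] `&` @kill_pair R @^-1` crossing (v n - x) T K =
    over_level slab phi x B (v n).
  apply/seteqP; split => -[s y] /=.
    by move=> [s0 [/= h1 h2 h3 h4]].
  by move=> [[s0 h1 h2] h3 h4].
have touchE n : [set p : (R * D R) * R | 0 < p.1.1 <= T] `&` @kill_pair R @^-1` touching (v n - x) T K `<=`
    at_level slab phi x (v n).
  move=> [s y] /= [s0 [/= h1 h2 h3 /eqP h4]].
  by split.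
have mO n : measurable (over_level slab phi x B (v n)).
  exact: (measurable_over_level x measurable_slab measurable_phi measurable_B).
have mT n : measurable (at_level slab phi x (v n)).
  exact: (measurable_at_level x measurable_slab measurable_phi).
pose mb : {measure set _ -> \bar R} := (sigma_finite_prod leb (P 0) \x Pi)%E.
(* The hitting event splits into strict crossings, which produce the limit, and hits exactly on the
   level, whose contribution is shown to vanish. *)
pose HC n := hit_event (v n - x) T (crossing (v n - x) T K).
pose HR n := hit_event (v n - x) T (last_below K `&` ~` crossing (v n - x) T K).
have mHC n : measurable (HC n) by apply: measurable_hit_event; exact: measurable_crossing.
have mHR n : measurable (HR n).
  apply: measurable_hit_event; apply: measurableI; first exact: measurable_last_below.
  by apply: measurableC; exact: measurable_crossing.
have HU n : hit_event (v n - x) T (last_below K) = HC n `|` HR n.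
  apply/seteqP; split => w.
    move=> [wT wL]; have [c|c] := pselect (crossing (v n - x) T K (pre_hit (v n - x) w)).
      by left; split.
    by right; split.
  move=> [] [wT]; first by case=> _ _ lK _; split.
  by move=> [lK _]; split.
have HD n : [disjoint HC n & HR n].
  by apply/disj_setPS => w [[_ c] [_ [_ nc]]]; exact: nc.
have CE n : (\int[P 0]_(w in HC n) (shifted (v n) (pre_hit (v n - x) w))%:E =
    \int[mb]_(p in over_level slab phi x B (v n)) (Gs p.1 (phi p.1 + p.2 - v n))%:E)%E.
  have ms : measurable_fun setT (EFin \o shifted (v n)) by exact/measurable_EFinP.
  have := integral_hit_crossing levyP (z0 n) T0 (Kz n) comp ms.
  by rewrite overE.
have WE n : (\int[P 0]_(w in HC n) (wgt (pre_hit (v n - x) w).1)%:E =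
    \int[mb]_(p in over_level slab phi x B (v n)) (W p.1 (phi p.1 + p.2 - v n))%:E)%E.
  have mw : measurable_fun setT (EFin \o (fun p : D R * R => wgt p.1)) by exact/measurable_EFinP.
  have := integral_hit_crossing levyP (z0 n) T0 (Kz n) comp mw.
  by rewrite overE.
have RE n : (\int[P 0]_(w in HR n) (wgt (pre_hit (v n - x) w).1)%:E <=
    \int[mb]_(p in at_level slab phi x (v n)) (wgt (kl p.1))%:E)%E.
  have mw : measurable_fun setT (EFin \o (fun p : D R * R => wgt p.1)) by exact/measurable_EFinP.
  have w0 (p : D R * R) : (0 <= (EFin \o (fun p : D R * R => wgt p.1)) p)%E.
    by rewrite lee_fin mulr_ge0 ?expR_ge0.
  apply: le_trans (integral_hit_touching x00 (z0 n) T0 (Kz n) comp mw w0) _.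
  apply: ge0_subset_integral.
  - apply: measurableI; first exact: measurable_time_slab.
    by apply: (measurable_preimage_set (@measurable_kill_pair R)); exact: measurable_touching.
  - exact: mT.
  - apply: measurable_funTS; exact: (measurableT_comp mw (@measurable_kill_pair R)).
  - by move=> p _; exact: w0.
  - exact: touchE.
have WO n := integral_divr (m := mb) (mO n) (fv n) (icw n).
have CO n := integral_divr (m := mb) (mO n) (fv n) (icr n).
have TO n := integral_divr (m := mb) (mT n) (fv n) (ito n).
have mwp n : measurable_fun setT (fun w => (wgt (pre_hit (v n - x) w).1)%:E : \bar R).
  apply/measurable_EFinP.
  exact: (measurableT_comp measurable_wgt (@measurable_pre_hit R (v n - x))).
have wp0 n w : (0 <= (wgt (pre_hit (v n - x) w).1)%:E :> \bar R)%E.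
  by rewrite lee_fin mulr_ge0 ?expR_ge0.
have msp n : measurable_fun setT (fun w => (shifted (v n) (pre_hit (v n - x) w))%:E : \bar R).
  apply/measurable_EFinP.
  exact: (measurableT_comp (@measurable_shifted (v n)) (@measurable_pre_hit R (v n - x))).
have Wfin n : (\int[P 0]_(w in hit_event (v n - x) T (last_below K))
    (wgt (pre_hit (v n - x) w).1)%:E < +oo)%E.
  rewrite HU ge0_integral_setU//; [|exact: measurable_funTS].
  apply: lte_add_pinfty.
    rewrite WE; have [/integrable_fin_num Wf _] := WO n.
    by rewrite ltey_eq Wf//; exact: mO.
  apply: le_lt_trans (RE n) _; have [/integrable_fin_num Wf _] := TO n.
  by rewrite ltey_eq Wf//; exact: mT.
pose RR n := (\int[P 0]_(w in HR n) (shifted (v n) (pre_hit (v n - x) w))%:E)%E.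
pose tt n := (\int[mb]_(p in at_level slab phi x (v n)) (wgt (kl p.1) / f (v n))%:E)%E.
have lhsE n : (lhs_num P H T x K (v n) = \int[mb]_(p in over_level slab phi x B (v n))
    (Gs p.1 (phi p.1 + p.2 - v n))%:E + RR n)%E.
  rewrite (lhs_num_kernel (z0 n) (Wfin n)) HU integral_setU//; first by rewrite CE.
  exact: measurable_funTS.
(* On hits without crossing the kernel is replaced by its bound, whose integral is controlled by
   touching jumps. *)
have RRb n : (`|RR n| <= \int[mb]_(p in at_level slab phi x (v n)) (wgt (kl p.1))%:E)%E.
  apply: le_trans (RE n); apply: (@le_trans _ _
    (\int[P 0]_(w in HR n) `|(shifted (v n) (pre_hit (v n - x) w))%:E|)%E).
    by apply: le_abse_integral => //; exact: measurable_funTS.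
  apply: ge0_le_integral => //.
  - by apply: measurableT_comp => //; exact: measurable_funTS.
  - exact: measurable_funTS.
  - by move=> w _; rewrite lee_fin; exact: Gb.
have c0 n : 0 <= (f (v n))^-1 by rewrite invr_ge0 ltW.
have RRt n : (`|RR n * ((f (v n))^-1)%:E| <= tt n)%E.
  rewrite /tt; have [_ ->] := TO n.
  rewrite abseM (gee0_abs (_ : 0 <= ((f (v n))^-1)%:E)%E) ?lee_fin//.
  by apply: lee_wpmul2r; rewrite ?lee_fin//; exact: RRb.
have RRfin n : RR n \is a fin_num.
  rewrite fin_num_abs (le_lt_trans (RRb n))//.
  by have [/integrable_fin_num Wf _] := TO n; rewrite ltey_eq Wf//; exact: mT.
have lhsdE n : (lhs_num P H T x K (v n) * ((f (v n))^-1)%:E =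
    \int[mb]_(p in over_level slab phi x B (v n)) (Gs p.1 (phi p.1 + p.2 - v n) / f (v n))%:E
    + RR n * ((f (v n))^-1)%:E)%E.
  by have [_ ->] := CO n; rewrite lhsE muleDl// fin_num_adde_defl.
under eq_fun do rewrite lhsdE.
have R0 : (RR n * ((f (v n))^-1)%:E @[n --> \oo] --> 0)%E.
  apply/cvg_abse0P; apply: (@squeeze_cvge _ _ _ _ (fun=> 0%E) _ tt).
  - by apply: nearW => n; rewrite /= abse_ge0 RRt.
  - exact: cvg_cst.
  - exact: cto.
have := cvgeD (_ : _ +? 0)%E ccr R0; rewrite adde0; apply.
exact: fin_num_adde_defl.
Qed.

End hit_limit.

Lemma dominated_product_integrable d1 d2 (T1 : measurableType d1) (T2 : measurableType d2)
    (R : realType) (m1 : {sigma_finite_measure set T1 -> \bar R})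
    (m2 : {sigma_finite_measure set T2 -> \bar R}) (A : set T1) (k : T2 -> R)
    (F : T1 * T2 -> R) :
  measurable A -> (m1 A < +oo)%E -> measurable_fun setT k -> (forall y, 0 <= k y) ->
  (\int[m2]_y (k y)%:E < +oo)%E -> measurable_fun setT F ->
  (forall x y, `|F (x, y)| <= \1_A x * k y) ->
  (m1 \x m2)%E.-integrable setT (EFin \o F).
Proof.
move=> mA Afin mk k0 kfin mF Fk.
have mEF : measurable_fun setT (EFin \o F) by exact/measurable_EFinP.
have mEk : measurable_fun setT (EFin \o k) by exact/measurable_EFinP.
apply/(integrable12ltyP m1 m2 mEF).
have k_ge0 : (0 <= \int[m2]_y (k y)%:E)%E by apply: integral_ge0 => y _; rewrite lee_fin.
have mI : measurable_fun setT (fun x => (\1_A x)%:E : \bar R).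
  exact/measurable_EFinP/measurable_indic.
apply: (@le_lt_trans _ _ (\int[m1]_x ((\int[m2]_y (k y)%:E) * (\1_A x)%:E))%E); last first.
  rewrite ge0_integralZl//.
  rewrite integral_indic// setIT; apply: lte_mul_pinfty => //.
  by rewrite ge0_fin_numE.
apply: ge0_le_integral => //.
- by move=> x _; exact: integral_ge0.
- have mAF : measurable_fun setT (abse \o (EFin \o F)) by exact: measurableT_comp.
  exact: (measurable_fun_integral_snd m2 mAF).
- by apply: emeasurable_funM.
- move=> x _; rewrite muleC -ge0_integralZl//; last by move=> y _; rewrite lee_fin.
  apply: ge0_le_integral => //.
  + apply: measurableT_comp => //; exact: (measurableT_comp mEF (measurable_pair1 x)).
  + exact: emeasurable_funM.
  + by move=> y _; rewrite -EFinM lee_fin.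
Qed.

(** * Identification of the limit with [rhs] *)

Section limit_measure.
Variables (R : realType) (P : R -> probability (D R) R).
Hypothesis levyP : levy_family P.
Variables (H : D R -> D R -> R) (T K g M alpha : R).
Hypotheses (T0 : 0 < T) (alpha0 : 0 < alpha) (gE : 0 <= g < alpha).
Local Notation h := (stopped H T).
Local Notation leb := (@lebesgue_measure R).
Local Notation G := (overshoot_kernel P H T).
Local Notation m := (sigma_finite_prod leb (P 0)).
Local Notation A := (slab T K).
Hypothesis mh : measurable_fun setT (fun p : D R * D R => h p.1 p.2).
Hypothesis hM : forall w w', `|h w w' * expfac g w| <= M.

Let g0 : 0 <= g. Proof. by case/andP: gE. Qed.
Let M0 : 0 <= M. Proof. exact: bound_ge0 hM. Qed.

Let kl (s : R * D R) := killD s.1 s.2.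
Let phi s := lastv (kl s).

Let mkl : measurable_fun setT kl. Proof. exact: (@measurable_killD R). Qed.
Let mphi : measurable_fun setT phi.
Proof. exact: measurableT_comp (@measurable_lastv R) mkl. Qed.
Let mA : measurable A. Proof. exact: measurable_slab. Qed.

(** The density with respect to [dt P(dw)] of a measure whose image under [kl] is the marginal of
    [mu_K^T] on paths. *)
Definition slab_density (s : R * D R) : R := \1_A s * expR (alpha * phi s).

Let mrho : measurable_fun setT slab_density.
Proof.
apply: measurable_funM; first exact: measurable_indic.
by apply: measurableT_comp => //; exact: measurable_funM.
Qed.

Let rho0 s : 0 <= slab_density s.
Proof. by rewrite mulr_ge0 ?expR_ge0// indicE. Qed.

Let C := M * expR (alpha * `|K|).

(** Since [g < alpha], the factor [exp(alpha phi)] beats the growth allowed to [H] when [phi <= 0];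
    for [0 < phi < K] it is at most [exp(alpha |K|)], the origin of [C]. *)
Let weight_rho s : M * expR (g * neg_part (phi s)) * slab_density s <= \1_A s * C.
Proof.
have [sA|nA] := boolP (s \in A); last first.
  by rewrite /slab_density indicE (negbTE nA) mul0r mulr0 mul0r.
have pK : phi s < K by move: sA; rewrite inE => -[].
rewrite /slab_density indicE sA !mul1r -mulrA -expRD; apply: ler_wpM2l => //.
rewrite ler_expR /neg_part; case/andP: gE => _ ga.
have kK := ler_norm K.
have [p0|p0] := leP (phi s) 0.
  rewrite max_r ?oppr_ge0//; apply: (@le_trans _ _ 0); last by rewrite mulr_ge0// ltW.
  rewrite mulrN addrC -mulrBl; apply: mulr_ge0_le0 => //.
  by rewrite subr_ge0 ltW.
rewrite max_l ?oppr_le0 ?(ltW p0)// mulr0 add0r ler_pM2l//.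
by apply: le_trans kK; exact: ltW.
Qed.

Let C0 : 0 <= C. Proof. by rewrite mulr_ge0 ?expR_ge0. Qed.

Let J (s : R * D R) (w' : D R) : R := h (kl s) w' * slab_density s.

Let J_bound s w' : `|J s w'| <= \1_A s * C.
Proof.
rewrite normrM (ger0_norm (rho0 s)); apply: le_trans (weight_rho s).
by apply: ler_wpM2r; [exact: rho0|exact: (stopped_bound g0 hM)].
Qed.

Let mJ : measurable_fun setT (fun p : (R * D R) * D R => J p.1 p.2).
Proof.
apply: measurable_funM; last exact: measurableT_comp mrho measurable_fst.
apply: (measurableT_comp mh
  (_ : measurable_fun setT (fun p : (R * D R) * D R => (kl p.1, p.2)))).
by apply: measurable_fun_pair => //; exact: measurableT_comp mkl measurable_fst.
Qed.

Let mJ_add : measurable_fun setT (fun p : (R * (R * D R)) * D R => J p.1.2 (addD p.1.1 p.2)).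
Proof.
apply: (measurableT_comp mJ
  (_ : measurable_fun setT (fun p : (R * (R * D R)) * D R => (p.1.2, addD p.1.1 p.2)))).
apply: measurable_fun_pair; first exact: measurableT_comp measurable_snd measurable_fst.
apply: (measurableT_comp (@measurable_addD R)
  (_ : measurable_fun setT (fun p : (R * (R * D R)) * D R => (p.1.1, p.2)))).
by apply: measurable_fun_pair => //; exact: measurableT_comp measurable_fst measurable_fst.
Qed.

Let slab_lty : (m A < +oo)%E.
Proof. exact: slab_fin. Qed.

Let Pfin : (\int[P 0]_w (cst C w)%:E < +oo)%E.
Proof.
have -> : (\int[P 0]_w (cst C w)%:E = C%:E * P 0 setT)%E by exact: (integral_cst (P 0) measurableT C%:E).
by apply: lte_mul_pinfty => //; exact: (finite_measure_lty (P 0) measurableT).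
Qed.

(** With the indicator of [tau 0 w' < T] absorbed in [h], the iterated integral is that of a bounded
    function over a set of finite measure. The two integrands agree on [Om] at every time. *)
Lemma mu_intE (w' : D R) : ((ind R (tau 0%R w' < T%:E)%E)%:E * mu_int P H alpha T K w' =
  \int[m]_s (J s w')%:E)%E.
Proof.
have Jint : (leb \x P 0)%E.-integrable setT (fun s => (J s w')%:E).
  have mJw : measurable_fun setT (fun s => (J s w')%:E : \bar R).
    by apply/measurable_EFinP; exact: (measurableT_comp mJ (measurable_pair2 w')).
  have lT : (leb `]0%R, T] < +oo)%E by rewrite lebesgue_measure_itv/= lte_fin T0 sube0 ltry.
  have mI : measurable `]0%R, T]%classic by exact: measurable_itv.
  apply: (dominated_product_integrable (m1 := leb) (m2 := P 0) mI lT (measurable_cst C) (fun=> C0) Pfin).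
    exact: (measurableT_comp mJ (measurable_pair2 w')).
  move=> t w; apply: le_trans (J_bound _ _) _; apply: ler_wpM2r => //.
  rewrite !indicE; have [/set_mem [/= tT _ _]|//] := boolP ((t, w) \in A).
  by rewrite mem_set//= in_itv.
transitivity (\int[leb]_t \int[P 0]_w (J (t, w) w')%:E)%E; last first.
  exact: (@integral12_prod_meas1 _ _ _ _ _ leb (P 0) _ Jint).
rewrite /ind; case: ifPn => tT; last first.
  rewrite mul0e; apply/esym/integral0_eq => t _; apply: integral0_eq => w _.
  by rewrite /J /stopped /ind (negbTE tT) mulr0 mul0r.
rewrite mul1e /mu_int integral_mkcond; apply: eq_integral => t _.
transitivity (\int[P 0]_w (if t \in `[0%R, T[%classic then (H (toD (kill w t%:E)) w' *
       (if leftlim w t is Some phi then ind R (phi < K) * expR (alpha * phi)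
        else 0))%:E else 0))%E.
  by rewrite patchE; case: ifP => // _; rewrite integral0.
apply: (levy_ae_eq_integral levyP) => w /set_mem Ow; have [aw w0] := Ow.
have -> : J (t, w) w' = H (toD (kill w t%:E)) w' * slab_density (t, w).
  by rewrite /J /stopped /ind tT mulr1.
rewrite /slab_density indicE.
(* Time 0 belongs to [[0, T[] but not to the slab; no left limit exists there, so the integrand of
   [mu_int] is 0. *)
have [t0|t0] := leP t 0.
  rewrite memNset; last by move=> [/= /andP[h1 _] _ _]; move: h1; rewrite ltNge t0.
  rewrite mul0r mulr0; case: ifPn => // /set_mem; rewrite /= in_itv/= => /andP[t0' _].
  have -> : t = 0 by apply/eqP; rewrite eq_le t0 t0'.
  by rewrite (leftlim0 (dcadlag w)) mulr0.
have ll := alive_left_conv (dcadlag w) aw t0.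
rewrite (left_conv_leftlim ll).
have phE : phi (t, w) = llim w t by exact: lastv_killD.
have lvE : lastv (killD t w) = llim w t by exact: lastv_killD.
have tdE : tauD (killD t w) = t%:E by exact: tauD_killD.
rewrite phE; have [tT'|tT'] := ltP t T; last first.
  have -> : ((t, w) \in A) = false.
    apply: memNset => -[_ /=]; rewrite tdE lte_fin.
    by rewrite ltNge tT'.
  have -> : (t \in `[0%R, T[%classic) = false.
    by apply: memNset => /=; rewrite in_itv/= => /andP[_]; rewrite ltNge tT'.
  by rewrite mul0r mulr0.
have -> : (t \in `[0%R, T[%classic) = true.
  by apply: mem_set => /=; rewrite in_itv/= (ltW t0).
rewrite /ind; have [lK|lK] := ltP (llim w t) K.
  have -> : ((t, w) \in A) = true.
    apply: mem_set; split => /=; first by rewrite t0 ltW.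
      by rewrite tdE lte_fin.
    by rewrite lvE.
  by [].
have -> : ((t, w) \in A) = false.
  apply: memNset => -[_ _ /=]; rewrite lvE.
  by rewrite ltNge lK.
by rewrite !mul0r.
Qed.

Let kernel_slab_bound s z : `|slab_density s * G (kl s) z| <= \1_A s * C.
Proof.
rewrite normrM (ger0_norm (rho0 s)) mulrC; apply: le_trans (weight_rho s).
by apply: ler_wpM2r; [exact: rho0|exact: (overshoot_kernel_bound P g0 mh hM)].
Qed.

Let mJz z : measurable_fun setT (fun p : (R * D R) * D R => J p.1 (addD z p.2)).
Proof.
apply: (measurableT_comp mJ_add (_ : measurable_fun setT
  (fun p : (R * D R) * D R => ((z, p.1), p.2)))).
by apply: measurable_fun_pair => //; exact: measurable_fun_pair.
Qed.

(** Fubini exchanges the expectation from [z] with the integral over the slab; the inner expectation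
    is the kernel. *)
Lemma mu_int_start z :
  (\int[P z]_w' ((ind R (tau 0%R w' < T%:E)%E)%:E * mu_int P H alpha T K w') =
   \int[m]_s (slab_density s * G (kl s) z)%:E)%E.
Proof.
have mEJ : measurable_fun setT (fun p : (R * D R) * D R => (J p.1 p.2)%:E : \bar R).
  exact/measurable_EFinP.
have mF : measurable_fun setT (fun w' : D R => \int[m]_s (J s w')%:E)%E.
  have mJs : measurable_fun setT (fun p : D R * (R * D R) => (J p.2 p.1)%:E : \bar R).
    exact: (measurableT_comp mEJ (@measurable_swap _ _ _ _)).
  exact: (measurable_fun_integral_snd m mJs).
transitivity (\int[P z]_w' \int[m]_s (J s w')%:E)%E.
  by apply: eq_integral => w' _; exact: mu_intE.
rewrite (levy_start_integral levyP z mF).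
have Jint := dominated_product_integrable (m1 := m) (m2 := P 0) mA slab_lty
  (measurable_cst C) (fun=> C0) Pfin (mJz z) (fun s w' => J_bound s (addD z w')).
rewrite -[LHS](Fubini Jint); apply: eq_integral => s _.
transitivity (\int[P 0]_w' ((slab_density s)%:E * (h (kl s) (addD z w'))%:E))%E.
  by apply: eq_integral => w' _; rewrite /= /J -EFinM mulrC.
rewrite integralZl//; last exact: (overshoot_kernel_integrable P g0 mh hM (kl s) z).
by rewrite (overshoot_kernelE P g0 mh hM) -EFinM.
Qed.

(** Fubini again, now between the slab and the overshoot; the bound [C] times the exponential
    density on []- x, +oo[] is integrable. *)
Lemma rhsE x : (\int[m]_(s in A) \int[leb]_(z in `](- x)%R, +oo[)
    (G (killD s.1 s.2) z *
      (alpha * expR (alpha * lastv (killD s.1 s.2)) * expR (- alpha * z)))%:E =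
  rhs P H alpha T x K)%E.
Proof.
pose I := `](- x)%R, +oo[%classic : set R.
pose k z := alpha * expR (- alpha * z) * \1_I z.
have k0 z : 0 <= k z by rewrite !mulr_ge0 ?expR_ge0 ?(ltW alpha0)// indicE.
have mI : measurable I by exact: measurable_itv.
have mk : measurable_fun setT k.
  apply: measurable_funM; last exact: (measurable_indic mI).
  exact: measurable_funM (measurable_cst alpha) (@measurable_exp_scale R alpha).
have kE : (\int[leb]_z (k z)%:E = (expR (- alpha * - x))%:E)%E.
  rewrite -(exp_tail alpha0 (- x)) [RHS]integral_mkcond; apply: eq_integral => z _.
  by rewrite patchE /k indicE -/I; case: (z \in I); rewrite ?mulr1 ?mulr0.
have mCk : measurable_fun setT (fun z => C * k z) by exact: measurable_funM.
have Ck0 z : 0 <= C * k z by rewrite mulr_ge0.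
have Ckfin : (\int[leb]_z (C * k z)%:E < +oo)%E.
  have mEk : measurable_fun setT (fun z => (k z)%:E : \bar R) by exact/measurable_EFinP.
  have kE0 z : [set: R] z -> (0 <= (k z)%:E)%E by rewrite lee_fin.
  have C0E : (0 <= C%:E)%E by rewrite lee_fin.
  have := ge0_integralZl leb measurableT mEk kE0 C0E.
  rewrite kE; under eq_integral do rewrite -EFinM.
  by move=> ->; rewrite -EFinM ltry.
pose F (p : (R * D R) * R) := k p.2 * (slab_density p.1 * G (kl p.1) p.2).
have mF : measurable_fun setT F.
  apply: measurable_funM; first exact: measurableT_comp mk measurable_snd.
  apply: measurable_funM; first exact: measurableT_comp mrho measurable_fst.
  apply: (measurableT_comp (measurable_overshoot_kernel P mh)
    (_ : measurable_fun setT (fun p : (R * D R) * R => (kl p.1, p.2)))).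
  by apply: measurable_fun_pair => //; exact: measurableT_comp mkl measurable_fst.
have Fk s z : `|F (s, z)| <= \1_A s * (C * k z).
  rewrite /F /= normrM (ger0_norm (k0 z)) (_ : \1_A s * _ = k z * (\1_A s * C)); last by ring.
  by apply: ler_wpM2l => //; exact: kernel_slab_bound.
have Fint := dominated_product_integrable (m1 := m) (m2 := leb) mA slab_lty
  mCk Ck0 Ckfin mF Fk.
transitivity (\int[m]_s \int[leb]_z (F (s, z))%:E)%E.
  rewrite integral_mkcond; apply: eq_integral => s _; rewrite patchE.
  case: ifPn => [sA|nA]; last first.
    apply/esym/integral0_eq => z _.
    by rewrite /F /slab_density /= indicE (negbTE nA) !(mul0r, mulr0).
  rewrite integral_mkcond; apply: eq_integral => z _; rewrite patchE /F /k /= !indicE -/I.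
  case: (z \in I); last by rewrite !(mul0r, mulr0).
  rewrite /slab_density indicE sA !(mulr1, mul1r); congr EFin.
  by rewrite /phi /kl; ring.
rewrite (Fubini Fint) /rhs [RHS]integral_mkcond; apply: eq_integral => z _.
rewrite patchE; transitivity ((k z)%:E * \int[m]_s (slab_density s * G (kl s) z)%:E)%E.
  have kint : m.-integrable setT (fun s => (slab_density s * G (kl s) z)%:E).
    have mkz : measurable_fun setT (fun s => slab_density s * G (kl s) z).
      apply: measurable_funM => //; apply: (measurableT_comp (measurable_overshoot_kernel P mh)
        (_ : measurable_fun setT (fun s => (kl s, z)))).
      exact: measurable_fun_pair.
    have iA : m.-integrable setT (fun s => (\1_A s * C)%:E).
      rewrite (_ : (fun s => _) = (EFin \o cst C) \_ A); last first.
        by apply/funext => s; rewrite patchE indicE; case: ifP => _; rewrite ?mul1r ?mul0r.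
      have iC : m.-integrable A (EFin \o cst C).
        apply: (@bounded_integrable _ _ _ _ _ _ C) => //.
        by move=> s _; rewrite /= ger0_norm.
      by move: iC => /(@integrable_mkcond _ _ _ m A (EFin \o cst C) mA).
    apply: (le_integrable measurableT _ _ iA); first exact/measurable_EFinP.
    move=> s _; rewrite lee_fin [leRHS]ger0_norm; first exact: kernel_slab_bound.
    by rewrite mulr_ge0// indicE.
  by rewrite -integralZl//; apply: eq_integral => s _; rewrite -EFinM.
rewrite -/I /k indicE mu_int_start; case: (z \in I); first by rewrite mulr1.
by rewrite mulr0 mul0e.
Qed.

End limit_measure.

(** Dominated convergence works along sequences. A neighbourhood that is missed at arbitrarily large
    arguments yields a sequence contradicting the hypothesis. *)
Lemma cvg_pinfty_seq (R : realType) (T : topologicalType) (f : R -> T) (l : T) :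
  (forall u : nat -> R, u n @[n --> \oo] --> +oo -> f (u n) @[n --> \oo] --> l) ->
  f x @[x --> +oo] --> l.
Proof.
move=> fl V nV; apply: contrapT => nf.
have /choice[u uE] : forall n : nat, exists x, n%:R < x /\ ~ V (f x).
  move=> n; apply: contrapT => nx; apply: nf; exists n%:R; split; first exact: num_real.
  by move=> x nlx; apply: contrapT => nV'; apply: nx; exists x.
have u_oo : u n @[n --> \oo] --> +oo.
  apply/cvgryPge => A; have [N _ hN] := nbhs_infty_ger A.
  by exists N => // n /hN An; exact: le_trans An (ltW (uE n).1).
have [N _ hN] := fl u u_oo V nV.
by have [_] := uE N; apply; exact: hN (leqnn N).
Qed.

Theorem theorem3p1 (R : realType) (P : R -> probability (D R) R)
    (alpha T x K : R) (H : D R -> D R -> R) :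
  levy_family P -> 0 < alpha -> Pibar_in_L alpha P ->
  0 < T -> 0 <= x -> in_HT P alpha T H ->
  (lhs_num P H T x K u * ((fine (Pibar P u))^-1)%:E)%E @[u --> +oo]
    --> rhs P H alpha T x K.
Proof.
move=> levyP alpha0 [x0 [x00 [Ppos Pratio]]] T0 xpos [mh [g [M [gE hM]]] h_cont].
apply: cvg_pinfty_seq => u u_oo.
rewrite -(rhsE levyP K T0 alpha0 gE mh hM x).
exact: (hit_limit levyP T0 xpos alpha0 x00 gE mh hM h_cont Ppos Pratio u_oo).
Qed.
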